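(* Let $V_1=Sp(2)/SU(2)$ be equipped with the normal homogeneous metric described in the context, let $\gamma$ be a unit-speed geodesic of $V_1$ with $\gamma(0)=o$, and let $A_t$ be the Jacobi tensor field along $\gamma$, i.e. the solution of $A^{2)}_t=-A_tR_t$ with $A_0=0$, $A^{1)}_0=I$. Then $$A_t=\sum_{k=0}^\infty\frac1{k!}\,\beta_k\,t^k,$$ where $\beta_k=\beta_k(0)$ and the functions $\alpha_k(t),\beta_k(t)$ are given by $\alpha_0=\beta_0=0$, $\alpha_1=0$, $\beta_1=I$ and $$\beta_k(t)=\alpha_{k-1}(t)+\beta_{k-1}'(t),\qquad \alpha_k(t)=\alpha_{k-1}'(t)-R_t\,\beta_{k-1}(t)\qquad(k\ge2).$$ Moreover, the coefficients $\beta_k=\beta_k(0)$ are functions of $R_0$, $R^{1)}_0$ and $R^{2)}_0$ only.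
   Context: The manifold $V_1$. Let $E_{kl}$ be the $4\times4$ matrix units. $sp(2)$ is the real Lie algebra of skew-Hermitian $4\times 4$ matrices $$\begin{pmatrix}a_{11}&a_{12}&a_{13}&a_{14}\\-\overline a_{12}&-a_{11}&\overline a_{14}&-\overline a_{13}\\-\overline a_{13}&-a_{14}&a_{33}&a_{34}\\-\overline a_{14}&a_{13}&-\overline a_{34}&-a_{33}\end{pmatrix}$$ with $a_{11},a_{33}$ purely imaginary and the other $a_{ij}$ complex. Put $S_1=i(E_{11}-E_{22})$, $S_2=i(E_{33}-E_{44})$, $S_3=E_{12}-E_{21}$, $S_4=i(E_{12}+E_{21})$, $S_5=E_{34}-E_{43}$, $S_6=i(E_{34}+E_{43})$, $S_7=E_{13}-E_{31}-E_{24}+E_{42}$, $S_8=i(E_{13}+E_{31}+E_{24}+E_{42})$, $S_9=E_{14}-E_{41}+E_{23}-E_{32}$, $S_{10}=i(E_{14}+E_{41}-E_{23}-E_{32})$, and $Q_1=\frac12S_1-\frac32S_2$, $Q_2=\sqrt{5/2}\,S_3$, $Q_3=\sqrt{5/2}\,S_4$, $Q_4=\frac{\sqrt6}2S_5-\frac{\sqrt2}2S_7$, $Q_5=\frac{\sqrt6}2S_6-\frac{\sqrt2}2S_8$, $Q_6=\frac{\sqrt5}2S_9$, $Q_7=\frac{\sqrt5}2S_{10}$, $Q_8=\frac32S_1+\frac12S_2$, $Q_9=S_5+\frac{\sqrt3}2S_7$, $Q_{10}=S_6+\frac{\sqrt3}2S_8$. The inner product $\langle A,B\rangle=-\frac15\mathrm{Tr}(AB)$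 on $sp(2)$ is $\mathrm{Ad}(Sp(2))$-invariant and $\{Q_1,\dots,Q_{10}\}$ is orthonormal. $\mathbf h=\mathrm{span}\{Q_8,Q_9,Q_{10}\}\cong su(2)$ is the Lie algebra of the subgroup $H\cong SU(2)$ of $Sp(2)$, and $\mathbf m=\mathrm{span}\{Q_1,\dots,Q_7\}$ is its orthogonal complement, identified with $T_oV_1$, where $o$ is the coset of $H$. $V_1=Sp(2)/H$ carries the $Sp(2)$-invariant Riemannian metric induced by $\langle\cdot,\cdot\rangle|_{\mathbf m}$ (a normal homogeneous space). Jacobi operator. $\nabla$ is the Levi-Civita connection and $R$ its curvature tensor, $R(X,Y)Z=\nabla_X\nabla_YZ-\nabla_Y\nabla_XZ-\nabla_{[X,Y]}Z$. Along $\gamma$, $R_t=R(\cdot,\gamma')\gamma'(t)$ and $R^{i)}_t=(\nabla_{\gamma'}\cdots\nabla_{\gamma'}R)(\cdot,\gamma')\gamma'(t)$ ($i$ covariant derivatives of $R$). Matrix conventions. $\{E_1,\dots,E_7\}$ is the orthonormal frame along $\gamma$ obtained by Levi-Civita parallel translation of $\{Q_1,\dots,Q_7\}$; all tensors along $\gamma$ are written as $7\times7$ matrix functions of $t$ in this frame ($R_t$ is symmetric), so that covariant differentiation along $\gamma$ (denoted by $'$ or by the exponents $1),2),\dots$) is entrywise differentiation. $A_t=(A^j_{i,t})$, with $i$ the row index and $j$ the column index, is such that $Y_{i,t}=\sum_jA^j_{i,t}E_{j,t}$ are the Jacobi fields along $\gamma$ (solutions of $Y''+R_tY=0$) with $Y_i(0)=0$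 and $Y_i'(0)=Q_i$; this is the equation $A^{2)}_t=-A_tR_t$ with $A_0=0$, $A_0^{1)}=I$. *)

(* Defs.v *)
(* Differential geometry of V_1 = Sp(2)/H is expressed on the total space of
   the projection pi : Sp(2) -> V_1, g |-> gH:
   - a smooth function on V_1 is a right H-invariant smooth function on Sp(2);
   - a pair (g, x), g in Sp(2), x in m, stands for the tangent vector
     d/ds|_0 (g exp(s x) H) of V_1 at gH (TV_1 = Sp(2) x_H m), so that
     (g h, h^-1 x h) and (g, x) stand for the same vector;
   - a vector field on V_1 is therefore a smooth map Y : Sp(2) -> m with
     Y(g h) = h^-1 Y(g) h;
   - a smooth curve of V_1 is the projection of a smooth curve c of Sp(2), and
     a vector field along it is a map y : R -> m, y(t) standing for (c(t), y(t)).
   Only the values on Sp(2) of the maps defined on all matrices matter. *)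
From HB Require Import structures.
From mathcomp Require Import all_boot all_order all_algebra.
From mathcomp Require Import complex.
From mathcomp Require Import all_classical all_reals all_analysis.
Import Order.TTheory GRing.Theory Num.Theory numFieldNormedType.Exports.

Set Implicit Arguments.
Unset Strict Implicit.
Unset Printing Implicit Defensive.

Local Open Scope classical_set_scope.
Local Open Scope ring_scope.
Local Open Scope complex_scope.

Section V1.
Variable R : realType.

Local Notation M := 'M[R[i]]_4.

Definition smooth_real (f : R -> R) : Prop :=
  forall n t, derivable (derive1n n f) t 1.

Definition smooth_curve (c : R -> M) : Prop :=
  forall i j, smooth_real (fun t => complex.Re (c t i j)) /\
              smooth_real (fun t => complex.Im (c t i j)).

Definition dcurve (c : R -> M) (t : R) : M :=
  \matrix_(i, j) (derive1 (fun s => complex.Re (c s i j)) t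
                  +i* derive1 (fun s => complex.Im (c s i j)) t).

Definition expm (A : M) : M :=
  lim ((\sum_(k < n) (k`!%:R)^-1 *: A ^+ k : 'M[R[i]^o]_4) @[n --> \oo]).

Definition sp2_mx (a11 a12 a13 a14 a33 a34 : R[i]) : M :=
  \matrix_(k, l) nth 0 (nth [::]
    [:: [:: a11;        a12;       a13;        a14];
        [:: - a12^*%C;  - a11;     a14^*%C;    - a13^*%C];
        [:: - a13^*%C;  - a14;     a33;        a34];
        [:: - a14^*%C;  a13;       - a34^*%C;  - a33]] k) l.

Definition sp2 : set M :=
  [set A | exists a11 a12 a13 a14 a33 a34,
     [/\ complex.Re a11 = 0, complex.Re a33 = 0
       & A = sp2_mx a11 a12 a13 a14 a33 a34]].

(* [Em k l] is the matrix unit E_{kl}, indices counted from 1. *)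
Definition Em (k l : nat) : M := delta_mx (inord k.-1) (inord l.-1).

(* The symplectic form whose unitary group has the above Lie algebra sp(2). *)
Definition Jm : M := Em 1 2 - Em 2 1 - Em 3 4 + Em 4 3.

Definition Sp2 : set M :=
  [set g | (map_mx (@conjc R) g)^T *m g = 1%:M /\ g^T *m Jm *m g = Jm].

(* The imaginary unit of R[i]. *)
Local Notation iC := ((0 : R) +i* 1).

Definition S1 : M := iC *: (Em 1 1 - Em 2 2).
Definition S2 : M := iC *: (Em 3 3 - Em 4 4).
Definition S3 : M := Em 1 2 - Em 2 1.
Definition S4 : M := iC *: (Em 1 2 + Em 2 1).
Definition S5 : M := Em 3 4 - Em 4 3.
Definition S6 : M := iC *: (Em 3 4 + Em 4 3).
Definition S7 : M := Em 1 3 - Em 3 1 - Em 2 4 + Em 4 2.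
Definition S8 : M := iC *: (Em 1 3 + Em 3 1 + Em 2 4 + Em 4 2).
Definition S9 : M := Em 1 4 - Em 4 1 + Em 2 3 - Em 3 2.
Definition S10 : M := iC *: (Em 1 4 + Em 4 1 - Em 2 3 - Em 3 2).

Local Notation "\sqrt x" := (Num.sqrt (x : R)) (at level 8, x at level 8).

Definition Qseq : seq M :=
  [:: (1 / 2 : R)%:C *: S1 - (3 / 2 : R)%:C *: S2;
      (\sqrt (5 / 2))%:C *: S3;
      (\sqrt (5 / 2))%:C *: S4;
      (\sqrt 6 / 2)%:C *: S5 - (\sqrt 2 / 2)%:C *: S7;
      (\sqrt 6 / 2)%:C *: S6 - (\sqrt 2 / 2)%:C *: S8;
      (\sqrt 5 / 2)%:C *: S9;
      (\sqrt 5 / 2)%:C *: S10;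
      (3 / 2 : R)%:C *: S1 + (1 / 2 : R)%:C *: S2;
      S5 + (\sqrt 3 / 2)%:C *: S7;
      S6 + (\sqrt 3 / 2)%:C *: S8].

(* [Q k] is the element Q_{k+1} of the orthonormal basis of sp(2). *)
Definition Q (k : nat) : M := nth 0 Qseq k.

Definition mspace : set M :=
  [set A | exists x : 'I_7 -> R, A = \sum_(k < 7) (x k)%:C *: Q k].

Definition hspace : set M :=
  [set A | exists x : 'I_3 -> R, A = \sum_(k < 3) (x k)%:C *: Q (7 + k)].

(* The connected subgroup of Sp(2) with Lie algebra hspace. *)
Definition H : set M :=
  [set g | exists2 s : seq M, (forall X, X \in s -> hspace X) &
                              g = \prod_(X <- s) expm X].

(* The trace of A *m B is real for A and B in sp(2). *)
Definition inner (A B : M) : R := - (5^-1 * complex.Re (\tr (A *m B))).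

(* The orthogonal projection of sp(2) onto mspace. *)
Definition projm (A : M) : M := \sum_(k < 7) (inner A (Q k))%:C *: Q k.

Definition dirD (A : M) (f : M -> R) (g : M) : R :=
  derive1 (fun s : R => f (g *m expm (s%:C *: A))) 0.

Definition dirDM (A : M) (Y : M -> M) (g : M) : M :=
  dcurve (fun s : R => Y (g *m expm (s%:C *: A))) 0.

(* A function on Sp(2) is C^(k+1) when it is continuous and its derivatives
   along the left-invariant vector fields exist and are C^k. *)
Fixpoint CkSp2 (k : nat) (f : M -> R) : Prop :=
  {within (Sp2 : set 'M[R[i]^o]_4), continuous (f : 'M[R[i]^o]_4 -> R)} /\
  if k is k'.+1 then
    forall A, sp2 A ->
      (forall g, Sp2 g ->
         derivable (fun s : R => f (g *m expm (s%:C *: A))) 0 1) /\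
      CkSp2 k' (dirD A f)
  else True.

Definition smoothSp2 (f : M -> R) : Prop := forall k, CkSp2 k f.

Definition smoothV1 (f : M -> R) : Prop :=
  smoothSp2 f /\ forall g h, Sp2 g -> H h -> f (g *m h) = f g.

Definition vfield (Y : M -> M) : Prop :=
  [/\ forall i j, smoothSp2 (fun g => complex.Re (Y g i j)) /\
                  smoothSp2 (fun g => complex.Im (Y g i j)),
      forall g, Sp2 g -> mspace (Y g)
    & forall g h, Sp2 g -> H h -> Y (g *m h) = invmx h *m Y g *m h].

(* The matrix-valued map [lift Y] is the horizontal lift of Y, a vector field
   on Sp(2) which is pi-related to Y; hence the Lie bracket of two vector
   fields of V_1 is the projection of the bracket of their lifts, the latter
   being the difference of the derivatives of one lift along the other. *)
Definition lift (Y : M -> M) (g : M) : M := g *m Y g.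

Definition vbracket (X Y : M -> M) (g : M) : M :=
  projm (invmx g *m (dirDM (X g) (lift Y) g - dirDM (Y g) (lift X) g)).

Record levi_civita (nabla : (M -> M) -> (M -> M) -> M -> M) : Prop :=
  LeviCivita {
    lc_vfield : forall X Y, vfield X -> vfield Y -> vfield (nabla X Y);
    lc_addl : forall X1 X2 Y g, vfield X1 -> vfield X2 -> vfield Y -> Sp2 g ->
      nabla (fun g => X1 g + X2 g) Y g = nabla X1 Y g + nabla X2 Y g;
    lc_scalel : forall f X Y g, smoothV1 f -> vfield X -> vfield Y -> Sp2 g ->
      nabla (fun g => (f g)%:C *: X g) Y g = (f g)%:C *: nabla X Y g;
    lc_addr : forall X Y1 Y2 g, vfield X -> vfield Y1 -> vfield Y2 -> Sp2 g ->
      nabla X (fun g => Y1 g + Y2 g) g = nabla X Y1 g + nabla X Y2 g;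
    lc_leibniz : forall f X Y g, smoothV1 f -> vfield X -> vfield Y -> Sp2 g ->
      nabla X (fun g => (f g)%:C *: Y g) g =
        (dirD (X g) f g)%:C *: Y g + (f g)%:C *: nabla X Y g;
    lc_metric : forall X Y Z g, vfield X -> vfield Y -> vfield Z -> Sp2 g ->
      dirD (X g) (fun k => inner (Y k) (Z k)) g =
        inner (nabla X Y g) (Z g) + inner (Y g) (nabla X Z g);
    lc_torsion_free : forall X Y g, vfield X -> vfield Y -> Sp2 g ->
      nabla X Y g - nabla Y X g = vbracket X Y g
  }.

Definition curvature (nabla : (M -> M) -> (M -> M) -> M -> M)
    (X Y Z : M -> M) (g : M) : M :=
  nabla X (nabla Y Z) g - nabla Y (nabla X Z) g - nabla (vbracket X Y) Z g.

Definition point (g : M) : set M := [set g *m h | h in H].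

(* c is a smooth lift to Sp(2) of the curve gamma of V_1; c(0) = 1 forces
   gamma(0) = o and identifies T_oV_1 with mspace. *)
Definition smooth_lift (gamma : R -> set M) (c : R -> M) : Prop :=
  [/\ smooth_curve c, forall t, Sp2 (c t), forall t, gamma t = point (c t)
    & c 0 = 1%:M].

Definition velocity (c : R -> M) (t : R) : M :=
  projm (invmx (c t) *m dcurve c t).

Definition field_along (y : R -> M) : Prop :=
  smooth_curve y /\ forall t, mspace (y t).

Record covariant_derivative (nabla : (M -> M) -> (M -> M) -> M -> M)
    (c : R -> M) (D : (R -> M) -> R -> M) : Prop := CovariantDerivative {
  cd_field : forall y, field_along y -> field_along (D y);
  cd_add : forall y1 y2 t, field_along y1 -> field_along y2 ->
    D (fun t => y1 t + y2 t) t = D y1 t + D y2 t;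
  cd_leibniz : forall (f : R -> R) y t, smooth_real f -> field_along y ->
    D (fun t => (f t)%:C *: y t) t =
      (derive1 f t)%:C *: y t + (f t)%:C *: D y t;
  cd_restrict : forall V Y t, vfield V -> vfield Y -> V (c t) = velocity c t ->
    D (fun t => Y (c t)) t = nabla V Y (c t)
}.

Definition geodesic (c : R -> M) (D : (R -> M) -> R -> M) : Prop :=
  forall t, D (velocity c) t = 0.

Definition unit_speed (c : R -> M) : Prop :=
  forall t, inner (velocity c t) (velocity c t) = 1.

Definition parallel_frame (D : (R -> M) -> R -> M) (e : 'I_7 -> R -> M) : Prop :=
  forall k, [/\ field_along (e k), forall t, D (e k) t = 0 & e k 0 = Q k].

(* Row k of [Rt t] lists the coordinates of R(E_k, gamma')gamma'(t) in the frame
   [e]; the value of the curvature tensor at a point is computed through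
   arbitrary vector fields extending its arguments. *)
Definition jacobi_operator (nabla : (M -> M) -> (M -> M) -> M -> M)
    (c : R -> M) (e : 'I_7 -> R -> M) (Rt : R -> 'M[R]_7) : Prop :=
  forall t k X V, vfield X -> vfield V ->
    X (c t) = e k t -> V (c t) = velocity c t ->
    curvature nabla X V V (c t) = \sum_(l < 7) (Rt t k l)%:C *: e l t.

Definition jacobi_tensor (Rt A : R -> 'M[R]_7) : Prop :=
  [/\ forall t, derivable A t 1,
      forall t, derivable (derive1 A) t 1,
      forall t, derive1 (derive1 A) t = - (A t *m Rt t),
      A 0 = 0
    & derive1 A 0 = 1%:M].

Fixpoint alpha_beta (Rt : R -> 'M[R]_7) (k : nat) :
    (R -> 'M[R]_7) * (R -> 'M[R]_7) :=
  match k with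
  | 0 => (fun=> 0, fun=> 0)
  | 1 => (fun=> 0, fun=> 1%:M)
  | k'.+1 =>
      let: (alpha, beta) := alpha_beta Rt k' in
      (fun t => derive1 alpha t - Rt t *m beta t,
       fun t => alpha t + derive1 beta t)
  end.

Definition beta (Rt : R -> 'M[R]_7) (k : nat) : R -> 'M[R]_7 :=
  (alpha_beta Rt k).2.

End V1.

(* Main.v *)
Require Import Defs.
From HB Require Import structures.
From mathcomp Require Import all_boot all_order all_algebra.
From mathcomp Require Import complex ring lra.
From mathcomp Require Import all_classical all_reals all_analysis.
Import Order.TTheory GRing.Theory Num.Theory numFieldNormedType.Exports.

(** Both assertions come down to the way in which the Jacobi operator changes
    along a geodesic: in a parallel frame, R' = 1/2 [L, R] for a constant
    skew-symmetric matrix L (lemma [jacobi_operator_rotation]).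

    V_1 is a normal homogeneous space. On the total space Sp(2) its Levi-Civita
    connection is the derivative along the lift plus one half of the bracket
    projected to m ([nabla_lie]). As an axiomatic connection is given, this is
    deduced from uniqueness: the difference of two metric torsion-free
    connections has contradictory symmetries, and it is tested against the
    Killing fields g |-> (g^-1 A g)_m, which are explicit and take all values.
    From there R(x,v)v = -[v, [v,x]_h]_m - 1/4 [v, [v,x]_m]_m, in the form of
    [curvature_killing]. Along a curve c of Sp(2) with c^-1 c' = v + u, v in m
    and u in h, the covariant derivative is D y = y' + [u,y] + 1/2 [v,y]_m
    ([D_along]). The terms in u are infinitesimal isometries commuting with all
    the structure, so they disappear from pairings of parallel fields: the
    matrix L of the map x |-> [x,v]_m in the parallel frame is constant, and the
    Jacobi operator is rotated by it.

    What is special to V_1 is that the bracket of m followed by the projection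
    to m is the cross product of the imaginary octonions. Hence L^2 = -1 on the
    orthogonal complement of the velocity ([projm_lie_sq]), where R lives. A
    matrix identity then gives ad_L^3 R = -4 ad_L R, that is R''' = -R', so
      R_t = R_0 + sin t R'_0 + (1 - cos t) R''_0
    ([brk3], [rotation_formula]). The whole function R_t, and with it every
    beta_k, is determined by R_0, R'_0 and R''_0.

    For the power series, the k-th derivative of A_t is A alpha_k + A' beta_k.
    Since alpha_k and beta_k are noncommutative polynomials in L and R_t, their
    derivatives are again given by 1/2 [L, .], and the recursion bounds them on
    bounded intervals by C K^k. Taylor's remainder therefore tends to zero
    ([jacobi_series]). *)

Set Implicit Arguments.
Unset Strict Implicit.
Unset Printing Implicit Defensive.

Local Open Scope classical_set_scope.
Local Open Scope ring_scope.

(** * Differentiable curves of matrices *)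

HB.lock Definition lie (R : realType) (A B : 'M[R[i]]_4) := A *m B - B *m A.
Lemma lieE (R : realType) (A B : 'M[R[i]]_4) : lie A B = A *m B - B *m A.
Proof. by rewrite lie.unlock. Qed.

Section Calculus.
Variable R : realType.
Local Notation M := 'M[R[i]]_4.
Local Notation Re := (@complex.Re R).
Local Notation Im := (@complex.Im R).

Lemma Re_add (x y : R[i]) : Re (x + y) = Re x + Re y. Proof. by case: x y => [? ?] []. Qed.
Lemma Im_add (x y : R[i]) : Im (x + y) = Im x + Im y. Proof. by case: x y => [? ?] []. Qed.
Lemma Re_opp (x : R[i]) : Re (- x) = - Re x. Proof. by case: x. Qed.
Lemma Im_opp (x : R[i]) : Im (- x) = - Im x. Proof. by case: x. Qed.
Lemma Re_mul (x y : R[i]) : Re (x * y) = Re x * Re y - Im x * Im y.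
Proof. by case: x y => [? ?] []. Qed.
Lemma Im_mul (x y : R[i]) : Im (x * y) = Re x * Im y + Im x * Re y.
Proof. by case: x y => [? ?] []. Qed.
Lemma complexP (x y : R[i]) : Re x = Re y -> Im x = Im y -> x = y.
Proof. by case: x y => [? ?] [? ?] /= -> ->. Qed.

Definition is_cderive (f : R -> R[i]) (t : R) (d : R[i]) : Prop :=
  is_derive t (1 : R) (fun s => Re (f s)) (Re d) /\
  is_derive t (1 : R) (fun s => Im (f s)) (Im d).

Lemma is_cderive_cst z t : is_cderive (fun=> z) t 0.
Proof. by split; exact: is_derive_cst. Qed.

Lemma is_cderiveD f g t d e : is_cderive f t d -> is_cderive g t e ->
  is_cderive (fun s => f s + g s) t (d + e).
Proof.
move=> [f1 f2] [g1 g2]; split.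
  have -> : (fun s => Re (f s + g s)) = (fun s => Re (f s)) + (fun s => Re (g s)).
    by apply/funext => s; rewrite Re_add.
  by rewrite Re_add; exact: is_deriveD.
have -> : (fun s => Im (f s + g s)) = (fun s => Im (f s)) + (fun s => Im (g s)).
  by apply/funext => s; rewrite Im_add.
by rewrite Im_add; exact: is_deriveD.
Qed.

Lemma is_derive_mul (f g : R -> R) t d e :
  is_derive t (1 : R) f d -> is_derive t (1 : R) g e ->
  is_derive t (1 : R) (fun s => f s * g s) (d * g t + f t * e).
Proof.
move=> fd ge; have := is_deriveM fd ge; rewrite (_ : _ + _ = d * g t + f t * e)//.
by rewrite addrC mulrC.
Qed.

Lemma is_cderiveM f g t d e : is_cderive f t d -> is_cderive g t e ->
  is_cderive (fun s => f s * g s) t (d * g t + f t * e).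
Proof.
move=> [f1 f2] [g1 g2]; split.
  have -> : (fun s => Re (f s * g s)) =
     (fun s => Re (f s) * Re (g s)) - (fun s => Im (f s) * Im (g s)).
    by apply/funext => s; rewrite Re_mul.
  apply: is_derive_eq (is_deriveB (is_derive_mul f1 g1) (is_derive_mul f2 g2)) _.
  by rewrite Re_add !Re_mul; ring.
have -> : (fun s => Im (f s * g s)) =
   (fun s => Re (f s) * Im (g s)) + (fun s => Im (f s) * Re (g s)).
  by apply/funext => s; rewrite Im_mul.
apply: is_derive_eq (is_deriveD (is_derive_mul f1 g2) (is_derive_mul f2 g1)) _.
by rewrite Im_add !Im_mul; ring.
Qed.

Lemma is_cderive_sum (I : Type) (r : seq I) (f : I -> R -> R[i]) (d : I -> R[i]) t :
  (forall k, is_cderive (f k) t (d k)) ->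
  is_cderive (fun s => \sum_(k <- r) f k s) t (\sum_(k <- r) d k).
Proof.
move=> fd; elim: r => [|k r ih].
  rewrite big_nil (_ : (fun s => _) = fun=> 0); first exact: is_cderive_cst.
  by apply/funext => s; rewrite big_nil.
rewrite big_cons (_ : (fun s => _) = fun s => f k s + \sum_(k <- r) f k s).
  exact: is_cderiveD.
by apply/funext => s; rewrite big_cons.
Qed.

Lemma Re_conj (x : R[i]) : Re (x^*%C) = Re x. Proof. by case: x. Qed.
Lemma Im_conj (x : R[i]) : Im (x^*%C) = - Im x. Proof. by case: x. Qed.

Lemma is_cderive_conj f t d : is_cderive f t d -> is_cderive (fun s => (f s)^*%C) t (d^*%C).
Proof.
move=> [f1 f2]; split.
  rewrite Re_conj; have -> : (fun s => Re ((f s)^*%C)) = fun s => Re (f s) => //.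
  by apply/funext => s; rewrite Re_conj.
rewrite Im_conj; have -> : (fun s => Im ((f s)^*%C)) = - (fun s => Im (f s)).
  by apply/funext => s; rewrite Im_conj.
exact: is_deriveN.
Qed.

Lemma is_cderive_real (f : R -> R) t d : is_derive t (1 : R) f d ->
  is_cderive (fun s => (f s)%:C%C) t (d%:C%C).
Proof. by move=> fd; split => //=; exact: is_derive_cst. Qed.

Definition is_mderive (c : R -> M) (t : R) (d : M) : Prop :=
  forall i j, is_cderive (fun s => c s i j) t (d i j).

Lemma is_mderive_cst A t : is_mderive (fun=> A) t 0.
Proof. by move=> i j; rewrite mxE; exact: is_cderive_cst. Qed.

Lemma is_mderive_eq c t d d' : is_mderive c t d -> d = d' -> is_mderive c t d'.
Proof. by move=> ? <-. Qed.

Lemma is_mderiveD f g t d e : is_mderive f t d -> is_mderive g t e ->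
  is_mderive (fun s => f s + g s) t (d + e).
Proof.
move=> fd ge i j; rewrite mxE.
rewrite (_ : (fun s => _) = fun s => f s i j + g s i j); first exact: is_cderiveD.
by apply/funext => s; rewrite mxE.
Qed.

Lemma is_mderiveM f g t d e : is_mderive f t d -> is_mderive g t e ->
  is_mderive (fun s => f s *m g s) t (d *m g t + f t *m e).
Proof.
move=> fd ge i j; rewrite !mxE -big_split/=.
rewrite (_ : (fun s => _) = fun s => \sum_k f s i k * g s k j).
  by apply: is_cderive_sum => k; exact: is_cderiveM.
by apply/funext => s; rewrite mxE.
Qed.

Lemma is_mderiveZ (f : R -> R) g t d e : is_derive t (1 : R) f d -> is_mderive g t e ->
  is_mderive (fun s => (f s)%:C%C *: g s) t (d%:C%C *: g t + (f t)%:C%C *: e).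
Proof.
move=> fd ge i j; rewrite !mxE.
rewrite (_ : (fun s => _) = fun s => (f s)%:C%C * g s i j).
  by apply: is_cderiveM => //; exact: is_cderive_real.
by apply/funext => s; rewrite mxE.
Qed.

Lemma is_mderiveZc (z : R[i]) g t e : is_mderive g t e ->
  is_mderive (fun s => z *: g s) t (z *: e).
Proof.
move=> ge i j; rewrite !mxE.
rewrite (_ : (fun s => _) = fun s => z * g s i j).
  have := is_cderiveM (is_cderive_cst z t) (ge i j).
  by rewrite mul0r add0r.
by apply/funext => s; rewrite mxE.
Qed.

Lemma is_mderiveN g t e : is_mderive g t e -> is_mderive (fun s => - g s) t (- e).
Proof.
move=> /(is_mderiveZc (-1)); rewrite scaleN1r; congr (is_mderive _ t (- e)).
by apply/funext => s; rewrite scaleN1r.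
Qed.

Lemma is_mderiveB f g t d e : is_mderive f t d -> is_mderive g t e ->
  is_mderive (fun s => f s - g s) t (d - e).
Proof. by move=> fd ge; apply: is_mderiveD => //; exact: is_mderiveN. Qed.

Lemma is_mderive_sum (I : Type) (r : seq I) (f : I -> R -> M) (d : I -> M) t :
  (forall k, is_mderive (f k) t (d k)) ->
  is_mderive (fun s => \sum_(k <- r) f k s) t (\sum_(k <- r) d k).
Proof.
move=> fd i j; rewrite summxE.
rewrite (_ : (fun s => _) = fun s => \sum_(k <- r) f k s i j).
  by apply: is_cderive_sum => k; exact: fd.
by apply/funext => s; rewrite summxE.
Qed.

Lemma is_mderive_tr f t d : is_mderive f t d -> is_mderive (fun s => (f s)^T) t (d^T).
Proof.
move=> fd i j; rewrite mxE (_ : (fun s => _) = fun s => f s j i)//.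
by apply/funext => s; rewrite mxE.
Qed.

Definition ctrmx (A : M) : M := (map_mx (@conjc R) A)^T.

Lemma is_mderive_ctr f t d : is_mderive f t d -> is_mderive (fun s => ctrmx (f s)) t (ctrmx d).
Proof.
move=> fd i j; rewrite !mxE (_ : (fun s => _) = fun s => (f s j i)^*%C).
  exact: is_cderive_conj.
by apply/funext => s; rewrite !mxE.
Qed.

Lemma is_cderive_trace f t d : is_mderive f t d -> is_cderive (fun s => \tr (f s)) t (\tr d).
Proof. by move=> fd; apply: is_cderive_sum => k; exact: fd. Qed.

Lemma dcurveE c t d : is_mderive c t d -> dcurve c t = d.
Proof.
move=> cd; apply/matrixP => i j; rewrite mxE; have [h1 h2] := cd i j.
by rewrite !derive1E !derive_val; apply: complexP.
Qed.

Lemma is_derive_derivable (f : R -> R) t :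
  derivable f t 1 -> is_derive t (1 : R) f (derive1 f t).
Proof. by move=> ft; rewrite derive1E; apply: derivableP. Qed.

Lemma is_mderive_dcurve (c : R -> M) t :
  (forall i j, derivable (fun s => Re (c s i j)) t 1 /\
               derivable (fun s => Im (c s i j)) t 1) ->
  is_mderive c t (dcurve c t).
Proof.
move=> cd i j; have [h1 h2] := cd i j; rewrite mxE.
by split; apply: is_derive_derivable.
Qed.

Lemma is_mderive_smooth (c : R -> M) t : smooth_curve c -> is_mderive c t (dcurve c t).
Proof. by move=> cs; apply: is_mderive_dcurve => i j; have [h1 h2] := cs i j; split;
  [exact: (h1 0%N)|exact: (h2 0%N)]. Qed.

Lemma is_derive_inner f g t d e : is_mderive f t d -> is_mderive g t e ->
  is_derive t (1 : R) (fun s => inner (f s) (g s)) (inner d (g t) + inner (f t) e).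
Proof.
move=> fd ge; have [h _] := is_cderive_trace (is_mderiveM fd ge).
have -> : (fun s => inner (f s) (g s)) =
    (- 5^-1 : R) *: (fun s => Re (\tr (f s *m g s))).
  by apply/funext => s; rewrite /inner -mulNr.
apply: is_derive_eq (is_deriveZ (- 5^-1) h) _.
by rewrite mxtraceD Re_add /inner -!mulNr scalerDr.
Qed.

Lemma is_mderive_projm f t d : is_mderive f t d -> is_mderive (fun s => projm (f s)) t (projm d).
Proof.
move=> fd; rewrite /projm; apply: is_mderive_sum => k.
have := is_mderiveZ (is_derive_inner fd (is_mderive_cst (Q R k) t)) (is_mderive_cst (Q R k) t).
rewrite scaler0 addr0 => h; apply: is_mderive_eq h _.
by rewrite /inner mulmx0 mxtrace0 mulr0 oppr0 addr0.
Qed.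

Lemma is_mderive_lie f g t d e : is_mderive f t d -> is_mderive g t e ->
  is_mderive (fun s => lie (f s) (g s)) t (lie d (g t) + lie (f t) e).
Proof.
move=> fd ge; have -> : (fun s => lie (f s) (g s)) = fun s => f s *m g s - g s *m f s.
  by apply/funext => s; rewrite lieE.
apply: is_mderive_eq (is_mderiveB (is_mderiveM fd ge) (is_mderiveM ge fd)) _.
rewrite !lieE; by rewrite [e *m _ + _]addrC opprD addrACA.
Qed.

End Calculus.

(** * The matrix exponential *)

Section ExpSeries.
Variable R : realType.

(** The exponential generating function of [c]: as functions of [s], the real
    and imaginary parts of the entries of [expm (s A)] have this form. *)
Definition eseries (c : nat -> R) (s : R) : R :=
  limn (pseries (fun n => c n / n`!%:R) s).

Definition expbounded (c : nat -> R) := exists B K, 0 <= K /\ forall n, `|c n| <= B * K ^+ n.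

Lemma expbounded_shift c : expbounded c -> expbounded (fun n => c n.+1).
Proof.
move=> [B [K [K0 h]]]; exists (B * K), K; split => // n.
by rewrite -mulrA -exprS.
Qed.

Lemma is_cvg_eseries c s : expbounded c -> cvgn (pseries (fun n => c n / n`!%:R) s).
Proof.
move=> [B [K [K0 cB]]].
apply: normed_cvg; rewrite /normed_series_of /=.
apply: (@series_le_cvg _ _ (B *: exp_coeff (K * `|s|))).
- by move=> n.
- move=> n /=; rewrite -[(_ *: _) n]/(B * exp_coeff (K * `|s|) n).
  apply: mulr_ge0; last by apply: exp_coeff_ge0; apply: mulr_ge0.
  by have := cB 0%N; rewrite expr0 mulr1; apply: le_trans.
- move=> n /=; rewrite -[(_ *: _) n]/(B * exp_coeff (K * `|s|) n) /exp_coeff/=.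
  rewrite !normrM normrV ?unitfE ?pnatr_eq0 -?lt0n ?fact_gt0//.
  rewrite [`|_ `!%:R|]ger0_norm// normrX exprMn.
  rewrite mulrAC !mulrA ler_pM2r ?invr_gt0 ?ltr0n ?fact_gt0//.
  by rewrite ler_wpM2r ?exprn_ge0.
- exact/is_cvg_seriesZ/is_cvg_series_exp_coeff.
Qed.

(** Differentiation shifts the coefficients, which is how the rule
    exp(sA)' = A exp(sA) comes about. *)
Lemma is_derive_eseries c s : expbounded c ->
  is_derive s (1 : R) (eseries c) (eseries (fun n => c n.+1) s).
Proof.
move=> cB.
have E d : pseries_diffs (fun n => d n / n`!%:R) = fun n => d n.+1 / n`!%:R.
  apply/funext => n; rewrite /pseries_diffs factS natrM invfM mulrCA.
  by rewrite mulVKf// pnatr_eq0.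
(* any radius larger than |s| will do *)
have := @pseries_snd_diffs R (fun n => c n / n`!%:R) (`|s| + 1) s.
rewrite !E; apply.
- exact: is_cvg_eseries.
- exact/is_cvg_eseries/expbounded_shift.
- apply: is_cvg_eseries.
  exact: (@expbounded_shift (fun n => c n.+1) (expbounded_shift cB)).
- by rewrite [ltRHS]ger0_norm ?ltrDl//; apply: addr_ge0.
Qed.

Lemma expboundedD c d : expbounded c -> expbounded d ->
  expbounded (fun n => c n + d n).
Proof.
move=> [B [K [K0 cB]]] [B' [K' [K'0 dB]]].
have B0 : 0 <= B by have := cB 0%N; rewrite expr0 mulr1; apply: le_trans.
have B'0 : 0 <= B' by have := dB 0%N; rewrite expr0 mulr1; apply: le_trans.
exists (B + B'), (K + K'); split=> [|n]; first exact: addr_ge0.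
apply: le_trans (ler_normD _ _) _; rewrite mulrDl; apply: lerD.
  apply: le_trans (cB n) _; apply: ler_wpM2l => //.
  by rewrite lerXn2r ?nnegrE ?addr_ge0// lerDl.
apply: le_trans (dB n) _; apply: ler_wpM2l => //.
by rewrite lerXn2r ?nnegrE ?addr_ge0// lerDr.
Qed.

Lemma expboundedZ a c : expbounded c -> expbounded (fun n => a * c n).
Proof.
move=> [B [K [K0 cB]]]; exists (`|a| * B), K; split=> // n.
by rewrite normrM -mulrA ler_wpM2l.
Qed.

Lemma eseriesZ a c s : expbounded c ->
  eseries (fun n => a * c n) s = a * eseries c s.
Proof.
move=> cB; apply: cvg_lim => //.
have -> : pseries (fun n => a * c n / n`!%:R) s =
    fun N => a * pseries (fun n => c n / n`!%:R) s N.
  apply/funext => N; rewrite /pseries /series/= mulr_sumr.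
  by apply: eq_bigr => n _; rewrite !mulrA.
by apply: cvgMr; exact: is_cvg_eseries.
Qed.

Lemma eseriesD c d s : expbounded c -> expbounded d ->
  eseries (fun n => c n + d n) s = eseries c s + eseries d s.
Proof.
move=> cB dB; apply: cvg_lim => //.
have -> : pseries (fun n => (c n + d n) / n`!%:R) s =
    (fun N => pseries (fun n => c n / n`!%:R) s N +
             pseries (fun n => d n / n`!%:R) s N).
  apply/funext => N; rewrite /pseries /series/= -big_split/=.
  by apply: eq_bigr => n _; rewrite !mulrDl.
by apply: cvgD; exact: is_cvg_eseries.
Qed.

Lemma eseries0 c : eseries c 0 = c 0%N.
Proof.
apply: cvg_lim => //; rewrite -cvg_shiftS /pseries /series/=.
rewrite (_ : (fun n => _) = fun=> c 0%N); first exact: cvg_cst.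
apply/funext => n; rewrite big_nat_recl//= expr0 mulr1 divr1.
by rewrite big1 ?addr0// => i _; rewrite expr0n mulr0.
Qed.

End ExpSeries.

Section MatrixExp.
Variable R : realType.
Local Notation M := 'M[R[i]]_4.
Local Notation Re := (@complex.Re R).
Local Notation Im := (@complex.Im R).

(** A real-valued submultiplicative norm, so that the bounds below stay in [R]. *)
Let normc1 (z : R[i]) : R := `|Re z| + `|Im z|.

Let normc1_ge0 z : 0 <= normc1 z. Proof. exact: addr_ge0. Qed.

Let normc1D x y : normc1 (x + y) <= normc1 x + normc1 y.
Proof. by rewrite /normc1 Re_add Im_add addrACA lerD// ler_normD. Qed.

Let normc1M x y : normc1 (x * y) <= normc1 x * normc1 y.
Proof.
rewrite /normc1 Re_mul Im_mul mulrDl !mulrDr -!normrM.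
apply: le_trans (lerD (ler_normB _ _) (ler_normD _ _)) _; lra.
Qed.

Let normc1_sum (I : Type) (r : seq I) F : normc1 (\sum_(k <- r) F k) <= \sum_(k <- r) normc1 (F k).
Proof.
elim: r => [|k r ih]; first by rewrite !big_nil /normc1 /= normr0 addr0.
by rewrite !big_cons; apply: le_trans (normc1D _ _) _; rewrite lerD2l.
Qed.

Lemma expmx_bounded (A : M) i j :
  expbounded (fun n => Re ((A ^+ n) i j)) /\ expbounded (fun n => Im ((A ^+ n) i j)).
Proof.
set K := \sum_k \sum_l normc1 (A k l).
have K0 : 0 <= K by do 2 (apply: sumr_ge0 => ? _); exact: normc1_ge0.
have h n k l : normc1 ((A ^+ n) k l) <= K ^+ n.
  elim: n k l => [|n ih] k l.
    rewrite !expr0 mxE /normc1; case: (k == l) => /=.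
      by rewrite normr1 normr0 addr0.
    by rewrite normr0 addr0.
  rewrite !exprS mxE; apply: le_trans (normc1_sum _ _) _.
  apply: le_trans (_ : \sum_m normc1 (A k m) * K ^+ n <= _).
    by apply: ler_sum => m _; apply: le_trans (normc1M _ _) _; rewrite ler_wpM2l.
  rewrite -mulr_suml ler_wpM2r ?exprn_ge0//.
  rewrite /K [leRHS](bigD1 k)//= lerDl.
  by do 2 (apply: sumr_ge0 => ? _); exact: normc1_ge0.
by split; exists 1, K; split=> // n; rewrite mul1r; apply: le_trans (h n i j);
  rewrite /normc1 ?lerDl ?lerDr.
Qed.

(** [expm] is a limit for the topology given by the complex-valued distance of
    R[i]; it is computed through the real limits of its components. *)
Lemma cvg_mxReIm (u : nat -> M) (E : M) :
  (forall i j, Re (u n i j) @[n --> \oo] --> Re (E i j)) ->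
  (forall i j, Im (u n i j) @[n --> \oo] --> Im (E i j)) ->
  (u n : 'M[R[i]^o]_4) @[n --> \oo] --> (E : 'M[R[i]^o]_4).
Proof.
move=> hRe hIm; apply/cvg_ballP => e e0.
have [er0 eE] : 0 < Re e /\ e = (Re e)%:C%C.
  by move: e0; case: e => a b; rewrite ltcE /= => /andP[/eqP -> ].
have e20 : 0 < Re e / 2 by rewrite divr_gt0.
have hr : \forall n \near \oo, forall i j, `|Re (E i j) - Re (u n i j)| < Re e / 2.
  apply: filter_forall => i; apply: filter_forall => j.
  by have /cvgrPdist_lt/(_ _ e20) := hRe i j.
have hi : \forall n \near \oo, forall i j, `|Im (E i j) - Im (u n i j)| < Re e / 2.
  apply: filter_forall => i; apply: filter_forall => j.
  by have /cvgrPdist_lt/(_ _ e20) := hIm i j.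
near=> n; split=> // i j; rewrite -ball_normE /ball_ /=.
have hr1 : `|Re (E i j - u n i j)| < Re e / 2.
  by rewrite Re_add Re_opp; move: i j; near: n; exact: hr.
have hi1 : `|Im (E i j - u n i j)| < Re e / 2.
  by rewrite Im_add Im_opp; move: i j {hr1}; near: n; exact: hi.
rewrite eE normc_def ltcR.
case: (E i j - u n i j) hr1 hi1 => a b /= ha hb.
rewrite -(@ltr_pXn2r _ 2)// ?nnegrE ?sqrtr_ge0 ?ltW//.
rewrite sqr_sqrtr ?addr_ge0 ?sqr_ge0//.
rewrite -[a ^+ 2]real_normK ?num_real// -[b ^+ 2]real_normK ?num_real//.
have := normr_ge0 a; have := normr_ge0 b; nra.
Unshelve. all: by end_near. Qed.

Lemma expmE (A : M) (s : R) i j :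
  expm (s%:C%C *: A) i j =
  Complex (eseries (fun n => Re ((A ^+ n) i j)) s)
          (eseries (fun n => Im ((A ^+ n) i j)) s).
Proof.
pose E : M := \matrix_(i, j) Complex (eseries (fun n => Re ((A ^+ n) i j)) s)
          (eseries (fun n => Im ((A ^+ n) i j)) s).
suff -> : expm (s%:C%C *: A) = E by rewrite mxE.
have hX n : (s%:C%C *: A) ^+ n = (s ^+ n)%:C%C *: A ^+ n.
  by rewrite exprZn -rmorphXn.
have hc k : ((k`!%:R)^-1 : R[i]) = ((k`!%:R)^-1 : R)%:C%C.
  by rewrite fmorphV rmorph_nat.
have hRe n i' j' : Re ((\sum_(k < n) (k`!%:R)^-1 *: (s%:C%C *: A) ^+ k : M) i' j') =
    pseries (fun n => Re ((A ^+ n) i' j') / n`!%:R) s n.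
  rewrite summxE /pseries /series/= big_mkord.
  elim/big_ind2: _ => //= [_ x _ y <- <-|k _]; first by rewrite Re_add.
  by rewrite !mxE hX hc mxE !Re_mul !Im_mul/=; ring.
have hIm n i' j' : Im ((\sum_(k < n) (k`!%:R)^-1 *: (s%:C%C *: A) ^+ k : M) i' j') =
    pseries (fun n => Im ((A ^+ n) i' j') / n`!%:R) s n.
  rewrite summxE /pseries /series/= big_mkord.
  elim/big_ind2: _ => //= [_ x _ y <- <-|k _]; first by rewrite Im_add.
  by rewrite !mxE hX hc mxE !Im_mul ?Re_mul/=; ring.
rewrite /expm; apply: (@cvg_lim ('M[R[i]^o]_4)); first exact: norm_hausdorff.
apply: cvg_mxReIm => i' j'; rewrite mxE/=.
  under eq_fun do rewrite hRe.
  by apply: is_cvg_eseries; have [] := expmx_bounded A i' j'.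
under eq_fun do rewrite hIm.
by apply: is_cvg_eseries; have [] := expmx_bounded A i' j'.
Qed.

Let cbounded (c : nat -> R[i]) :=
  expbounded (fun n => Re (c n)) /\ expbounded (fun n => Im (c n)).

Let ceseries (c : nat -> R[i]) s : R[i] :=
  Complex (eseries (fun n => Re (c n)) s) (eseries (fun n => Im (c n)) s).

Let cboundedZ a c : cbounded c -> cbounded (fun n => a * c n).
Proof.
move=> [h1 h2]; split.
  under [X in expbounded X]eq_fun do rewrite Re_mul -mulNr.
  by apply: expboundedD; exact: expboundedZ.
under [X in expbounded X]eq_fun do rewrite Im_mul.
by apply: expboundedD; exact: expboundedZ.
Qed.

Let ceseriesZ a c s : cbounded c -> ceseries (fun n => a * c n) s = a * ceseries c s.
Proof.
move=> [h1 h2]; apply: complexP; rewrite ?Re_mul ?Im_mul /=.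
  under [in LHS]eq_fun do rewrite Re_mul -mulNr.
  by rewrite eseriesD ?eseriesZ ?mulNr//; exact: expboundedZ.
under [in LHS]eq_fun do rewrite Im_mul.
by rewrite eseriesD ?eseriesZ//; exact: expboundedZ.
Qed.

Let ceseries_sum (I : Type) (r : seq I) (c : I -> nat -> R[i]) s :
  (forall k, cbounded (c k)) ->
  cbounded (fun n => \sum_(k <- r) c k n) /\
  ceseries (fun n => \sum_(k <- r) c k n) s = \sum_(k <- r) ceseries (c k) s.
Proof.
move=> h; elim: r => [|k r [[ih1 ih2] ih3]].
  have -> : (fun n : nat => \sum_(k <- [::]) c k n) = fun n => 0 * (0 : R[i]).
    by apply/funext => n; rewrite big_nil mul0r.
  have h0 : cbounded (fun=> 0).
    by split; exists 0, 0; split => // n; rewrite normr0 mul0r.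
  by split; [exact: cboundedZ|rewrite ceseriesZ// mul0r big_nil].
have [h1 h2] := h k.
have -> : (fun n : nat => \sum_(k <- k :: r) c k n) =
    fun n => c k n + \sum_(k <- r) c k n.
  by apply/funext => n; rewrite big_cons.
split.
  split; [under [X in expbounded X]eq_fun do rewrite Re_add|
          under [X in expbounded X]eq_fun do rewrite Im_add]; exact: expboundedD.
rewrite big_cons -ih3; apply: complexP; rewrite ?Re_add ?Im_add /=.
  by under [in LHS]eq_fun do rewrite Re_add; exact: eseriesD.
by under [in LHS]eq_fun do rewrite Im_add; exact: eseriesD.
Qed.

Let expmE' A s i j : expm (s%:C%C *: A) i j = ceseries (fun n => (A ^+ n) i j) s.
Proof. exact: expmE. Qed.

Lemma expm_commute (A : M) s : A *m expm (s%:C%C *: A) = expm (s%:C%C *: A) *m A.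
Proof.
apply/matrixP => i j; rewrite !mxE.
under eq_bigr do rewrite expmE' -(ceseriesZ _ _ (expmx_bounded _ _ _)).
under [RHS]eq_bigr do rewrite mulrC expmE' -(ceseriesZ _ _ (expmx_bounded _ _ _)).
rewrite -!(ceseries_sum _ _ _).2; last 2 first.
- by move=> k; apply/cboundedZ/expmx_bounded.
- by move=> k; apply/cboundedZ/expmx_bounded.
congr ceseries; apply/funext => n.
have := commrX n (commr_refl A); rewrite /GRing.comm => /matrixP/(_ i j).
rewrite !mxE => ->; by apply: eq_bigr => k _; rewrite mulrC.
Qed.

Lemma is_mderive_expm (A : M) s :
  is_mderive (fun s : R => expm (s%:C%C *: A)) s (A *m expm (s%:C%C *: A)).
Proof.
move=> i j; rewrite mxE.
have -> : \sum_k A i k * expm (s%:C%C *: A) k j =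
    ceseries (fun n => (A ^+ n.+1) i j) s.
  under eq_bigr do rewrite expmE' -(ceseriesZ _ _ (expmx_bounded _ _ _)).
  rewrite -(ceseries_sum _ _ _).2; last first.
    by move=> k; apply/cboundedZ/expmx_bounded.
  by congr ceseries; apply/funext => n; rewrite exprS mxE.
under eq_fun do rewrite expmE'.
have [h1 h2] := expmx_bounded A i j.
by split; exact: is_derive_eseries.
Qed.

Lemma is_mderive_expm_l (A g : M) s :
  is_mderive (fun s : R => g *m expm (s%:C%C *: A)) s (g *m expm (s%:C%C *: A) *m A).
Proof.
apply: is_mderive_eq (is_mderiveM (is_mderive_cst g s) (is_mderive_expm A s)) _.
by rewrite mul0mx add0r expm_commute mulmxA.
Qed.

Lemma expm0 (A : M) : expm (0%:C%C *: A) = 1%:M.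
Proof.
apply/matrixP => i j; rewrite expmE' /ceseries !eseries0 expr0.
by apply: complexP.
Qed.

End MatrixExp.

(** * The Lie algebra sp(2) *)

Ltac mx4 :=
  apply/matrixP => -[[|[|[|[|//]]]] ?] [[|[|[|[|//]]]] ?].

Section Algebra.
Variable R : realType.
Local Notation M := 'M[R[i]]_4.
Local Notation Re := (@complex.Re R).
Local Notation Im := (@complex.Im R).
Implicit Types A B C : M.

Lemma innerC A B : inner A B = inner B A.
Proof. by rewrite /inner mxtrace_mulC. Qed.

Lemma innerDl A B C : inner (A + B) C = inner A C + inner B C.
Proof. by rewrite /inner mulmxDl mxtraceD Re_add mulrDr opprD. Qed.

Lemma innerZl (r : R) A B : inner (r%:C%C *: A) B = r * inner A B.
Proof. by rewrite /inner -scalemxAl mxtraceZ Re_mul /= mul0r subr0; ring. Qed.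

Lemma innerNl A B : inner (- A) B = - inner A B.
Proof. by rewrite /inner mulNmx raddfN/= Re_opp; ring. Qed.

Lemma innerBl A B C : inner (A - B) C = inner A C - inner B C.
Proof. by rewrite innerDl innerNl. Qed.

Lemma inner0l A : inner 0 A = 0.
Proof. by rewrite /inner mul0mx mxtrace0 mulr0 oppr0. Qed.

Lemma inner_suml (I : Type) (r : seq I) (F : I -> M) A :
  inner (\sum_(k <- r) F k) A = \sum_(k <- r) inner (F k) A.
Proof.
elim: r => [|k r ih]; first by rewrite !big_nil inner0l.
by rewrite !big_cons innerDl ih.
Qed.

Lemma innerDr A B C : inner A (B + C) = inner A B + inner A C.
Proof. by rewrite innerC innerDl !(innerC A). Qed.
Lemma innerZr (r : R) A B : inner A (r%:C%C *: B) = r * inner A B.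
Proof. by rewrite innerC innerZl (innerC A). Qed.
Lemma innerNr A B : inner A (- B) = - inner A B.
Proof. by rewrite innerC innerNl (innerC A). Qed.
Lemma innerBr A B C : inner A (B - C) = inner A B - inner A C.
Proof. by rewrite innerDr innerNr. Qed.
Lemma inner0r A : inner A 0 = 0.
Proof. by rewrite innerC inner0l. Qed.
Lemma inner_sumr (I : Type) (r : seq I) (F : I -> M) A :
  inner A (\sum_(k <- r) F k) = \sum_(k <- r) inner A (F k).
Proof. by rewrite innerC inner_suml; apply: eq_bigr => k _; exact: innerC. Qed.

(** The inner product is invariant under the adjoint action, because the trace
    is cyclic. *)
Lemma inner_lie A B C : inner (lie A B) C = inner A (lie B C).
Proof.
rewrite !lieE innerBl innerBr; congr (_ - _); rewrite /inner ?mulmxA//.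
by rewrite -mulmxA mxtrace_mulC -mulmxA.
Qed.

Lemma lieC A B : lie A B = - lie B A. Proof. by rewrite !lieE opprB. Qed.
Lemma lieDl A B C : lie (A + B) C = lie A C + lie B C.
Proof. by rewrite !lieE mulmxDl mulmxDr opprD addrACA. Qed.
Lemma lieZl (z : R[i]) A B : lie (z *: A) B = z *: lie A B.
Proof. by rewrite !lieE -scalemxAl -scalemxAr scalerBr. Qed.
Lemma lieNl A B : lie (- A) B = - lie A B.
Proof. by rewrite -scaleN1r lieZl scaleN1r. Qed.
Lemma lieBl A B C : lie (A - B) C = lie A C - lie B C.
Proof. by rewrite lieDl lieNl. Qed.
Lemma lieDr A B C : lie A (B + C) = lie A B + lie A C.
Proof. by rewrite lieC lieDl opprD -!(lieC A). Qed.
Lemma lieZr (z : R[i]) A B : lie A (z *: B) = z *: lie A B.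
Proof. by rewrite lieC lieZl -scalerN -lieC. Qed.
Lemma lieNr A B : lie A (- B) = - lie A B.
Proof. by rewrite lieC lieNl -lieC. Qed.
Lemma lieBr A B C : lie A (B - C) = lie A B - lie A C.
Proof. by rewrite lieDr lieNr. Qed.
Lemma lie0l A : lie 0 A = 0.
Proof. by rewrite !lieE mul0mx mulmx0 subr0. Qed.
Lemma lie0r A : lie A 0 = 0.
Proof. by rewrite !lieE mul0mx mulmx0 subr0. Qed.
Lemma liexx A : lie A A = 0.
Proof. by rewrite !lieE subrr. Qed.
Lemma lie_suml (I : Type) (r : seq I) (F : I -> M) A :
  lie (\sum_(k <- r) F k) A = \sum_(k <- r) lie (F k) A.
Proof.
elim: r => [|k r ih]; first by rewrite !big_nil lie0l.
by rewrite !big_cons lieDl ih.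
Qed.
Lemma lie_jacobi A B C : lie A (lie B C) = lie (lie A B) C + lie B (lie A C).
Proof.
rewrite !lieE !mulmxBr !mulmxBl !mulmxA !opprB.
have shuffle (V : zmodType) (a b c d e f : V) :
    a - b + (c - d) = a - e + (c - f) + ((e - d) + (f - b)).
  by rewrite [RHS]addrACA !subrKA [RHS]addrACA [- d - b]addrC -[RHS]addrACA.
exact: shuffle.
Qed.

(** The element of sp(2) with coordinates [s] in the basis S_1, ..., S_10. *)
Definition smx (s : seq R) : M :=
  sp2_mx (Complex 0 s`_0) (Complex s`_2 s`_3) (Complex s`_6 s`_7)
         (Complex s`_8 s`_9) (Complex 0 s`_1) (Complex s`_4 s`_5).

Definition smx_rows (s : seq R) : seq (seq R[i]) :=
  let a12 := Complex s`_2 s`_3 in let a13 := Complex s`_6 s`_7 in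
  let a14 := Complex s`_8 s`_9 in let a34 := Complex s`_4 s`_5 in
  [:: [:: Complex 0 s`_0; a12; a13; a14];
      [:: - a12^*%C; - Complex 0 s`_0; a14^*%C; - a13^*%C];
      [:: - a13^*%C; - a14; Complex 0 s`_1; a34];
      [:: - a14^*%C; a13; - a34^*%C; - Complex 0 s`_1]].

Lemma smxE s i j : smx s i j = nth 0 (nth [::] (smx_rows s) i) j.
Proof. by rewrite mxE. Qed.

Lemma sp2P A : sp2 A <-> exists s, A = smx s.
Proof.
split; last by move=> [s ->]; do 6 eexists; split; last reflexivity.
move=> [[? a1] [[a3 a4] [[a7 a8] [[a9 a10] [[? a2] [[a5 a6] [/= -> -> ->]]]]]]].
by exists [:: a1; a2; a3; a4; a5; a6; a7; a8; a9; a10].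
Qed.

Lemma sum4 (V : zmodType) (F : 'I_4 -> V) : \sum_k F k =
  F (@Ordinal 4 0 isT) + F (@Ordinal 4 1 isT) + F (@Ordinal 4 2 isT) +
  F (@Ordinal 4 3 isT).
Proof.
rewrite !big_ord_recl big_ord0 addr0 !addrA.
by do !congr (_ + _); congr F; apply: val_inj.
Qed.

Lemma lie4 A B i j : lie A B i j =
  \sum_k A i k * B k j - \sum_k B i k * A k j.
Proof. by rewrite lieE !mxE. Qed.

Lemma smxD s t : smx s + smx t = smx [seq s`_k + t`_k | k <- iota 0 10].
Proof.
by mx4; rewrite !mxE /=; apply: complexP; rewrite ?Re_add ?Im_add /=; ring.
Qed.

Lemma smxZ (r : R) s : r%:C%C *: smx s = smx [seq r * s`_k | k <- iota 0 10].
Proof.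
by mx4; rewrite !mxE /=; apply: complexP; rewrite ?Re_mul ?Im_mul /=; ring.
Qed.

Lemma eq_smx s t : (forall k, (k < 10)%N -> s`_k = t`_k) -> smx s = smx t.
Proof. by move=> st; rewrite /smx !st. Qed.

Lemma inner_smx s t : inner (smx s) (smx t) =
  2 / 5 * (\sum_(0 <= k < 6) s`_k * t`_k) + 4 / 5 * (\sum_(6 <= k < 10) s`_k * t`_k).
Proof.
rewrite /inner /mxtrace !big_ord_recl !big_ord0 !mxE !big_ord_recl !big_ord0.
rewrite !mxE/= unlock /=.
by field.
Qed.

Lemma lie_smx s t : lie (smx s) (smx t) = smx [::
     2 * s`_2 * t`_3 - 2 * s`_3 * t`_2 + 2 * s`_6 * t`_7 - 2 * s`_7 * t`_6 + 2 * s`_8 * t`_9 - 2 * s`_9 * t`_8;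
     2 * s`_4 * t`_5 - 2 * s`_5 * t`_4 - 2 * s`_6 * t`_7 + 2 * s`_7 * t`_6 + 2 * s`_8 * t`_9 - 2 * s`_9 * t`_8;
     0 - 2 * s`_0 * t`_3 + 2 * s`_3 * t`_0 - 2 * s`_6 * t`_8 + 2 * s`_7 * t`_9 + 2 * s`_8 * t`_6 - 2 * s`_9 * t`_7;
     2 * s`_0 * t`_2 - 2 * s`_2 * t`_0 - 2 * s`_6 * t`_9 - 2 * s`_7 * t`_8 + 2 * s`_8 * t`_7 + 2 * s`_9 * t`_6;
     0 - 2 * s`_1 * t`_5 + 2 * s`_5 * t`_1 - 2 * s`_6 * t`_8 - 2 * s`_7 * t`_9 + 2 * s`_8 * t`_6 + 2 * s`_9 * t`_7;
     2 * s`_1 * t`_4 - 2 * s`_4 * t`_1 - 2 * s`_6 * t`_9 + 2 * s`_7 * t`_8 - 2 * s`_8 * t`_7 + 2 * s`_9 * t`_6;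
     0 - s`_0 * t`_7 + s`_1 * t`_7 + s`_2 * t`_8 + s`_3 * t`_9 + s`_4 * t`_8 + s`_5 * t`_9 + s`_7 * t`_0 - s`_7 * t`_1 - s`_8 * t`_2 - s`_8 * t`_4 - s`_9 * t`_3 - s`_9 * t`_5;
     s`_0 * t`_6 - s`_1 * t`_6 - s`_2 * t`_9 + s`_3 * t`_8 + s`_4 * t`_9 - s`_5 * t`_8 - s`_6 * t`_0 + s`_6 * t`_1 - s`_8 * t`_3 + s`_8 * t`_5 + s`_9 * t`_2 - s`_9 * t`_4;
     0 - s`_0 * t`_9 - s`_1 * t`_9 - s`_2 * t`_6 - s`_3 * t`_7 - s`_4 * t`_6 + s`_5 * t`_7 + s`_6 * t`_2 + s`_6 * t`_4 + s`_7 * t`_3 - s`_7 * t`_5 + s`_9 * t`_0 + s`_9 * t`_1;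
     s`_0 * t`_8 + s`_1 * t`_8 + s`_2 * t`_7 - s`_3 * t`_6 - s`_4 * t`_7 - s`_5 * t`_6 + s`_6 * t`_3 + s`_6 * t`_5 - s`_7 * t`_2 + s`_7 * t`_4 - s`_8 * t`_0 - s`_8 * t`_1].
Proof.
set u := (X in _ = smx X).
mx4.
all: rewrite lie4 !sum4 !smxE /=.
all: rewrite /u; apply: complexP; rewrite ?(Re_add, Re_opp, Im_add, Im_opp).
all: rewrite ?(Re_mul, Im_mul, Re_opp, Im_opp, Re_conj, Im_conj) /=.
all: ring.
Qed.

End Algebra.

(** * The splitting of sp(2) into m and h, and the cross product on m *)

Section Basis.
Variable R : realType.
Local Notation M := 'M[R[i]]_4.
Local Notation Re := (@complex.Re R).
Local Notation Im := (@complex.Im R).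
Implicit Types A B C : M.

Lemma EmE k l : (k.-1 < 4)%N -> (l.-1 < 4)%N -> Em R k l =
  \matrix_(i, j) ((i == k.-1 :> nat) && (j == l.-1 :> nat))%:R.
Proof.
by move=> k4 l4; apply/matrixP => i j; rewrite !mxE -!val_eqE /= !inordK.
Qed.

Ltac basis_elt :=
  rewrite /S1 /S2 /S3 /S4 /S5 /S6 /S7 /S8 /S9 /S10 !EmE //;
  mx4;
  rewrite smxE !mxE //=; apply: complexP;
  rewrite ?(Re_add, Re_opp, Re_mul, Im_add, Im_opp, Im_mul) /=; ring.

Lemma S1E : S1 R = smx [:: 1]. Proof. by basis_elt. Qed.
Lemma S2E : S2 R = smx [:: 0; 1]. Proof. by basis_elt. Qed.
Lemma S3E : S3 R = smx [:: 0; 0; 1]. Proof. by basis_elt. Qed.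
Lemma S4E : S4 R = smx [:: 0; 0; 0; 1]. Proof. by basis_elt. Qed.
Lemma S5E : S5 R = smx [:: 0; 0; 0; 0; 1]. Proof. by basis_elt. Qed.
Lemma S6E : S6 R = smx [:: 0; 0; 0; 0; 0; 1]. Proof. by basis_elt. Qed.
Lemma S7E : S7 R = smx [:: 0; 0; 0; 0; 0; 0; 1]. Proof. by basis_elt. Qed.
Lemma S8E : S8 R = smx [:: 0; 0; 0; 0; 0; 0; 0; 1]. Proof. by basis_elt. Qed.
Lemma S9E : S9 R = smx [:: 0; 0; 0; 0; 0; 0; 0; 0; 1]. Proof. by basis_elt. Qed.
Lemma S10E : S10 R = smx [:: 0; 0; 0; 0; 0; 0; 0; 0; 0; 1].
Proof. by basis_elt. Qed.

Local Notation p := (Num.sqrt (2 : R)).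
Local Notation q := (Num.sqrt (3 : R)).
Local Notation r := (Num.sqrt (5 : R)).

Let p2 : p ^+ 2 = 2. Proof. exact: sqr_sqrtr. Qed.
Let q2 : q ^+ 2 = 3. Proof. exact: sqr_sqrtr. Qed.
Let r2 : r ^+ 2 = 5. Proof. exact: sqr_sqrtr. Qed.
(** Once the square roots of 6 and 5/2 are written with those of 2, 3 and 5,
    the relations p^2 = 2, q^2 = 3 and r^2 = 5 decide all the identities between
    coordinates. *)
Let sqrt6 : Num.sqrt (6 : R) = p * q.
Proof. by rewrite -sqrtrM//; congr Num.sqrt; ring. Qed.
Let sqrt52 : Num.sqrt (5 / 2 : R) = r * p / 2.
Proof.
have -> : (5 / 2 : R) = (r * p / 2) ^+ 2 by rewrite !exprMn p2 r2; field.
by rewrite sqrtr_sqr ger0_norm// divr_ge0// mulr_ge0// sqrtr_ge0.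
Qed.

(** S-coordinates of the combination of Q_1, ..., Q_10 with coefficients z. *)
Definition ucoord (z : seq R) : seq R :=
  [:: z`_0 / 2 + 3 / 2 * z`_7; - 3 / 2 * z`_0 + z`_7 / 2;
      r * p / 2 * z`_1; r * p / 2 * z`_2;
      p * q / 2 * z`_3 + z`_8; p * q / 2 * z`_4 + z`_9;
      - (p / 2) * z`_3 + q / 2 * z`_8; - (p / 2) * z`_4 + q / 2 * z`_9;
      r / 2 * z`_5; r / 2 * z`_6].

Definition qmx (z : seq R) : M := smx (ucoord z).

Lemma qmxD z w : qmx z + qmx w = qmx [seq z`_k + w`_k | k <- iota 0 10].
Proof.
by rewrite /qmx smxD; apply: eq_smx; do 10 (case=> [|]; first by move=> _ /=; ring).
Qed.

Lemma qmxZ (a : R) z : a%:C%C *: qmx z = qmx [seq a * z`_k | k <- iota 0 10].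
Proof.
by rewrite /qmx smxZ; apply: eq_smx; do 10 (case=> [|]; first by move=> _ /=; ring).
Qed.

Definition unit_seq k : seq R := rcons (nseq k 0) 1.

Lemma smxN (s : seq R) : - smx s = smx [seq - s`_k | k <- iota 0 10].
Proof.
rewrite -scaleN1r (_ : -1 = (-1 : R)%:C%C) ?smxZ; last by rewrite rmorphN.
by congr smx; apply: eq_map => k; rewrite mulN1r.
Qed.

Lemma Q_qmx k : (k < 10)%N -> Q R k = qmx (unit_seq k).
Proof.
do 10 (case: k => [|k] //; first by
  move=> _; rewrite /Q /= ?S1E ?S2E ?S3E ?S4E ?S5E ?S6E ?S7E ?S8E ?S9E ?S10E;
  rewrite ?smxZ ?smxN ?smxD ?sqrt6 ?sqrt52; apply: eq_smx;
  do 10 (case=> [|]; first by move=> _ /=; ring)).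
Qed.

(** The basis Q_1, ..., Q_10 is orthonormal. *)
Lemma inner_qmx z w : inner (qmx z) (qmx w) = \sum_(0 <= k < 10) z`_k * w`_k.
Proof.
rewrite inner_smx unlock /=.
by field: p2 q2 r2.
Qed.

Lemma ord7_lt10 (j : 'I_7) : (j < 10)%N.
Proof. by apply: leq_trans (ltn_ord j) _. Qed.

Lemma eq_qmx (z w : seq R) : (forall k, (k < 10)%N -> z`_k = w`_k) -> qmx z = qmx w.
Proof. by move=> zw; rewrite /qmx /ucoord !zw. Qed.

Lemma inner_qmxQ (z : seq R) k : (k < 10)%N -> inner (qmx z) (Q R k) = z`_k.
Proof.
move=> k10; rewrite Q_qmx// inner_qmx unlock /=; move: k10.
by do 10 (case: k => [|k] //=; first by move=> _; ring).
Qed.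

Lemma inner_QQ j k : (j < 10)%N -> (k < 10)%N -> inner (Q R j) (Q R k) = (j == k)%:R.
Proof.
move=> j10 k10; rewrite (Q_qmx j10) inner_qmxQ// /unit_seq nth_rcons size_nseq.
rewrite nth_nseq [k == j]eq_sym; case: ltngtP => //.
Qed.

Lemma qmx_sum (z : seq R) : qmx z = \sum_(k < 10) (z`_k)%:C%C *: Q R k.
Proof.
rewrite !big_ord_recl big_ord0 !Q_qmx//= !qmxZ addr0 !qmxD.
by apply: eq_qmx; do 10 (case=> [|]; first by move=> _ /=; ring).
Qed.

Lemma sp2_qmx A : sp2 A -> exists z, A = qmx z.
Proof.
move=> /sp2P[s ->].
(* the inner products with Q_1, ..., Q_10 *)
exists [:: 2 / 5 * (s`_0 / 2 - 3 / 2 * s`_1); r * p / 5 * s`_2; r * p / 5 * s`_3;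
  p * q / 5 * s`_4 - 2 / 5 * p * s`_6; p * q / 5 * s`_5 - 2 / 5 * p * s`_7;
  2 / 5 * r * s`_8; 2 / 5 * r * s`_9;
  2 / 5 * (3 / 2 * s`_0 + s`_1 / 2);
  2 / 5 * s`_4 + 2 / 5 * q * s`_6; 2 / 5 * s`_5 + 2 / 5 * q * s`_7].
by apply: eq_smx; do 10 (case=> [|]; first by move=> _ /=; field: p2 q2 r2).
Qed.

Lemma sp2_span A : sp2 A -> A = \sum_(k < 10) (inner A (Q R k))%:C%C *: Q R k.
Proof.
move=> /sp2_qmx[z ->]; rewrite [LHS]qmx_sum; apply: eq_bigr => k _.
by rewrite inner_qmxQ.
Qed.

Lemma sp2_smx (s : seq R) : sp2 (smx s). Proof. by apply/sp2P; exists s. Qed.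

Lemma sp2D A B : sp2 A -> sp2 B -> sp2 (A + B).
Proof. by move=> /sp2P[s ->] /sp2P[t ->]; rewrite smxD; exact: sp2_smx. Qed.

Lemma sp2Z (a : R) A : sp2 A -> sp2 (a%:C%C *: A).
Proof. by move=> /sp2P[s ->]; rewrite smxZ; exact: sp2_smx. Qed.

Lemma sp2N A : sp2 A -> sp2 (- A).
Proof. by move=> /sp2P[s ->]; rewrite smxN; exact: sp2_smx. Qed.

Lemma sp2_lie A B : sp2 A -> sp2 B -> sp2 (lie A B).
Proof. by move=> /sp2P[s ->] /sp2P[t ->]; rewrite lie_smx; exact: sp2_smx. Qed.

Lemma sp2_Q k : (k < 10)%N -> sp2 (Q R k).
Proof. by move=> k10; rewrite Q_qmx//; exact: sp2_smx. Qed.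

Lemma sp2_sum n (F : 'I_n -> M) : (forall k, sp2 (F k)) -> sp2 (\sum_k F k).
Proof.
move=> sF; elim/big_ind: _ => //; last exact: sp2D.
by have := sp2Z 0 (sp2_Q (isT : (0 < 10)%N)); rewrite scale0r.
Qed.

Lemma mspace_sp2 A : mspace A -> sp2 A.
Proof.
move=> [x ->]; apply: sp2_sum => k; apply/sp2Z/sp2_Q.
exact: ord7_lt10.
Qed.

Lemma hspace_sp2 A : hspace A -> sp2 A.
Proof.
move=> [x ->]; apply: sp2_sum => k; apply/sp2Z/sp2_Q.
by rewrite -[10%N]/(7 + 3)%N ltn_add2l.
Qed.

Lemma projmD A B : projm (A + B) = projm A + projm B.
Proof.
rewrite /projm -big_split; apply: eq_bigr => k _ /=.
by rewrite innerDl rmorphD scalerDl.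
Qed.

Lemma projmZ (a : R) A : projm (a%:C%C *: A) = a%:C%C *: projm A.
Proof.
rewrite /projm scaler_sumr; apply: eq_bigr => k _ /=.
by rewrite innerZl rmorphM scalerA.
Qed.

Lemma projmN A : projm (- A) = - projm A.
Proof.
rewrite /projm -sumrN; apply: eq_bigr => k _ /=.
by rewrite innerNl rmorphN scaleNr.
Qed.

Lemma projmB A B : projm (A - B) = projm A - projm B.
Proof. by rewrite projmD projmN. Qed.

Lemma mspace_projm A : mspace (projm A).
Proof. by exists (fun k => inner A (Q R k)). Qed.

Lemma mspace_Q k : (k < 7)%N -> mspace (Q R k).
Proof.
move=> k7; exists (fun j => (j == Ordinal k7)%:R).
rewrite (bigD1 (Ordinal k7))//= eqxx scale1r big1 ?addr0// => j /negbTE->.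
by rewrite scale0r.
Qed.

Lemma projm_id A : mspace A -> projm A = A.
Proof.
move=> [x ->]; rewrite /projm; apply: eq_bigr => k _; congr (_%:C%C *: _).
rewrite inner_suml (bigD1 k)//= innerZl inner_QQ ?ord7_lt10// eqxx mulr1.
rewrite big1 ?addr0// => j /negbTE jk.
by rewrite innerZl inner_QQ ?ord7_lt10// val_eqE jk mulr0.
Qed.

Lemma inner_projm A B : mspace B -> inner (projm A) B = inner A B.
Proof.
move=> [x ->]; rewrite !inner_sumr; apply: eq_bigr => k _; rewrite !innerZr.
congr (_ * _); rewrite inner_suml (bigD1 k)//= innerZl inner_QQ ?ord7_lt10// eqxx mulr1.
rewrite big1 ?addr0// => j /negbTE jk.
by rewrite innerZl inner_QQ ?ord7_lt10// val_eqE jk mulr0.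
Qed.

Lemma mspaceD A B : mspace A -> mspace B -> mspace (A + B).
Proof. by move=> /projm_id<- /projm_id<-; rewrite -projmD; exact: mspace_projm. Qed.
Lemma mspaceZ (a : R) A : mspace A -> mspace (a%:C%C *: A).
Proof. by move=> /projm_id<-; rewrite -projmZ; exact: mspace_projm. Qed.
Lemma mspaceN A : mspace A -> mspace (- A).
Proof. by move=> /projm_id<-; rewrite -projmN; exact: mspace_projm. Qed.
Lemma mspaceB A B : mspace A -> mspace B -> mspace (A - B).
Proof. by move=> mA mB; apply: mspaceD => //; exact: mspaceN. Qed.

Lemma sp2_inner_eq0 A : sp2 A -> inner A A = 0 -> A = 0.
Proof.
move=> /sp2_qmx[z ->]; rewrite inner_qmx big_mkord => /eqP.
rewrite psumr_eq0 => [/allP h|k _]; last by rewrite -expr2 sqr_ge0.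
rewrite qmx_sum big1// => k _; have := h k (mem_index_enum _).
by rewrite /= mulf_eq0 orbb => /eqP->; rewrite scale0r.
Qed.

Lemma hspace_sub A : sp2 A -> hspace (A - projm A).
Proof.
move=> sA; exists (fun k => inner A (Q R (7 + k)%N)).
rewrite {1}(sp2_span sA) (@big_split_ord _ _ _ 7 3)/= /projm.
by rewrite addrAC subrr add0r.
Qed.

Lemma inner_mh A B : mspace A -> hspace B -> inner A B = 0.
Proof.
move=> [x ->] [y ->]; rewrite inner_suml big1// => j _; rewrite inner_sumr big1// => k _.
rewrite innerZl innerZr inner_QQ; last 2 first.
- exact: ord7_lt10.
- by rewrite -[10%N]/(7 + 3)%N ltn_add2l.
rewrite (_ : _ == _ = false) ?mulr0//; apply/negbTE.
by rewrite neq_ltn (leq_trans (ltn_ord j))// leq_addr.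
Qed.

Lemma mspace_qmx A : mspace A -> exists z : seq R, (size z <= 7)%N /\ A = qmx z.
Proof.
move=> [x ->]; exists [seq x k | k <- enum 'I_7].
rewrite size_map size_enum_ord; split=> //.
rewrite qmx_sum (@big_split_ord _ _ _ 7 3)/= [X in _ + X]big1 ?addr0.
  apply: eq_bigr => k _; rewrite (nth_map k) ?size_enum_ord//.
  by rewrite nth_ord_enum.
by move=> k _; rewrite nth_default ?scale0r// size_map size_enum_ord leq_addr.
Qed.

Lemma hspace_qmx A : hspace A -> exists a b c : R, A = qmx [:: 0; 0; 0; 0; 0; 0; 0; a; b; c].
Proof.
move=> [x ->]; set a := x ord0; set b := x (Ordinal (isT : 1 < 3)%N).
set c := x (Ordinal (isT : 2 < 3)%N); exists a, b, c.
rewrite qmx_sum (@big_split_ord _ _ _ 7 3)/= [X in _ = X + _]big1 ?add0r.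
  by rewrite !big_ord_recl !big_ord0 /=; do !congr (_ + _); congr ((x _)%:C%C *: _); apply: val_inj.
move=> k _; rewrite (_ : nth _ _ _ = 0) ?scale0r//=.
have h m : (m < 7)%N -> [:: 0; 0; 0; 0; 0; 0; 0; a; b; c]`_m = 0.
  by do 7 (case: m => [|m] //).
exact: h (ltn_ord k).
Qed.

(** h is a subalgebra: the three brackets of its basis have no component in m. *)
Lemma inner_hh_m A B C : hspace A -> hspace B -> mspace C -> inner (lie A B) C = 0.
Proof.
move=> hA hB [x ->]; rewrite inner_sumr big1// => k _; rewrite innerZr.
rewrite (_ : inner _ _ = 0) ?mulr0//.
move: hA hB => /hspace_qmx[a [b [c ->]]] /hspace_qmx[a' [b' [c' ->]]].
rewrite Q_qmx; last exact: ord7_lt10.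
rewrite /qmx lie_smx inner_smx; case: k => k /= k7; move: k7.
by do 7 (case: k => [|k] //; first by move=> _; rewrite unlock /=; field: p2 q2 r2).
Qed.

(** The cross product of the imaginary octonions. In the basis Q_1, ..., Q_7
    the bracket of m, projected to m, has the structure constants 0, 1 and -1 of
    this product, see [projm_lie_qmx]; in particular H acts on m through G_2. *)
Definition cross (x y : seq R) : seq R :=
  [:: (x`_1 * y`_2 - x`_2 * y`_1) - (x`_3 * y`_4 - x`_4 * y`_3) - (x`_5 * y`_6 - x`_6 * y`_5);
      (x`_2 * y`_0 - x`_0 * y`_2) + (x`_3 * y`_5 - x`_5 * y`_3) - (x`_4 * y`_6 - x`_6 * y`_4);
      (x`_0 * y`_1 - x`_1 * y`_0) + (x`_3 * y`_6 - x`_6 * y`_3) + (x`_4 * y`_5 - x`_5 * y`_4);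
      - (x`_4 * y`_0 - x`_0 * y`_4) + (x`_5 * y`_1 - x`_1 * y`_5) + (x`_6 * y`_2 - x`_2 * y`_6);
      - (x`_0 * y`_3 - x`_3 * y`_0) - (x`_6 * y`_1 - x`_1 * y`_6) + (x`_5 * y`_2 - x`_2 * y`_5);
      - (x`_6 * y`_0 - x`_0 * y`_6) + (x`_1 * y`_3 - x`_3 * y`_1) + (x`_2 * y`_4 - x`_4 * y`_2);
      - (x`_0 * y`_5 - x`_5 * y`_0) - (x`_1 * y`_4 - x`_4 * y`_1) + (x`_2 * y`_3 - x`_3 * y`_2)].

Lemma projm_qmx (z : seq R) : projm (qmx z) = qmx (take 7 z).
Proof.
rewrite [RHS]qmx_sum (@big_split_ord _ _ _ 7 3)/= [X in _ = _ + X]big1 ?addr0.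
  apply: eq_bigr => k _; rewrite nth_take// inner_qmxQ//.
  exact: ord7_lt10.
move=> k _; rewrite nth_default ?scale0r// size_take_min.
exact: leq_trans (geq_minl _ _) (leq_addr _ _).
Qed.

Lemma projm_lie_qmx (x y : seq R) : (size x <= 7)%N -> (size y <= 7)%N ->
  projm (lie (qmx x) (qmx y)) = qmx (cross x y).
Proof.
move=> x7 y7.
have -> : projm (lie (qmx x) (qmx y)) = projm (qmx (cross x y)); last first.
  by rewrite projm_qmx.
rewrite /projm; apply: eq_bigr => k _; congr (_%:C%C *: _).
rewrite inner_qmxQ; last exact: ord7_lt10.
rewrite Q_qmx; last exact: ord7_lt10.
have e : forall s : seq R, (size s <= 7)%N -> [/\ s`_7 = 0, s`_8 = 0 & s`_9 = 0].
  by move=> s s7; split; rewrite nth_default//; apply: leq_trans s7 _.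
have [x07 x8 x9] := e _ x7; have [y07 y8 y9] := e _ y7.
have ue (s : seq R) : (size s <= 7)%N -> smx (ucoord s) = smx
  [:: s`_0 / 2; - 3 / 2 * s`_0; r * p / 2 * s`_1; r * p / 2 * s`_2;
      p * q / 2 * s`_3; p * q / 2 * s`_4; - (p / 2) * s`_3; - (p / 2) * s`_4;
      r / 2 * s`_5; r / 2 * s`_6].
  by move=> /e[s7 s8 s9]; rewrite /ucoord s7 s8 s9 !mulr0 !mul0r !addr0.
rewrite /qmx (ue x)// (ue y)// lie_smx inner_smx.
case: k => k /= k7; move: k7.
by do 7 (case: k => [|k] //; first by move=> _; rewrite unlock /=; field: p2 q2 r2).
Qed.

(** The identity v x (v x y) = <v, y> v - <v, v> y of the octonionic cross
    product. For a unit vector v it makes the bracket with v, followed by the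
    projection to m, a complex structure on the orthogonal complement of v. *)
Lemma projm_lie_sq A B : mspace A -> mspace B ->
  projm (lie A (projm (lie A B))) =
  (inner A B)%:C%C *: A - (inner A A)%:C%C *: B.
Proof.
move=> /mspace_qmx[x [x7 ->]] /mspace_qmx[y [y7 ->]].
rewrite !projm_lie_qmx// !inner_qmx -scaleNr -rmorphN/= !qmxZ qmxD.
have e : forall s : seq R, (size s <= 7)%N -> [/\ s`_7 = 0, s`_8 = 0 & s`_9 = 0].
  by move=> s s7; split; rewrite nth_default//; apply: leq_trans s7 _.
have [x07 x8 x9] := e _ x7; have [y07 y8 y9] := e _ y7.
have [e1 e2] : (\sum_(0 <= k < 10) x`_k * y`_k = \sum_(0 <= k < 7) x`_k * y`_k) /\
   (\sum_(0 <= k < 10) x`_k * x`_k = \sum_(0 <= k < 7) x`_k * x`_k).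
  by rewrite !unlock /= x07 x8 x9 !mul0r !addr0.
rewrite e1 e2; apply: eq_qmx.
do 7 (case=> [|]; first by move=> _; rewrite unlock /=; ring).
by do 3 (case=> [|]; first by move=> _; rewrite /= ?x07 ?x8 ?x9 ?y07 ?y8 ?y9; ring).
Qed.

(** By invariance, the h-component of [A, B] pairs with h as B pairs with
    [h, A], which lies in h and is orthogonal to B. *)
Lemma mspace_lie_h A B : hspace A -> mspace B -> mspace (lie A B).
Proof.
move=> hA mB; have sl : sp2 (lie A B) by apply: sp2_lie; [exact: hspace_sp2|exact: mspace_sp2].
have hX := hspace_sub sl; set X := _ - _ in hX.
suff X0 : X = 0 by rewrite -[lie A B](subrK (projm (lie A B))) -/X X0 add0r; exact: mspace_projm.
apply: sp2_inner_eq0; first exact: hspace_sp2.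
rewrite {1}/X innerBl (inner_mh (mspace_projm _) hX) subr0.
by rewrite lieC innerNl inner_lie innerC inner_hh_m// oppr0.
Qed.

End Basis.

(** * The group Sp(2) and the adjoint action of H *)

Section Group.
Variable R : realType.
Local Notation M := 'M[R[i]]_4.
Implicit Types A B C g h : M.
Local Notation Re := (@complex.Re R).
Local Notation Im := (@complex.Im R).
Local Notation J := (Jm R).

Lemma ctrmxM A B : ctrmx (A *m B) = ctrmx B *m ctrmx A.
Proof. by rewrite /ctrmx map_mxM trmx_mul. Qed.

Lemma ctrmxK A : ctrmx (ctrmx A) = A.
Proof. by apply/matrixP => i j; rewrite !mxE conjcK. Qed.

Lemma ctrmx1 : ctrmx 1%:M = 1%:M :> M.
Proof. by rewrite /ctrmx map_mx1 trmx1. Qed.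

Lemma JmE : J = \matrix_(i, j) nth 0 (nth [::]
  [:: [:: 0; 1; 0; 0]; [:: -1; 0; 0; 0]; [:: 0; 0; 0; -1]; [:: 0; 0; 1; 0]] i) j.
Proof.
rewrite /Jm !EmE//; mx4;
  by rewrite !mxE /= ?(addr0, add0r, oppr0, subr0).
Qed.

Lemma sp2_cond A : sp2 A -> ctrmx A = - A /\ A^T *m J + J *m A = 0.
Proof.
move=> /sp2P[s ->]; split.
  mx4;
  rewrite !mxE /=; apply: complexP;
  by rewrite ?(Re_conj, Re_opp, Im_conj, Im_opp, Re_conj, Im_conj) /=; ring.
rewrite JmE; mx4.
all: rewrite mxE [X in X + _]mxE [X in _ + X]mxE !sum4 !mxE /=.
all: ring.
Qed.

(** The linearized equations of Sp(2) determine sp(2). Unlike the explicit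
    entries, they are visibly stable under conjugation by Sp(2). *)
Lemma cond_sp2 A : ctrmx A = - A -> A^T *m J + J *m A = 0 -> sp2 A.
Proof.
move=> sk sy; pose a k l := A (inord k) (inord l).
have aE i j : A i j = a i j by rewrite /a !inord_val.
have ska k l : (k < 4)%N -> (l < 4)%N -> (a l k)^*%C = - a k l.
  by move=> k4 l4; have := congr1 (fun B : M => B (inord k) (inord l)) sk; rewrite !mxE.
have sya k l : (k < 4)%N -> (l < 4)%N ->
    \sum_(m < 4) a m k * J m (inord l) + \sum_(m < 4) J (inord k) m * a m l = 0.
  move=> k4 l4.
  transitivity ((A^T *m J + J *m A) (inord k) (inord l)); last by rewrite sy mxE.
  rewrite [RHS]mxE [X in _ = X + _]mxE [X in _ = _ + X]mxE.
  by congr (_ + _); apply: eq_bigr => m _; rewrite ?[A^T _ _]mxE aE !inordK.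
have h01 := sya 0%N 1%N isT isT; have h02 := sya 0%N 2%N isT isT.
have h03 := sya 0%N 3%N isT isT; have h12 := sya 1%N 2%N isT isT.
have h13 := sya 1%N 3%N isT isT; have h23 := sya 2%N 3%N isT isT.
move: h01 h02 h03 h12 h13 h23; rewrite JmE !sum4 !mxE !inordK//=.
rewrite !(mulr0, mul0r, mulr1, mul1r, mulrN1, mulN1r, addr0, add0r).
move=> h01 h02 h03 h12 h13 h23.
have sk' k l : (k < 4)%N -> (l < 4)%N -> a k l = - (a l k)^*%C.
  by move=> k4 l4; rewrite ska// opprK.
exists (a 0%N 0%N), (a 0%N 1%N), (a 0%N 2%N), (a 0%N 3%N), (a 2%N 2%N), (a 2%N 3%N).
have diag k : (k < 4)%N -> Re (a k k) = 0.
  move=> k4; have := congr1 Re (ska k k k4 k4); rewrite Re_conj Re_opp => h.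
  lra.
split; [exact: diag|exact: diag|].
have sr k l : (k < 4)%N -> (l < 4)%N -> Re (a l k) = - Re (a k l).
  by move=> k4 l4; rewrite (sk' l k)// Re_opp Re_conj.
have si k l : (k < 4)%N -> (l < 4)%N -> Im (a l k) = Im (a k l).
  by move=> k4 l4; rewrite (sk' l k)// Im_opp Im_conj opprK.
have := (sr 0%N 1%N isT isT, sr 0%N 2%N isT isT, sr 0%N 3%N isT isT,
  sr 1%N 2%N isT isT, sr 1%N 3%N isT isT, sr 2%N 3%N isT isT).
have := (si 0%N 1%N isT isT, si 0%N 2%N isT isT, si 0%N 3%N isT isT,
  si 1%N 2%N isT isT, si 1%N 3%N isT isT, si 2%N 3%N isT isT).
move=> [[[[[i01 i02] i03] i12] i13] i23] [[[[[r01 r02] r03] r12] r13] r23].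
move: (congr1 Re h01) (congr1 Re h02) (congr1 Re h03) (congr1 Re h12)
 (congr1 Re h13) (congr1 Re h23) (congr1 Im h01) (congr1 Im h02) (congr1 Im h03)
 (congr1 Im h12) (congr1 Im h13) (congr1 Im h23).
rewrite !(Re_add, Im_add) ?(Re_opp, Im_opp) /= {h01 h02 h03 h12 h13 h23}.
move=> h1 h2 h3 h4 h5 h6 h7 h8 h9 h10 h11 h12.
mx4; rewrite aE mxE //=.
all: apply: complexP; rewrite ?(Re_opp, Im_opp, Re_conj, Im_conj);
  [clear h7 h8 h9 h10 h11 h12 i01 i02 i03 i12 i13 i23
  |clear h1 h2 h3 h4 h5 h6 r01 r02 r03 r12 r13 r23]; lra.
Qed.

End Group.

Section GroupAction.
Variable R : realType.
Local Notation M := 'M[R[i]]_4.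
Implicit Types A B C g h : M.
Local Notation J := (Jm R).

Lemma Sp2_ctrmxl g : Sp2 g -> ctrmx g *m g = 1%:M. Proof. by case. Qed.
Lemma Sp2_ctrmxr g : Sp2 g -> g *m ctrmx g = 1%:M.
Proof. by move=> /Sp2_ctrmxl/mulmx1C. Qed.

Lemma Sp2_invmx g : Sp2 g -> invmx g = ctrmx g.
Proof.
move=> Sg; have gu : g \in unitmx by case: (mulmx1_unit (Sp2_ctrmxr Sg)).
by rewrite -[LHS]mul1mx -(Sp2_ctrmxl Sg) -mulmxA mulmxV// mulmx1.
Qed.

Lemma Sp2M g h : Sp2 g -> Sp2 h -> Sp2 (g *m h).
Proof.
move=> [g1 g2] [h1 h2]; split.
  by rewrite -/(ctrmx _) ctrmxM mulmxA -(mulmxA _ _ g) [ctrmx g *m g]g1 mulmx1.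
by rewrite trmx_mul -!mulmxA (mulmxA J) (mulmxA g^T) (mulmxA g^T J) g2 mulmxA.
Qed.

Lemma Sp2_1 : Sp2 (1%:M : M).
Proof. by split; [rewrite -/(ctrmx _) ctrmx1 mulmx1|rewrite trmx1 mul1mx mulmx1]. Qed.

Lemma Sp2_ctrmx g : Sp2 g -> Sp2 (ctrmx g).
Proof.
move=> Sg; split; first by rewrite -/(ctrmx _) ctrmxK Sp2_ctrmxr.
have [_ g2] := Sg.
rewrite -{1}g2 !mulmxA -trmx_mul Sp2_ctrmxr// trmx1 mul1mx.
by rewrite -mulmxA Sp2_ctrmxr// mulmx1.
Qed.

Lemma sp2_Ad g A : Sp2 g -> sp2 A -> sp2 (ctrmx g *m A *m g).
Proof.
move=> Sg /sp2_cond[sk sy]; apply: cond_sp2.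
  by rewrite !ctrmxM ctrmxK sk mulNmx mulmxN mulmxA.
have [_ g2] := Sg; have [_ g2'] := Sp2_ctrmx Sg.
have Jg : J *m ctrmx g = g^T *m J.
  by rewrite -{1}g2 -!mulmxA Sp2_ctrmxr// mulmx1.
have gJ : (ctrmx g)^T *m J = J *m g.
  by rewrite -{2}g2' -!mulmxA Sp2_ctrmxl// mulmx1.
rewrite !trmx_mul !mulmxA Jg -[_ *m _ *m _ *m J]mulmxA gJ !mulmxA.
by rewrite -mulmxDl -!mulmxA -mulmxDr sy mulmx0 mul0mx.
Qed.

Lemma sp2_Ad' g A : Sp2 g -> sp2 A -> sp2 (g *m A *m ctrmx g).
Proof. by move=> /Sp2_ctrmx Sg /(sp2_Ad Sg); rewrite ctrmxK. Qed.

Lemma ctrmx_sp2 A : sp2 A -> ctrmx A = - A.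
Proof. by move=> /sp2_cond[]. Qed.

Lemma is_mderive_const (c : R -> M) : (forall t, is_mderive c t 0) -> forall t, c t = c 0.
Proof.
move=> c0 t; apply/matrixP => i j; apply: complexP.
  apply: (@is_derive_0_is_cst _ (fun s => complex.Re (c s i j))) => s.
  by have [+ _] := c0 s i j; rewrite mxE.
apply: (@is_derive_0_is_cst _ (fun s => complex.Im (c s i j))) => s.
by have [_] := c0 s i j; rewrite mxE.
Qed.

Lemma is_mderive_expm_r A s :
  is_mderive (fun s : R => expm (s%:C%C *: A)) s (expm (s%:C%C *: A) *m A).
Proof. by rewrite -expm_commute; exact: is_mderive_expm. Qed.

(** The defining equations of Sp(2) hold at s = 0, and their left-hand sides
    are constant along s |-> exp(sA). *)
Lemma Sp2_expmZ A (s : R) : sp2 A -> Sp2 (expm (s%:C%C *: A)).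
Proof.
move=> sA; have [sk sy] := sp2_cond sA.
pose E (s : R) := expm (s%:C%C *: A).
have E0 : E 0 = 1%:M by exact: expm0.
split.
  have := @is_mderive_const (fun s => ctrmx (E s) *m E s) _ s.
  rewrite E0 ctrmx1 mulmx1; apply => t.
  apply: is_mderive_eq (is_mderiveM (is_mderive_ctr (is_mderive_expm A t)) (is_mderive_expm A t)) _.
  by rewrite ctrmxM sk mulmxN mulNmx !mulmxA addNr.
have := @is_mderive_const (fun s => (E s)^T *m J *m E s) _ s.
rewrite E0 trmx1 mul1mx mulmx1; apply => t.
apply: is_mderive_eq (is_mderiveM (is_mderiveM (is_mderive_tr (is_mderive_expm A t)) (is_mderive_cst J t)) (is_mderive_expm A t)) _.
by rewrite mulmx0 addr0 trmx_mul !mulmxA -mulmxDl -!mulmxA -mulmxDr sy mulmx0 mul0mx.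
Qed.

Lemma expm1E A : expm ((1 : R)%:C%C *: A) = expm A.
Proof. by rewrite rmorph1 scale1r. Qed.

Lemma H_Sp2 h : H h -> Sp2 h.
Proof.
move=> [s hs ->]; elim: s hs => [|X s ih] hs; first by rewrite big_nil; exact: Sp2_1.
rewrite big_cons; apply: Sp2M.
  by rewrite -expm1E; apply: Sp2_expmZ; apply: hspace_sp2; apply: hs; rewrite mem_head.
by apply: ih => Y Ys; apply: hs; rewrite inE Ys orbT.
Qed.

Lemma projm_h A : hspace A -> projm A = 0.
Proof.
move=> hA; rewrite /projm big1// => k _.
by rewrite innerC (inner_mh (mspace_Q _ (ltn_ord k)) hA) scale0r.
Qed.

Lemma is_mderive_Ad (g : R -> M) g' A t : is_mderive g t g' -> is_mderive (fun s => ctrmx (g s) *m A *m g s) t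
  (ctrmx g' *m A *m g t + ctrmx (g t) *m A *m g').
Proof.
move=> gd; apply: is_mderive_eq (is_mderiveM (is_mderiveM (is_mderive_ctr gd) (is_mderive_cst A t)) gd) _.
by rewrite mulmx0 addr0.
Qed.

(** As [w] is skew-Hermitian, the product rule yields a commutator. *)
Lemma is_mderive_Ad_lie (g : R -> M) w A t : sp2 w -> is_mderive g t (g t *m w) ->
  is_mderive (fun s => ctrmx (g s) *m A *m g s) t (lie (ctrmx (g t) *m A *m g t) w).
Proof.
move=> sw gd; apply: is_mderive_eq (is_mderive_Ad A gd) _.
by rewrite ctrmxM ctrmx_sp2// !mulNmx lieE addrC !mulmxA.
Qed.

Lemma inner_sym0 A B : inner A B = 0 -> inner A B + inner B A = 0.
Proof. by move=> AB; rewrite [inner B A]innerC AB addr0. Qed.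

(** Along x(s) = exp(-sX) A exp(sX), the squared norm of the h-component has
    derivative zero: x' = [x, X], and the bracket with X preserves m and acts
    skew-symmetrically on h. Since it vanishes at s = 0, x stays in m. *)
Lemma Ad_exp_m A X : hspace X -> mspace A -> mspace (ctrmx (expm X) *m A *m expm X).
Proof.
move=> hX mA; have sX := hspace_sp2 hX.
pose x (s : R) := ctrmx (expm (s%:C%C *: X)) *m A *m expm (s%:C%C *: X).
have xd s : is_mderive x s (lie (x s) X) by apply: is_mderive_Ad_lie => //; exact: is_mderive_expm_r.
have sx s : sp2 (x s) by apply: sp2_Ad; [exact: Sp2_expmZ|exact: mspace_sp2].
pose z s := x s - projm (x s).
have zd s : is_mderive z s (lie (x s) X - projm (lie (x s) X)) by apply: is_mderiveB => //; exact: is_mderive_projm.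
have hz s : hspace (z s) by apply: hspace_sub.
have N0 s : inner (z s) (z s) = 0.
  have -> : 0 = inner (z 0) (z 0).
    by rewrite /z /x expm0 ctrmx1 mul1mx mulmx1 projm_id// subrr inner0l.
  apply: (@is_derive_0_is_cst _ (fun s => inner (z s) (z s))) => {}s.
  apply: is_derive_eq (is_derive_inner (zd s) (zd s)) _.
  have e : inner (lie (x s) X - projm (lie (x s) X)) (z s) = 0.
    rewrite innerBl (inner_mh (mspace_projm _) (hz s)) subr0.
    have xE : x s = z s + projm (x s) by rewrite subrK.
    rewrite {1}xE lieDl innerDl (innerC (lie (z s) X)) -inner_lie liexx inner0l add0r.
    by rewrite inner_lie innerC inner_hh_m//; exact: mspace_projm.
  exact: inner_sym0.
have := sp2_inner_eq0 (hspace_sp2 (hz 1)) (N0 1).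
rewrite /z /x expm1E => /eqP; rewrite subr_eq0 => /eqP->.
exact: mspace_projm.
Qed.

(** The argument of [Ad_exp_m] with m and h exchanged. *)
Lemma Ad_exp_h A X : hspace X -> hspace A -> projm (ctrmx (expm X) *m A *m expm X) = 0.
Proof.
move=> hX hA; have sX := hspace_sp2 hX.
pose x (s : R) := ctrmx (expm (s%:C%C *: X)) *m A *m expm (s%:C%C *: X).
have xd s : is_mderive x s (lie (x s) X) by apply: is_mderive_Ad_lie => //; exact: is_mderive_expm_r.
have sx s : sp2 (x s) by apply: sp2_Ad; [exact: Sp2_expmZ|exact: hspace_sp2].
pose z s := projm (x s).
have zd s : is_mderive z s (projm (lie (x s) X)) by exact: is_mderive_projm.
have mz s : mspace (z s) by exact: mspace_projm.
have N0 s : inner (z s) (z s) = 0.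
  have -> : 0 = inner (z 0) (z 0).
    by rewrite /z /x expm0 ctrmx1 mul1mx mulmx1 projm_h// inner0l.
  apply: (@is_derive_0_is_cst _ (fun s => inner (z s) (z s))) => {}s.
  apply: is_derive_eq (is_derive_inner (zd s) (zd s)) _.
  have e : inner (projm (lie (x s) X)) (z s) = 0.
    rewrite inner_projm//.
    have xE : x s = (x s - projm (x s)) + z s by rewrite subrK.
    rewrite {1}xE lieDl innerDl (innerC (lie (z s) X)) -inner_lie liexx inner0l addr0.
    by rewrite inner_hh_m//; exact: hspace_sub.
  exact: inner_sym0.
by have := sp2_inner_eq0 (mspace_sp2 (mz 1)) (N0 1); rewrite /z /x expm1E.
Qed.

Lemma projm_Ad_H h A : H h -> sp2 A ->
  projm (ctrmx h *m A *m h) = ctrmx h *m projm A *m h.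
Proof.
move=> [s hs ->]; elim: s hs A => [|X s ih] hs A sA.
  by rewrite big_nil -[1%R]/(1%:M : M) ctrmx1 !mul1mx !mulmx1.
have hX : hspace X by apply: hs; rewrite mem_head.
have SX : Sp2 (expm X) by rewrite -expm1E; exact/Sp2_expmZ/hspace_sp2.
rewrite big_cons -[(_ * _)%R]/(_ *m _) ctrmxM.
set P := \prod_(_ <- _) _.
have e B : ctrmx P *m ctrmx (expm X) *m B *m (expm X *m P) = ctrmx P *m (ctrmx (expm X) *m B *m expm X) *m P.
  by rewrite !mulmxA.
rewrite !e ih; last 2 first.
- by move=> Y Ys; apply: hs; rewrite inE Ys orbT.
- exact: sp2_Ad.
congr (_ *m _ *m _).
rewrite -{1}[A](subrK (projm A)) mulmxDr mulmxDl projmD Ad_exp_h ?add0r//.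
  by apply/projm_id/Ad_exp_m => //; exact: mspace_projm.
exact: hspace_sub.
Qed.

End GroupAction.

(** * Killing vector fields *)

Section Killing.
Variable R : realType.
Local Notation M := 'M[R[i]]_4.
Local Notation Mo := 'M[R[i]^o]_4.
Implicit Types A B C g h : M.
Local Notation Re := (@complex.Re R).
Local Notation Im := (@complex.Im R).

Definition ccont (F : Mo -> R[i]) :=
  continuous (fun g : Mo => Re (F g)) /\ continuous (fun g : Mo => Im (F g)).

Lemma ccont_coord i j : ccont (fun g : Mo => g i j).
Proof.
have key (f : R[i] -> R) : (forall x y, `|f x - f y| <= Re `|x - y|) ->
    continuous (fun g : Mo => f (g i j)).
  move=> fl g; have FF := nbhs_filter (g : Mo); apply/cvgrPdist_lt => e e0.
  have eC : 0 < (e%:C%C : R[i]) by rewrite ltcR.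
  apply: (filterS _ (nbhsx_ballx (g : Mo) _ eC)).
  move=> g' [_ /(_ i j)]; rewrite -ball_normE /ball_ /= => gg'.
  apply: le_lt_trans (fl _ _) _.
  by move: gg'; rewrite ltcE => /andP[_].
have sq a b : `|a| <= Num.sqrt (a ^+ 2 + b ^+ 2) :> R.
  by rewrite -sqrtr_sqr ler_wsqrtr// lerDl sqr_ge0.
have sq' a b : `|b| <= Num.sqrt (a ^+ 2 + b ^+ 2) :> R by rewrite addrC; apply: sq.
by split; apply: key => -[a b] [a' b'] /=; [exact: sq|exact: sq'].
Qed.

Lemma ccont_cst z : ccont (fun=> z).
Proof. by split => g; have FF := nbhs_filter (g : Mo); exact: cvg_cst. Qed.

Lemma ccontD F G : ccont F -> ccont G -> ccont (fun g : Mo => F g + G g).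
Proof.
move=> [f1 f2] [g1 g2]; split.
  rewrite (funext (fun g : Mo => Re_add (F g) (G g))) => g.
  have FF := nbhs_filter (g : Mo).
  by apply: cvgD; [exact: f1|exact: g1].
rewrite (funext (fun g : Mo => Im_add (F g) (G g))) => g.
have FF := nbhs_filter (g : Mo).
by apply: cvgD; [exact: f2|exact: g2].
Qed.

Lemma ccontM F G : ccont F -> ccont G -> ccont (fun g : Mo => F g * G g).
Proof.
move=> [f1 f2] [g1 g2]; split.
  rewrite (funext (fun g : Mo => Re_mul (F g) (G g))) => g.
  have FF := nbhs_filter (g : Mo).
  by apply: cvgB; apply: cvgM; [exact: f1|exact: g1|exact: f2|exact: g2].
rewrite (funext (fun g : Mo => Im_mul (F g) (G g))) => g.
have FF := nbhs_filter (g : Mo).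
by apply: cvgD; apply: cvgM; [exact: f1|exact: g2|exact: f2|exact: g1].
Qed.

Lemma ccont_conj F : ccont F -> ccont (fun g : Mo => (F g)^*%C).
Proof.
move=> [f1 f2]; split; first by rewrite (funext (fun g : Mo => Re_conj (F g))).
rewrite (funext (fun g : Mo => Im_conj (F g))) => g.
by have FF := nbhs_filter (g : Mo); apply: cvgN; exact: f2.
Qed.

Lemma eq_ccont F G : F =1 G -> ccont F -> ccont G.
Proof. by move=> /funext->. Qed.

Lemma ccont_sum (I : Type) (r : seq I) (F : I -> Mo -> R[i]) :
  (forall k, ccont (F k)) -> ccont (fun g : Mo => \sum_(k <- r) F k g).
Proof.
move=> h; elim: r => [|k r ih].
  by apply: eq_ccont (ccont_cst 0) => g; rewrite big_nil.
by apply: eq_ccont (ccontD (h k) ih) => g; rewrite big_cons.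
Qed.

(** The components of a Killing field are functions g |-> Re tr (B g^* A g).
    Differentiating such a function along a left-invariant field only changes
    B, so that all of them are smooth. *)
Section Form.
Variable A : M.

Let form B g : R := Re (\tr (B *m (ctrmx g *m A *m g))).

Let form_continuous B : continuous (form B : Mo -> R).
Proof.
have hctr i j : ccont (fun g : Mo => ctrmx g i j).
  by apply: eq_ccont (ccont_conj (ccont_coord j i)) => g; rewrite !mxE.
have hmul (F G : M -> M) : (forall i j, ccont (fun g : Mo => F g i j)) ->
    (forall i j, ccont (fun g : Mo => G g i j)) ->
    forall i j, ccont (fun g : Mo => (F g *m G g) i j).
  move=> hF hG i j.
  apply: eq_ccont (ccont_sum (index_enum 'I_4) (fun k => ccontM (hF i k) (hG k j))) => g.
  by rewrite mxE.
have hcst C i j : ccont (fun=> C i j) by exact: ccont_cst.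
have hA := hmul _ _ (hmul _ _ hctr (hcst A)) ccont_coord.
by have [] := ccont_sum (index_enum 'I_4) (fun i => hmul _ _ (hcst B) hA i i).
Qed.

Let is_derive_form B X g :
  is_derive (0 : R) (1 : R) (fun s : R => form B (g *m expm (s%:C%C *: X)))
    (form (B *m ctrmx X + X *m B) g).
Proof.
have gd := is_mderive_expm_l X g 0.
have [h _] := is_cderive_trace (is_mderiveM (is_mderive_cst B 0) (is_mderive_Ad A gd)).
apply: is_derive_eq h _; rewrite expm0 mulmx1 mul0mx add0r ctrmxM.
rewrite /form; congr Re.
have e1 : B *m (ctrmx X *m ctrmx g *m A *m g) = B *m ctrmx X *m (ctrmx g *m A *m g).
  by rewrite !mulmxA.
have e2 : B *m (ctrmx g *m A *m (g *m X)) = (B *m (ctrmx g *m A *m g)) *m X.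
  by rewrite !mulmxA.
rewrite mulmxDr e1 e2 mulmxDl 2!mxtraceD; congr (_ + _).
have -> : X *m B *m (ctrmx g *m A *m g) = X *m (B *m (ctrmx g *m A *m g)).
  by rewrite !mulmxA.
exact: mxtrace_mulC.
Qed.

Lemma form_smooth B : smoothSp2 (fun g => Re (\tr (B *m (ctrmx g *m A *m g)))).
Proof.
move=> k; rewrite -/(form B); elim: k B => [|k ih] B /=.
  by split=> //; apply: continuous_subspaceT; exact: form_continuous.
split; first by apply: continuous_subspaceT; exact: form_continuous.
move=> X sX; split=> [g Sg|].
  by have [] := is_derive_form B X g.
rewrite (_ : dirD X (form B) = form (B *m ctrmx X + X *m B))//.
apply/funext => g; rewrite /dirD derive1E.
by have h := is_derive_form B X g; rewrite derive_val.
Qed.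

End Form.

(** The Killing vector field of V_1 generated by [A], which is the velocity of
    the left translations by exp(tA). These fields are explicit, and they extend
    every tangent vector. *)
Definition killing A g : M := projm (ctrmx g *m A *m g).

Lemma killing_vfield A : sp2 A -> vfield (killing A).
Proof.
move=> sA; split=> [i j|g _|g h Sg Hh]; last 2 first.
- exact: mspace_projm.
- have Sh := H_Sp2 Hh; rewrite (Sp2_invmx Sh).
  have sgA : sp2 (ctrmx g *m A *m g) by exact: sp2_Ad.
  rewrite -(projm_Ad_H Hh sgA); congr projm.
  by rewrite ctrmxM !mulmxA.
have e (f : R[i] -> R) g : (forall x y, f (x + y) = f x + f y) -> f 0 = 0 ->
    (forall (r : R) x, f (r%:C%C * x) = r * f x) ->
    f (killing A g i j) = Re (\tr ((\sum_(k < 7) (- 5^-1 * f (Q R k i j))%:C%C *: Q R k)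
      *m (ctrmx g *m A *m g))).
  move=> fD f0 fZ; rewrite /killing /projm summxE (big_morph f fD f0).
  have tr_inner (B C : M) : Re (\tr (B *m C)) = - 5 * inner B C by rewrite /inner; field.
  rewrite tr_inner inner_suml mulr_sumr; apply: eq_bigr => k _.
  by rewrite mxE fZ innerZl [inner (Q _ _) _]innerC; field.
have hRe (r : R) x : Re (r%:C%C * x) = r * Re x by rewrite Re_mul/= mul0r subr0.
have hIm (r : R) x : Im (r%:C%C * x) = r * Im x by rewrite Im_mul/= mul0r addr0.
split.
  rewrite (funext (fun g => e Re g (@Re_add R) erefl hRe)); exact: form_smooth.
rewrite (funext (fun g => e Im g (@Im_add R) erefl hIm)); exact: form_smooth.
Qed.

Lemma killing_at g x : Sp2 g -> mspace x -> killing (g *m x *m ctrmx g) g = x.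
Proof.
move=> Sg mx; rewrite /killing !mulmxA Sp2_ctrmxl// mul1mx -mulmxA Sp2_ctrmxl// mulmx1.
exact: projm_id.
Qed.

Lemma is_mderive_Ad_exp A X g : sp2 X ->
  is_mderive (fun s : R => ctrmx (g *m expm (s%:C%C *: X)) *m A *m (g *m expm (s%:C%C *: X))) 0
    (lie (ctrmx g *m A *m g) X).
Proof.
move=> sX; have h := is_mderive_Ad_lie A sX (is_mderive_expm_l X g 0).
by apply: is_mderive_eq h _; rewrite expm0 mulmx1.
Qed.

End Killing.

(** * The Levi-Civita connection *)

Section Connection.
Variable R : realType.
Local Notation M := 'M[R[i]]_4.
Implicit Types A B C g h : M.
Local Notation Re := (@complex.Re R).
Local Notation Im := (@complex.Im R).

Lemma Sp2_mulexp g A (s : R) : Sp2 g -> sp2 A -> Sp2 (g *m expm (s%:C%C *: A)).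
Proof. by move=> Sg sA; apply: Sp2M => //; exact: Sp2_expmZ. Qed.

Lemma mulexp0 g A : g *m expm ((0 : R)%:C%C *: A) = g.
Proof. by rewrite expm0 mulmx1. Qed.

Lemma vfield_is_mderive Y A g : vfield Y -> Sp2 g -> sp2 A ->
  is_mderive (fun s : R => Y (g *m expm (s%:C%C *: A))) 0 (dirDM A Y g).
Proof.
move=> [sY _ _] Sg sA; apply: is_mderive_dcurve => i j.
have [hr hi] := sY i j.
by have [_ /(_ A sA)[hr1 _]] := hr 1%N; have [_ /(_ A sA)[hi1 _]] := hi 1%N;
  split; [exact: hr1|exact: hi1].
Qed.

Lemma eq_dirDM Y Z A g : Sp2 g -> sp2 A -> (forall k, Sp2 k -> Y k = Z k) ->
  dirDM A Y g = dirDM A Z g.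
Proof.
move=> Sg sA YZ; rewrite /dirDM; congr (dcurve _ 0); apply/funext => s.
exact/YZ/Sp2_mulexp.
Qed.

Lemma dirDM_mspace Y A g : vfield Y -> Sp2 g -> sp2 A -> projm (dirDM A Y g) = dirDM A Y g.
Proof.
move=> vY Sg sA; rewrite -(dcurveE (is_mderive_projm (vfield_is_mderive vY Sg sA))).
rewrite /dirDM; congr (dcurve _ 0); apply/funext => s; apply: projm_id.
by have [_ mY _] := vY; apply: mY; exact: Sp2_mulexp.
Qed.

Lemma dirDM_lift Y A g : vfield Y -> Sp2 g -> sp2 A ->
  dirDM A (Defs.lift Y) g = g *m (A *m Y g + dirDM A Y g).
Proof.
move=> vY Sg sA.
rewrite {1}/dirDM /Defs.lift (dcurveE (is_mderiveM (is_mderive_expm_l A g 0) (vfield_is_mderive vY Sg sA))).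
by rewrite mulexp0 mulmxDr mulmxA.
Qed.

Lemma vbracketE X Y g : vfield X -> vfield Y -> Sp2 g ->
  vbracket X Y g = projm (lie (X g) (Y g)) + dirDM (X g) Y g - dirDM (Y g) X g.
Proof.
move=> vX vY Sg; have [_ mX _] := vX; have [_ mY _] := vY.
have sX := mspace_sp2 (mX g Sg); have sY := mspace_sp2 (mY g Sg).
rewrite /vbracket !dirDM_lift// -mulmxBr Sp2_invmx// mulmxA Sp2_ctrmxl// mul1mx.
have -> : X g *m Y g + dirDM (X g) Y g - (Y g *m X g + dirDM (Y g) X g) =
    lie (X g) (Y g) + (dirDM (X g) Y g - dirDM (Y g) X g).
  by rewrite lieE opprD addrACA.
by rewrite projmD projmB !dirDM_mspace// addrA.
Qed.

Lemma killing_is_mderive A X g : sp2 X ->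
  is_mderive (fun s : R => killing A (g *m expm (s%:C%C *: X))) 0
    (projm (lie (ctrmx g *m A *m g) X)).
Proof. by move=> sX; exact/is_mderive_projm/is_mderive_Ad_exp. Qed.

Lemma dirDM_killing A X g : sp2 X ->
  dirDM X (killing A) g = projm (lie (ctrmx g *m A *m g) X).
Proof. by move=> sX; apply: dcurveE; exact: killing_is_mderive. Qed.

(** Smoothness only involves values on Sp(2), because the integral curves
    g exp(sA) of left-invariant fields stay there. *)
Lemma CkSp2_ext k (f f' : M -> R) : (forall g, Sp2 g -> f g = f' g) ->
  CkSp2 k f -> CkSp2 k f'.
Proof.
have cont (f1 f2 : M -> R) : (forall g, Sp2 g -> f1 g = f2 g) ->
    {within (@Sp2 R : set 'M[R[i]^o]_4), continuous (f1 : 'M[R[i]^o]_4 -> R)} ->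
    {within (@Sp2 R : set 'M[R[i]^o]_4), continuous (f2 : 'M[R[i]^o]_4 -> R)}.
  move=> e; apply: subspace_eq_continuous => g; rewrite inE; exact: e.
elim: k f f' => [|k ih] f f' e /=; first by move=> [c _]; split=> //; exact: cont c.
move=> [c d]; split; first exact: cont c.
move=> A sA; have [d1 d2] := d A sA.
have ee g s : Sp2 g -> f (g *m expm (s%:C%C *: A)) = f' (g *m expm (s%:C%C *: A)).
  by move=> Sg; apply: e; exact: Sp2_mulexp.
split=> [g Sg|].
  by rewrite -(funext (fun s => ee g s Sg)); exact: d1.
apply: ih d2 => g Sg; rewrite /dirD; congr (derive1 _ 0); apply/funext => s.
exact: ee.
Qed.

Lemma vfield_ext Y Z : (forall g, Sp2 g -> Y g = Z g) -> vfield Y -> vfield Z.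
Proof.
move=> YZ [sY mY eY]; split=> [i j|g Sg|g h Sg Hh].
- have [h1 h2] := sY i j; split => k.
    by apply: CkSp2_ext (h1 k) => g Sg; rewrite YZ.
  by apply: CkSp2_ext (h2 k) => g Sg; rewrite YZ.
- by rewrite -YZ//; exact: mY.
- by rewrite -!YZ ?eY//; apply: Sp2M => //; exact: H_Sp2.
Qed.

Lemma inner_lie_swap A B C : inner (lie A B) C = - inner (lie A C) B.
Proof. by rewrite !inner_lie (lieC C) innerNr opprK. Qed.

Lemma projm_lie_swap A B C : mspace B -> mspace C ->
  inner (projm (lie A C)) B = - inner (projm (lie A B)) C.
Proof.
move=> mB mC; apply: etrans (inner_projm _ mB) _.
by apply: etrans (inner_lie_swap _ _ _) _; congr (- _); apply/esym/inner_projm.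
Qed.

Section LeviCivita.
Variable nabla : (M -> M) -> (M -> M) -> M -> M.
Hypothesis LC : levi_civita nabla.

Lemma half_sym (a a' b c l : M) : a' - a = l + b - c ->
  a' - (b + (1 / 2 : R)%:C%C *: l) = a - (c + (1 / 2 : R)%:C%C *: (- l)).
Proof.
move=> e; have -> : a' = l + b - c + a by rewrite -e subrK.
have -> : (1 / 2 : R)%:C%C = 1 / 2 :> R[i] by rewrite fmorph_div/= rmorph1 rmorph_nat.
by apply/matrixP => i j; rewrite !mxE; field.
Qed.

Lemma half_skew (nv nw dv dw lv lw v w : M) :
  inner dv w + inner v dw = inner nv w + inner v nw ->
  inner lw v = - inner lv w ->
  inner (nv - (dv + (1 / 2 : R)%:C%C *: lv)) w =
  - inner (nw - (dw + (1 / 2 : R)%:C%C *: lw)) v.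
Proof.
move=> e1 e2; rewrite !innerBl !innerDl !innerZl e2 [inner nw v]innerC [inner dw v]innerC.
lra.
Qed.

(** The symmetries behind the uniqueness of the Levi-Civita connection: a
    tensor symmetric in its first two arguments and skew in the last two is
    zero, as six exchanges bring it back to its opposite. *)
Lemma sym_skew_eq0 (I : Type) (P : I -> Prop) (T : I -> I -> I -> R) :
  (forall x y z, P x -> P y -> P z -> T x y z = T y x z) ->
  (forall x y z, P x -> P y -> P z -> T x y z = - T x z y) ->
  forall x y z, P x -> P y -> P z -> T x y z = 0.
Proof.
move=> sym skew x y z Px Py Pz.
have e : T x y z = - T x y z.
  by rewrite {1}sym// skew// sym// skew// sym// skew// opprK sym// -skew// sym// skew// opprK.
lra.
Qed.

(** The right-hand side is metric and torsion free, since the bracket on m is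
    skew for the invariant inner product. So its difference with nabla, paired
    with a third field, has the symmetries of [sym_skew_eq0]; Killing fields
    take all tangent values at [g], hence this difference is zero. *)
Lemma nabla_lie X Y g : vfield X -> vfield Y -> Sp2 g ->
  nabla X Y g = dirDM (X g) Y g + (1 / 2 : R)%:C%C *: projm (lie (X g) (Y g)).
Proof.
move=> vX vY Sg.
pose S X Y : M := nabla X Y g -
  (dirDM (X g) Y g + (1 / 2 : R)%:C%C *: projm (lie (X g) (Y g))).
have mV V : vfield V -> mspace (V g) by move=> [_ mV _]; exact: mV.
have sV V : vfield V -> sp2 (V g) by move=> vV; exact/mspace_sp2/mV.
have mS V W : vfield V -> vfield W -> mspace (S V W).
  move=> vV vW; apply: mspaceB; first exact/mV/(lc_vfield LC).
  apply: mspaceD; last exact/mspaceZ/mspace_projm.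
  by rewrite -dirDM_mspace//; [exact: mspace_projm|exact: sV].
have Ssym V W : vfield V -> vfield W -> S V W = S W V.
  move=> vV vW; rewrite /S (lieC (W g)) projmN; apply: half_sym.
  by rewrite (lc_torsion_free LC vV vW Sg) vbracketE.
have Sskew U V W : vfield U -> vfield V -> vfield W ->
    inner (S U V) (W g) = - inner (S U W) (V g).
  move=> vU vV vW; have := lc_metric LC vU vV vW Sg.
  rewrite /dirD derive1E.
  have h := is_derive_inner (vfield_is_mderive vV Sg (sV U vU)) (vfield_is_mderive vW Sg (sV U vU)).
  rewrite derive_val !mulexp0 => e.
  exact: (half_skew e (projm_lie_swap (U g) (mV _ vV) (mV _ vW))).
have S0 U V W : vfield U -> vfield V -> vfield W -> inner (S U V) (W g) = 0.
  apply: (sym_skew_eq0 (P := @vfield R) (T := fun U V W => inner (S U V) (W g)) _ Sskew).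
  by move=> {}U {}V {}W vU vV _; rewrite Ssym.
have := S0 X Y (killing (g *m S X Y *m ctrmx g)) vX vY.
rewrite killing_at//; last exact: mS.
move=> /(_ _)/(sp2_inner_eq0 (mspace_sp2 (mS X Y vX vY))) e.
apply/eqP; rewrite -subr_eq0 -/(S X Y); apply/eqP/e.
by apply/killing_vfield/sp2_Ad'/mspace_sp2/mS.
Qed.

End LeviCivita.
End Connection.

(** * Curvature *)

Section Curvature.
Variable R : realType.
Local Notation M := 'M[R[i]]_4.
Implicit Types A B C g h : M.
Local Notation half := ((1 / 2 : R)%:C%C).

Lemma projm_lie_hh A B : hspace A -> hspace B -> projm (lie A B) = 0.
Proof.
move=> hA hB; rewrite /projm big1// => k _.
by rewrite (inner_hh_m hA hB (mspace_Q _ (ltn_ord k))) scale0r.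
Qed.

Definition Ad g A : M := ctrmx g *m A *m g.

Lemma Ad_lie g A B : Sp2 g -> Ad g (lie A B) = lie (Ad g A) (Ad g B).
Proof.
move=> Sg; rewrite /Ad !lieE mulmxBr mulmxBl !mulmxA.
have e C : C *m g *m ctrmx g = C by rewrite -mulmxA Sp2_ctrmxr// mulmx1.
by rewrite !e.
Qed.

(** The bracket of two Killing fields is again a Killing field, so it is smooth
    and nabla can be evaluated on it. *)
Lemma killing_bracket A B g : Sp2 g -> sp2 A -> sp2 B ->
  vbracket (killing A) (killing B) g = killing (lie B A) g.
Proof.
move=> Sg sA sB.
have mk C : mspace (killing C g) by exact: mspace_projm.
transitivity (projm (lie (projm (Ad g A)) (projm (Ad g B))) +
  projm (lie (Ad g B) (projm (Ad g A))) - projm (lie (Ad g A) (projm (Ad g B)))).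
  rewrite vbracketE//; [|exact: killing_vfield..].
  by congr (_ + _ - _); apply: dirDM_killing; exact/mspace_sp2/mk.
rewrite /killing -[ctrmx g *m lie B A *m g]/(Ad g (lie B A)) Ad_lie//.
have sa : sp2 (Ad g A) by exact: sp2_Ad.
have sb : sp2 (Ad g B) by exact: sp2_Ad.
move: (Ad g A) (Ad g B) sa sb => a b sa sb.
have e : projm (lie (b - projm b) (a - projm a)) = 0.
  by apply: projm_lie_hh; exact: hspace_sub.
move: e; rewrite lieBl !lieBr !projmB (lieC (projm b) (projm a)) (lieC (projm b) a) !projmN.
move: (projm (lie b a)) (projm (lie b (projm a))) (projm (lie a (projm b)))
  (projm (lie (projm a) (projm b))) => p q r s.
rewrite opprK => /eqP; rewrite subr_eq0 subr_eq => /eqP->.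
by rewrite [LHS]addrC addrA.
Qed.

(** Values of nabla_X Y, and of its derivative in the direction [w], for the
    Killing fields X and Y of matrices [a] and [b] in the moving frame. *)
Definition nab (a b : M) : M :=
  projm (lie b (projm a)) + half *: projm (lie (projm a) (projm b)).

Definition dnab (a b w : M) : M :=
  projm (lie (lie b w) (projm a)) + projm (lie b (projm (lie a w))) +
  half *: (projm (lie (projm (lie a w)) (projm b)) +
           projm (lie (projm a) (projm (lie b w)))).

Lemma scale_half (C : M) : half *: C + half *: C = C.
Proof.
by rewrite -scalerDl -rmorphD/= (_ : 1/2 + 1/2 = 1 :> R) ?scale1r//; field.
Qed.

Lemma subr_half (C : M) : - C + half *: C = - (half *: C).
Proof. by rewrite -{1}[C]scale_half opprD -addrA addNr addr0. Qed.

Lemma projm0 : projm (0 : M) = 0.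
Proof. by have := projmB (0 : M) 0; rewrite !subrr. Qed.

Lemma nab_diag v : mspace v -> nab v v = 0.
Proof. by move=> /projm_id e; rewrite /nab e liexx projm0 scaler0 addr0. Qed.

Lemma nab_m x v : mspace x -> mspace v -> nab x v = - (half *: projm (lie x v)).
Proof.
move=> /projm_id ex /projm_id ev; rewrite /nab ex ev (lieC v x) projmN.
exact: subr_half.
Qed.

Lemma dnab_vv v x : mspace v -> dnab v v x =
  projm (lie v (lie x v)) - projm (lie v (projm (lie x v))).
Proof.
move=> /projm_id ev; rewrite /dnab ev (lieC (projm (lie v x)) v) projmN addNr scaler0 addr0.
by rewrite (lieC (lie v x) v) (lieC v x) !projmN !lieNr !projmN opprK.
Qed.

Lemma dnab_xv v x : mspace x -> mspace v -> dnab x v v =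
  half *: projm (lie v (projm (lie x v))).
Proof.
move=> /projm_id ex /projm_id ev; rewrite /dnab ex ev liexx lie0l projm0 add0r.
rewrite lie0r projm0 addr0 (lieC (projm _) v) projmN scalerN.
set P := projm _; by rewrite -[X in X - _](scale_half P) addrK.
Qed.

Section LeviCivita.
Variable nabla : (M -> M) -> (M -> M) -> M -> M.
Hypothesis LC : levi_civita nabla.

Let nabla_killing A B g : sp2 A -> sp2 B -> Sp2 g ->
  nabla (killing A) (killing B) g = nab (Ad g A) (Ad g B).
Proof.
move=> sA sB Sg.
rewrite (nabla_lie LC (killing_vfield sA) (killing_vfield sB) Sg).
by congr (_ + _); apply: dirDM_killing; exact/mspace_sp2/mspace_projm.
Qed.

Let dirDM_nabla_killing A B X g : sp2 A -> sp2 B -> Sp2 g -> sp2 X ->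
  dirDM X (nabla (killing A) (killing B)) g = dnab (Ad g A) (Ad g B) X.
Proof.
move=> sA sB Sg sX.
rewrite (@eq_dirDM _ _ (fun g => nab (Ad g A) (Ad g B)) _ _ Sg sX); last first.
  by move=> k Sk; exact: nabla_killing.
apply: dcurveE.
have da := is_mderive_Ad_exp A g sX; have db := is_mderive_Ad_exp B g sX.
have d1 := is_mderive_projm (is_mderive_lie db (is_mderive_projm da)).
have d2 := is_mderiveZc half (is_mderive_projm (is_mderive_lie (is_mderive_projm da) (is_mderive_projm db))).
apply: is_mderive_eq (is_mderiveD d1 d2) _; rewrite mulexp0.
by congr (_ + _ *: _); exact: projmD.
Qed.

(** The Killing fields X and V are those whose matrices in the moving frame are
    x and v at the point g. Then nabla_V V vanishes at g, and the three terms of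
    the curvature are combinations of iterated brackets. *)
Lemma curvature_killing g x v : Sp2 g -> mspace x -> mspace v ->
  let X := killing (g *m x *m ctrmx g) in let V := killing (g *m v *m ctrmx g) in
  curvature nabla X V V g =
    projm (lie v (lie x v)) - (3 / 4 : R)%:C%C *: projm (lie v (projm (lie x v))).
Proof.
move=> Sg mx mv.
set A := g *m x *m ctrmx g; set B := g *m v *m ctrmx g => X V.
have sx := mspace_sp2 mx; have sv := mspace_sp2 mv.
have sA : sp2 A by exact: sp2_Ad'.
have sB : sp2 B by exact: sp2_Ad'.
have vX : vfield X by exact: killing_vfield.
have vV : vfield V by exact: killing_vfield.
have aA : Ad g A = x.
  by rewrite /Ad /A !mulmxA Sp2_ctrmxl// mul1mx -mulmxA Sp2_ctrmxl// mulmx1.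
have aB : Ad g B = v.
  by rewrite /Ad /B !mulmxA Sp2_ctrmxl// mul1mx -mulmxA Sp2_ctrmxl// mulmx1.
have Xg : X g = x by exact: killing_at.
have Vg : V g = v by exact: killing_at.
have pv := projm_id mv; have px := projm_id mx.
set P := projm (lie v (projm (lie x v))).
have eVV : nabla X (nabla V V) g = projm (lie v (lie x v)) - P.
  rewrite (nabla_lie LC vX (lc_vfield LC vV vV) Sg) Xg.
  rewrite (dirDM_nabla_killing sB sB Sg sx) (nabla_killing sB sB Sg) aB.
  by rewrite nab_diag// lie0r projm0 scaler0 addr0 dnab_vv.
have eXV : nabla V (nabla X V) g = half *: P - half *: (half *: P).
  rewrite (nabla_lie LC vV (lc_vfield LC vX vV) Sg) Vg.
  rewrite (dirDM_nabla_killing sA sB Sg sv) (nabla_killing sA sB Sg) aA aB.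
  by rewrite nab_m// dnab_xv// lieNr lieZr projmN projmZ scalerN.
have eT : nabla (vbracket X V) V g = - (half *: P).
  have vT : vfield (vbracket X V).
    apply: (@vfield_ext _ (killing (lie B A))).
      by move=> k Sk; rewrite killing_bracket.
    by apply/killing_vfield/sp2_lie.
  have Tg : vbracket X V g = - projm (lie x v).
    rewrite killing_bracket// /killing -[ctrmx g *m lie B A *m g]/(Ad g (lie B A)).
    by rewrite Ad_lie// aA aB lieC projmN.
  rewrite (nabla_lie LC vT vV Sg) Vg Tg.
  rewrite (dirDM_killing B g (sp2N (mspace_sp2 (mspace_projm _)))).
  rewrite -[ctrmx g *m B *m g]/(Ad g B) aB lieNr projmN lieNl -lieC -/P.
  exact: subr_half.
transitivity (projm (lie v (lie x v)) - P - (half *: P - half *: (half *: P)) + half *: P).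
  rewrite /curvature -[X in _ = _ + X]opprK.
  by congr (_ - _ - _); [exact: eVV|exact: eXV|exact: eT].
clearbody P; move: (projm _) => N.
have -> : (3 / 4 : R)%:C%C = 3 / 4 :> R[i] by rewrite fmorph_div/= !rmorph_nat.
have -> : half = 1 / 2 :> R[i] by rewrite fmorph_div/= rmorph1 rmorph_nat.
by apply/matrixP => i j; rewrite !mxE; field.
Qed.

End LeviCivita.
End Curvature.

(** * Covariant differentiation along a curve *)

Section Smooth.
Variable R : realType.
Local Notation M := 'M[R[i]]_4.
Local Notation Re := (@complex.Re R).
Local Notation Im := (@complex.Im R).
Local Notation half := ((1 / 2 : R)%:C%C).

(** [smooth_real] takes further derivatives at the end; taking them first makes
    the product rule an induction. *)
Fixpoint Ck (k : nat) (f : R -> R) : Prop :=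
  if k is k'.+1 then (forall t, derivable f t 1) /\ Ck k' (derive1 f) else True.

Lemma smooth_realP f : smooth_real f <-> forall k, Ck k f.
Proof.
split=> [sf k|Cf].
  elim: k f sf => //= k ih f sf; split=> [t|]; first exact: (sf 0%N).
  by apply: ih => n t; have := sf n.+1 t; rewrite derive1Sn.
move=> n; elim: n f Cf => [|n ih] f Cf t; first by have [] := Cf 1%N.
by rewrite derive1Sn; apply: ih => k; have [] := Cf k.+1.
Qed.

Lemma CkS k f : Ck k.+1 f -> Ck k f.
Proof. by elim: k f => //= k ih f [d /ih]. Qed.

Lemma derive1_is_derive (f df : R -> R) :
  (forall t, is_derive t (1 : R) f (df t)) -> derive1 f = df.
Proof. by move=> h; apply/funext => t; rewrite derive1E; have ht := h t; rewrite derive_val. Qed.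

Lemma CkD k f g : Ck k f -> Ck k g -> Ck k (fun t => f t + g t).
Proof.
elim: k f g => //= k ih f g [df cf] [dg cg].
have h t : is_derive t (1 : R) (fun t => f t + g t) (derive1 f t + derive1 g t).
  by apply: is_deriveD; exact: is_derive_derivable.
by split=> [t|]; [have [] := h t|rewrite (derive1_is_derive h); exact: ih].
Qed.

Lemma CkM k f g : Ck k f -> Ck k g -> Ck k (fun t => f t * g t).
Proof.
elim: k f g => //= k ih f g [df cf] [dg cg].
have h t : is_derive t (1 : R) (fun t => f t * g t) (derive1 f t * g t + f t * derive1 g t).
  by apply: is_derive_mul; exact: is_derive_derivable.
split=> [t|]; first by have [] := h t.
by rewrite (derive1_is_derive h); apply: CkD; apply: ih => //; exact: CkS.
Qed.

Lemma Ck_cst k (a : R) : Ck k (fun _ : R => a).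
Proof.
elim: k a => //= k ih a; have h t : is_derive t (1 : R) (fun _ : R => a) 0 by exact: is_derive_cst.
by split=> [t|]; [have [] := h t|rewrite (derive1_is_derive h)].
Qed.

Lemma smoothD (f g : R -> R) : smooth_real f -> smooth_real g -> smooth_real (fun t => f t + g t).
Proof. by move=> /smooth_realP sf /smooth_realP sg; apply/smooth_realP => k; exact: CkD. Qed.
Lemma smoothM (f g : R -> R) : smooth_real f -> smooth_real g -> smooth_real (fun t => f t * g t).
Proof. by move=> /smooth_realP sf /smooth_realP sg; apply/smooth_realP => k; exact: CkM. Qed.
Lemma smooth_cst (a : R) : smooth_real (fun _ : R => a).
Proof. by apply/smooth_realP => k; exact: Ck_cst. Qed.
Lemma smooth_derive1 (f : R -> R) : smooth_real f -> smooth_real (derive1 f).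
Proof. by move=> sf n t; rewrite -derive1Sn; exact: (sf n.+1). Qed.

Definition smooth_complex (f : R -> R[i]) :=
  smooth_real (fun t => Re (f t)) /\ smooth_real (fun t => Im (f t)).

Lemma eq_smooth_complex f g : f =1 g -> smooth_complex f -> smooth_complex g.
Proof. by move=> /funext->. Qed.

Lemma smooth_complex_cst z : smooth_complex (fun _ : R => z).
Proof. by split; exact: smooth_cst. Qed.

Lemma smooth_complexD (f g : R -> R[i]) : smooth_complex f -> smooth_complex g -> smooth_complex (fun t => f t + g t).
Proof.
move=> [f1 f2] [g1 g2]; split.
  by rewrite (funext (fun t => Re_add (f t) (g t))); exact: smoothD.
by rewrite (funext (fun t => Im_add (f t) (g t))); exact: smoothD.
Qed.

Lemma smooth_complexM (f g : R -> R[i]) : smooth_complex f -> smooth_complex g -> smooth_complex (fun t => f t * g t).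
Proof.
move=> [f1 f2] [g1 g2]; split.
  have -> : (fun t => Re (f t * g t)) =
     fun t => Re (f t) * Re (g t) + (- 1) * (Im (f t) * Im (g t)).
    by apply/funext => t; rewrite Re_mul mulN1r.
  by apply: smoothD; [|apply: smoothM; first exact: smooth_cst]; exact: smoothM.
by rewrite (funext (fun t => Im_mul (f t) (g t))); apply: smoothD; exact: smoothM.
Qed.

Lemma smooth_complex_conj (f : R -> R[i]) : smooth_complex f -> smooth_complex (fun t => (f t)^*%C).
Proof.
move=> [f1 f2]; split; first by rewrite (funext (fun t => Re_conj (f t))).
have -> : (fun t => Im (f t)^*%C) = fun t => (- 1) * Im (f t).
  by apply/funext => t; rewrite Im_conj mulN1r.
by apply: smoothM; [exact: smooth_cst|exact: f2].
Qed.

Lemma smooth_complex_sum (I : Type) (r : seq I) (f : I -> R -> R[i]) :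
  (forall k, smooth_complex (f k)) -> smooth_complex (fun t => \sum_(k <- r) f k t).
Proof.
move=> h; elim: r => [|k r ih].
  by apply: eq_smooth_complex (smooth_complex_cst 0) => t; rewrite big_nil.
by apply: eq_smooth_complex (smooth_complexD (h k) ih) => t; rewrite big_cons.
Qed.

Lemma smooth_curveE (c : R -> M) :
  smooth_curve c <-> forall i j, smooth_complex (fun t => c t i j).
Proof. by split=> h i j; have := h i j. Qed.

Lemma smooth_curve_cst (A : M) : smooth_curve (fun _ : R => A).
Proof. by apply/smooth_curveE => i j; exact: smooth_complex_cst. Qed.

Lemma smooth_curveD (c d : R -> M) : smooth_curve c -> smooth_curve d ->
  smooth_curve (fun t => c t + d t : M).
Proof.
move=> sc sd; apply/smooth_curveE => i j.
by apply: eq_smooth_complex (smooth_complexD (sc i j) (sd i j)) => t; rewrite mxE.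
Qed.

Lemma smooth_curve_sum (I : Type) (r : seq I) (f : I -> R -> M) :
  (forall k, smooth_curve (f k)) -> smooth_curve (fun t => \sum_(k <- r) f k t).
Proof.
move=> h; apply/smooth_curveE => i j.
by apply: eq_smooth_complex (smooth_complex_sum r (fun k => h k i j)) => t; rewrite summxE.
Qed.

Lemma smooth_curveM (c d : R -> M) : smooth_curve c -> smooth_curve d ->
  smooth_curve (fun t => c t *m d t : M).
Proof.
move=> sc sd; apply/smooth_curveE => i j.
apply: eq_smooth_complex (smooth_complex_sum (index_enum 'I_4) (fun k => smooth_complexM (sc i k) (sd k j))) => t.
by rewrite mxE.
Qed.

Lemma smooth_curve_ctrmx (c : R -> M) : smooth_curve c -> smooth_curve (fun t => ctrmx (c t) : M).
Proof.
move=> sc; apply/smooth_curveE => i j.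
by apply: eq_smooth_complex (smooth_complex_conj (sc j i)) => t; rewrite !mxE.
Qed.

Lemma smooth_curveZ (f : R -> R) (c : R -> M) : smooth_real f -> smooth_curve c ->
  smooth_curve (fun t => (f t)%:C%C *: c t : M).
Proof.
move=> sf sc; apply/smooth_curveE => i j.
have cf : smooth_complex (fun t => (f t)%:C%C) by split; [exact: sf|exact: smooth_cst].
by apply: eq_smooth_complex (smooth_complexM cf (sc i j)) => t; rewrite mxE.
Qed.

Lemma smooth_inner (c d : R -> M) : smooth_curve c -> smooth_curve d ->
  smooth_real (fun t => inner (c t) (d t)).
Proof.
move=> sc sd.
have [h _] := smooth_complex_sum (index_enum 'I_4) (fun k => smooth_curveM sc sd k k).
rewrite /inner (_ : (fun t => _) = fun t => - 5^-1 * Re (\tr (c t *m d t))).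
  by apply: smoothM; [exact: smooth_cst|exact: h].
by apply/funext => t; rewrite mulNr.
Qed.

Lemma smooth_curve_projm (c : R -> M) : smooth_curve c -> smooth_curve (fun t => projm (c t)).
Proof.
move=> sc; apply: smooth_curve_sum => k; apply: smooth_curveZ.
  by apply: smooth_inner; [exact: sc|exact: smooth_curve_cst].
exact: smooth_curve_cst.
Qed.

Lemma smooth_dcurve (c : R -> M) : smooth_curve c -> smooth_curve (dcurve c : R -> M).
Proof.
move=> sc i j; have [h1 h2] := sc i j; split.
  rewrite (_ : (fun t => _) = derive1 (fun s => Re (c s i j))); first exact: smooth_derive1.
  by apply/funext => t; rewrite mxE.
rewrite (_ : (fun t => _) = derive1 (fun s => Im (c s i j))); first exact: smooth_derive1.
by apply/funext => t; rewrite mxE.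
Qed.

End Smooth.

Lemma linear_sum (R : realType) n (L : 'M[R[i]]_4 -> 'M[R[i]]_4) :
  (forall A B, L (A + B) = L A + L B) ->
  (forall (a : R) A, L (a%:C%C *: A) = a%:C%C *: L A) ->
  forall (a : 'I_n -> R) F,
    \sum_k (a k)%:C%C *: L (F k) = L (\sum_k (a k)%:C%C *: F k).
Proof.
move=> LD LZ a F; have L0 : L 0 = 0 by have := LZ 0 0; rewrite rmorph0 !scale0r.
by rewrite (big_morph L LD L0); apply: eq_bigr => k _; rewrite LZ.
Qed.

Section Along.
Variable R : realType.
Local Notation M := 'M[R[i]]_4.
Local Notation half := ((1 / 2 : R)%:C%C).
Variable c : R -> M.
Hypothesis sc : smooth_curve c.
Hypothesis Sc : forall t, Sp2 (c t).

(** The logarithmic derivative of [c], whose m-component is the velocity of the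
    projection of [c]. *)
Definition logder (t : R) : M := ctrmx (c t) *m dcurve c t.

Lemma dcurve_logder t : dcurve c t = c t *m logder t.
Proof. by rewrite /logder mulmxA Sp2_ctrmxr// mul1mx. Qed.

Lemma is_mderive_c t : is_mderive c t (c t *m logder t).
Proof. by rewrite -dcurve_logder; exact: is_mderive_smooth. Qed.

Lemma is_mderive_unique (f : R -> M) t d d' : is_mderive f t d -> is_mderive f t d' -> d = d'.
Proof. by move=> h h'; rewrite -(dcurveE h) -(dcurveE h'). Qed.

(** Differentiating the equations of Sp(2) along [c]. *)
Lemma sp2_logder t : sp2 (logder t).
Proof.
have h := is_mderive_c t; apply: cond_sp2.
  have h1 : is_mderive (fun s => ctrmx (c s) *m c s) t (ctrmx (logder t) + logder t).
    apply: is_mderive_eq (is_mderiveM (is_mderive_ctr h) h) _.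
    have e := Sp2_ctrmxl (Sc t).
    by rewrite ctrmxM -mulmxA e mulmx1 mulmxA e mul1mx.
  rewrite (funext (fun s => Sp2_ctrmxl (Sc s))) in h1.
  by have /eqP := is_mderive_unique h1 (is_mderive_cst _ t); rewrite addr_eq0 => /eqP.
have h1 : is_mderive (fun s => (c s)^T *m Jm R *m c s) t
    ((logder t)^T *m Jm R + Jm R *m logder t).
  apply: is_mderive_eq (is_mderiveM (is_mderiveM (is_mderive_tr h) (is_mderive_cst _ t)) h) _.
  have [_ e] := Sc t; rewrite mulmx0 addr0 mulmxA e; congr (_ + _).
  by rewrite trmx_mul -2!mulmxA (mulmxA (c t)^T) e.
rewrite (_ : (fun s => _) = fun=> Jm R) in h1.
  exact: is_mderive_unique h1 (is_mderive_cst _ t).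
by apply/funext => s; have [] := Sc s.
Qed.

Lemma velocityE t : velocity c t = projm (logder t).
Proof. by rewrite /velocity Sp2_invmx. Qed.

Lemma mspace_velocity t : mspace (velocity c t).
Proof. exact: mspace_projm. Qed.

Lemma field_along_velocity : field_along (velocity c).
Proof.
split; last exact: mspace_velocity.
rewrite (funext velocityE); apply: smooth_curve_projm.
by apply: smooth_curveM; [exact: smooth_curve_ctrmx|exact: smooth_dcurve].
Qed.

Lemma field_along_killing A : sp2 A -> field_along (fun t => killing A (c t)).
Proof.
move=> sA; split=> [|t]; last exact: mspace_projm.
apply: smooth_curve_projm; apply: smooth_curveM => //.
by apply: smooth_curveM; [exact: smooth_curve_ctrmx|exact: smooth_curve_cst].
Qed.

Lemma field_alongZ f y : smooth_real f -> field_along y ->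
  field_along (fun t => (f t)%:C%C *: y t : M).
Proof.
by move=> sf [sy my]; split=> [|t]; [exact: smooth_curveZ|exact: mspaceZ].
Qed.

Variables (nabla : (M -> M) -> (M -> M) -> M -> M) (D : (R -> M) -> R -> M).
Hypothesis LC : levi_civita nabla.
Hypothesis cdD : covariant_derivative nabla c D.

Lemma D_sum (I : Type) (r : seq I) (y : I -> R -> M) t :
  (forall k, field_along (y k)) ->
  D (fun t => \sum_(k <- r) y k t) t = \sum_(k <- r) D (y k) t.
Proof.
move=> fy; suff [] : field_along (fun t => \sum_(k <- r) y k t) /\
  D (fun t => \sum_(k <- r) y k t) t = \sum_(k <- r) D (y k) t by [].
elim: r => [|k r [ih1 ih2]].
  have -> : (fun t : R => \sum_(k <- [::]) y k t) = fun=> 0 :> M.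
    by apply/funext => s; rewrite big_nil.
  have f0 : field_along (fun=> 0 : M).
    split=> [|s]; first exact: smooth_curve_cst.
    by rewrite -projm0; exact: mspace_projm.
  split=> //; rewrite big_nil.
  have := cd_add cdD t f0 f0; rewrite (_ : (fun _ : R => 0 + 0 : M) = fun=> 0).
    by move=> /eqP; rewrite -subr_eq0 opprD addNKr oppr_eq0 => /eqP.
  by apply/funext => s; rewrite addr0.
have -> : (fun t : R => \sum_(k <- k :: r) y k t) = fun t => y k t + \sum_(k <- r) y k t.
  by apply/funext => s; rewrite big_cons.
split; last by rewrite (cd_add cdD t (fy k) ih1) ih2 big_cons.
have [s1 m1] := fy k; have [s2 m2] := ih1.
by split=> [|s]; [exact: smooth_curveD|exact: mspaceD].
Qed.

Lemma D_killing A t : sp2 A -> D (fun t => killing A (c t)) t =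
  projm (lie (Ad (c t) A) (velocity c t)) +
  half *: projm (lie (velocity c t) (projm (Ad (c t) A))).
Proof.
move=> sA; set v := velocity c t.
have mv : mspace v by exact: mspace_velocity.
set V := killing (c t *m v *m ctrmx (c t)).
have vV : vfield V by apply/killing_vfield/sp2_Ad'/mspace_sp2.
have Vc : V (c t) = v by exact: killing_at.
rewrite (cd_restrict cdD vV (killing_vfield sA) Vc).
rewrite (nabla_lie LC vV (killing_vfield sA) (Sc t)) Vc.
congr (_ + _); apply: dirDM_killing; exact: mspace_sp2.
Qed.

(** A field along [c] is a combination of the ten Killing fields of the Q_k,
    whose coefficients are smooth functions of time. So D is determined by the
    Leibniz rule and by the values of nabla on Killing fields. *)
Lemma D_along y t : field_along y ->
  D y t = dcurve y t + projm (lie (logder t) (y t))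
          - half *: projm (lie (velocity c t) (y t)).
Proof.
move=> fy; have [sy my] := fy.
(* the Killing field of [Y s] has the value [y s] at the point [c s] *)
pose Y s := c s *m y s *m ctrmx (c s).
have spY s : sp2 (Y s) by apply/sp2_Ad'/mspace_sp2.
pose f (k : 'I_10) s := inner (Y s) (Q R k).
have sY : smooth_curve Y.
  by apply: smooth_curveM; [exact: smooth_curveM|exact: smooth_curve_ctrmx].
have sf k : smooth_real (f k).
  by apply: smooth_inner; [exact: sY|exact: smooth_curve_cst].
have sQ (k : 'I_10) : sp2 (Q R k) by exact: sp2_Q.
have AdY s : Ad (c s) (Y s) = y s.
  by rewrite /Ad /Y !mulmxA Sp2_ctrmxl// mul1mx -mulmxA Sp2_ctrmxl// mulmx1.
have AdS (a : 'I_10 -> R) s : \sum_(k < 10) (a k)%:C%C *: Ad (c s) (Q R k) =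
    Ad (c s) (\sum_(k < 10) (a k)%:C%C *: Q R k).
  rewrite /Ad mulmx_sumr mulmx_suml; apply: eq_bigr => k _.
  by rewrite -scalemxAr -scalemxAl.
have yE : y = fun s => \sum_(k < 10) (f k s)%:C%C *: killing (Q R k) (c s).
  apply/funext => s; rewrite (linear_sum (@projmD R) (@projmZ R)) AdS -sp2_span//.
  by rewrite AdY projm_id.
rewrite {1}yE D_sum; last first.
  by move=> k; apply: field_alongZ; [exact: sf|exact: field_along_killing].
have fk k : field_along (fun s => killing (Q R (k : 'I_10)) (c s)) by exact: field_along_killing.
under eq_bigr do rewrite (cd_leibniz cdD _ (sf _) (fk _)) D_killing//.
rewrite big_split/= (linear_sum (@projmD R) (@projmZ R)) AdS.
set v := velocity c t; set w := logder t.
have dy : is_mderive y t (dcurve y t) by exact: is_mderive_smooth.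
have dY : is_mderive Y t (c t *m (lie w (y t) + dcurve y t) *m ctrmx (c t)).
  have dc := is_mderive_c t.
  apply: is_mderive_eq (is_mderiveM (is_mderiveM dc dy) (is_mderive_ctr dc)) _.
  rewrite -/w ctrmxM (ctrmx_sp2 (sp2_logder t)) -/w mulNmx mulmxN lieE mulmxDr mulmxBr !mulmxDl.
  by rewrite mulNmx !mulmxA addrAC.
have mdy : projm (dcurve y t) = dcurve y t.
  rewrite -(dcurveE (is_mderive_projm dy)); congr (dcurve _ t).
  by apply/funext => s; exact: projm_id.
have sdY : sp2 (dcurve Y t).
  rewrite (dcurveE dY); apply: sp2_Ad' => //; apply: sp2D.
    by apply: sp2_lie; [exact: sp2_logder|exact: mspace_sp2].
  by rewrite -mdy; exact/mspace_sp2/mspace_projm.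
have -> : \sum_(k < 10) (derive1 (f k) t)%:C%C *: Q R k = dcurve Y t.
  rewrite [RHS]sp2_span//; apply: eq_bigr => k _; congr (_%:C%C *: _).
  rewrite derive1E.
  have h := is_derive_inner (is_mderive_smooth t sY) (is_mderive_cst (Q R k) t).
  by rewrite derive_val inner0r addr0.
have -> : Ad (c t) (dcurve Y t) = lie w (y t) + dcurve y t.
  by rewrite (dcurveE dY) /Ad !mulmxA Sp2_ctrmxl// mul1mx -mulmxA Sp2_ctrmxl// mulmx1.
rewrite projmD mdy.
pose L B := projm (lie B v) + half *: projm (lie v (projm B)).
have LD B C : L (B + C) = L B + L C.
  by rewrite /L lieDl !projmD lieDr projmD scalerDr addrACA.
have LZ (a : R) B : L (a%:C%C *: B) = a%:C%C *: L B.
  rewrite /L lieZl !projmZ lieZr projmZ scalerDr; congr (_ + _).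
  by rewrite !scalerA mulrC.
have Ly : L (y t) = - (half *: projm (lie v (y t))).
  by rewrite /L (projm_id (my t)) (lieC (y t) v) projmN subr_half.
rewrite (linear_sum LD LZ) AdS -(sp2_span (spY t)) AdY Ly.
by congr (_ - _); rewrite addrC.
Qed.

End Along.

(** * The Jacobi operator in a parallel frame *)

Section Frame.
Variable R : realType.
Local Notation M := 'M[R[i]]_4.
Local Notation half := ((1 / 2 : R)%:C%C).
Variable nabla : (M -> M) -> (M -> M) -> M -> M.
Hypothesis LC : levi_civita nabla.
Variable c : R -> M.
Hypothesis sc : smooth_curve c.
Hypothesis Sc : forall t, Sp2 (c t).
Variable D : (R -> M) -> R -> M.
Hypothesis cdD : covariant_derivative nabla c D.
Hypothesis geoD : geodesic c D.
Hypothesis unitc : unit_speed c.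
Variable e : 'I_7 -> R -> M.
Hypothesis pe : parallel_frame D e.
Variable Rt : R -> 'M[R]_7.
Hypothesis jR : jacobi_operator nabla c e Rt.

Local Notation v := (velocity c).

(** The h-component of the logarithmic derivative reflects the choice of the
    lift [c]; it acts on fields along [c] by an infinitesimal isometry. *)
Let u t : M := logder c t - v t.

Let mv t : mspace (v t). Proof. exact: mspace_velocity. Qed.
Let me k t : mspace (e k t). Proof. by have [[_ h] _ _] := pe k. Qed.

Let hu t : hspace (u t).
Proof. by rewrite /u velocityE//; apply/hspace_sub/sp2_logder. Qed.

Let projm_lie_u x t : mspace x -> projm (lie (u t) x) = lie (u t) x.
Proof. by move=> mx; apply: projm_id (mspace_lie_h (hu t) mx). Qed.

Let addr_half (a b C : M) : a + (- b - C) + half *: C = a - b - half *: C.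
Proof. by rewrite -!addrA subr_half. Qed.

Let D_u y t : field_along y ->
  D y t = dcurve y t - lie (y t) (u t) - half *: projm (lie (y t) (v t)).
Proof.
move=> fy; have my : mspace (y t) by have [_ h] := fy.
rewrite (D_along sc Sc LC cdD _ fy).
have -> : logder c t = u t + v t by rewrite subrK.
rewrite lieDl projmD (projm_lie_u t my) (lieC (u t) (y t)).
rewrite (lieC (v t) (y t)) projmN scalerN opprK; exact: addr_half.
Qed.

Let is_mderive_e k t : is_mderive (e k) t (lie (e k t) (u t) + half *: projm (lie (e k t) (v t))).
Proof.
have [fe De _] := pe k; have [se _] := fe.
apply: is_mderive_eq (is_mderive_smooth t se) _; have := De t; rewrite (D_u t fe).
by move=> /eqP; rewrite subr_eq0 subr_eq addrC => /eqP.
Qed.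

(** For a geodesic the bracket of the velocity with itself drops out, and only
    the rotation by [u] is left. *)
Let is_mderive_v t : is_mderive v t (lie (v t) (u t)).
Proof.
have fv : field_along v by exact: field_along_velocity.
have [sv _] := fv.
apply: is_mderive_eq (is_mderive_smooth t sv) _; have := geoD t; rewrite (D_u t fv).
by rewrite liexx projm0 scaler0 subr0 => /eqP; rewrite subr_eq0 => /eqP.
Qed.

Let inner_lie_skew (a b x : M) : inner (lie a x) b + inner a (lie b x) = 0.
Proof. by rewrite inner_lie (lieC b x) innerNr subrr. Qed.

Let inner_lie_skew_opp (a b x : M) : inner (lie a x) b = - inner a (lie b x).
Proof. by apply/eqP; rewrite -addr_eq0 inner_lie_skew. Qed.

Let projm_sym (a b : M) : inner a (projm b) = inner (projm a) b.
Proof.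
rewrite -(inner_projm a (mspace_projm b)) innerC.
by rewrite (inner_projm b (mspace_projm a)) innerC.
Qed.

Let is_derive0_cst (f : R -> R) : (forall t, is_derive t (1 : R) f 0) -> forall t, f t = f 0.
Proof. by move=> h t; apply: is_derive_0_is_cst. Qed.

Let inner_ev_v x t : inner (lie x (v t)) (v t) = 0.
Proof. by rewrite inner_lie liexx inner0r. Qed.

Let orthonormal_e k l t : inner (e k t) (e l t) = (k == l)%:R.
Proof.
transitivity (inner (e k 0) (e l 0)); last first.
  have [_ _ ->] := pe k; have [_ _ ->] := pe l.
  by rewrite inner_QQ// ord7_lt10.
apply: (@is_derive0_cst (fun t => inner (e k t) (e l t))) => {}t.
apply: is_derive_eq (is_derive_inner (is_mderive_e k t) (is_mderive_e l t)) _.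
rewrite innerDl innerDr innerZl innerZr.
rewrite (inner_projm (lie (e k t) (v t)) (me l t)) (innerC (e k t) (projm _)).
rewrite (inner_projm (lie (e l t) (v t)) (me k t)) (innerC (lie (e l t) (v t))).
rewrite addrACA inner_lie_skew -mulrDr inner_lie_skew; ring.
Qed.

Let lie_der_r (A B C : M) : lie (lie A B) C = lie (lie A C) B + lie A (lie B C).
Proof.
by rewrite (lieC (lie A B)) lie_jacobi opprD -lieNl -(lieC A C) -lieNr -(lieC B C).
Qed.

Let p k t := inner (v t) (e k t).

Let p_cst k t : p k t = p k 0.
Proof.
apply: (@is_derive0_cst (p k)) => {}t.
apply: is_derive_eq (is_derive_inner (is_mderive_v t) (is_mderive_e k t)) _.
rewrite innerDr addrA inner_lie_skew add0r innerZr innerC.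
by rewrite (inner_projm (lie (e k t) (v t)) (mv t)) inner_ev_v mulr0.
Qed.

Let n k t : M := lie (e k t) (v t).

Let is_mderive_n k t : is_mderive (n k) t (lie (n k t) (u t) + half *: lie (projm (n k t)) (v t)).
Proof.
apply: is_mderive_eq (is_mderive_lie (is_mderive_e k t) (is_mderive_v t)) _.
rewrite lieDl lieZl addrAC; congr (_ + _).
exact/esym/lie_der_r.
Qed.

Let Lam t : 'M[R]_7 := \matrix_(k, j) inner (n k t) (e j t).

(** The rotation by [u] preserves every pairing, and the remaining terms cancel
    because the bracket with [v] is skew. The same holds for [p_cst]. *)
Let Lam_cst t : Lam t = Lam 0.
Proof.
apply/matrixP => k j; rewrite !mxE.
apply: (@is_derive0_cst (fun t => inner (n k t) (e j t))) => {}t.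
apply: is_derive_eq (is_derive_inner (is_mderive_n k t) (is_mderive_e j t)) _.
rewrite innerDl innerDr innerZl innerZr addrACA inner_lie_skew add0r -mulrDr.
by rewrite inner_lie_skew_opp projm_sym addNr mulr0.
Qed.

Let G t : 'M[R]_7 := \matrix_(k, l) inner (n k t) (n l t).

(** An orthonormal family of seven vectors is a basis of m. *)
Let frame_span x t : mspace x -> x = \sum_k (inner x (e k t))%:C%C *: e k t.
Proof.
move=> mx; pose P : 'M[R]_7 := \matrix_(k, j) inner (e k t) (Q R j).
have eE k : e k t = \sum_(j < 7) (P k j)%:C%C *: Q R j.
  by rewrite -[LHS](projm_id (me k t)) /projm; apply: eq_bigr => j _; rewrite mxE.
have QP j k : inner (Q R (j : 'I_7)) (e k t) = P k j by rewrite mxE innerC.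
have PPt : P *m P^T = 1%:M.
  apply/matrixP => k l; rewrite !mxE -(orthonormal_e k l t) {1}(eE k) inner_suml.
  by apply: eq_bigr => j _; rewrite innerZl QP [P^T _ _]mxE.
have PtP := mulmx1C PPt.
have PtPE i j : \sum_k P k i * P k j = (i == j)%:R.
  have := congr1 (fun B : 'M[R]_7 => B i j) PtP.
  rewrite mxE [X in _ = X -> _]mxE => <-.
  by apply: eq_bigr => k _; rewrite [P^T _ _]mxE.
rewrite -{1}(projm_id mx) /projm.
have xe k : inner x (e k t) = \sum_(j < 7) inner x (Q R j) * P k j.
  by rewrite eE inner_sumr; apply: eq_bigr => j _; rewrite innerZr mulrC.
under [RHS]eq_bigr do rewrite {2}eE scaler_sumr.
rewrite exchange_big/=; apply: eq_bigr => j _.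
under eq_bigr do rewrite scalerA -rmorphM/=.
rewrite -scaler_suml -rmorph_sum; congr (_%:C%C *: _).
under eq_bigr do rewrite xe mulr_suml.
rewrite exchange_big/= (bigD1 j)//= [X in _ = _ + X]big1 ?addr0 => [|i /negbTE ij].
  transitivity (inner x (Q R j) * \sum_k P k j * P k j).
    by rewrite PtPE eqxx mulr1.
  by rewrite mulr_sumr; apply: eq_bigr => k _; rewrite mulrA.
transitivity (inner x (Q R i) * \sum_k P k i * P k j).
  by rewrite mulr_sumr; apply: eq_bigr => k _; rewrite mulrA.
by rewrite PtPE ij mulr0.
Qed.

Let projm_n k t : projm (n k t) = \sum_j (Lam t k j)%:C%C *: e j t.
Proof.
rewrite [LHS](frame_span t (mspace_projm _)); apply: eq_bigr => j _.
by congr (_%:C%C *: _); rewrite mxE; exact: inner_projm.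
Qed.

Let lie_projm_n k t : lie (projm (n k t)) (v t) = \sum_j (Lam t k j)%:C%C *: n j t.
Proof. by rewrite projm_n lie_suml; apply: eq_bigr => j _; rewrite lieZl. Qed.

Let Lam_skew t : (Lam t)^T = - Lam t.
Proof.
by apply/matrixP => k j; rewrite !mxE /n inner_lie_skew_opp innerC.
Qed.

Let is_derive_G k l t : is_derive t (1 : R) (fun t => G t k l)
  ((1 / 2) * (Lam 0 *m G t - G t *m Lam 0) k l).
Proof.
rewrite (_ : (fun t => _) = fun t => inner (n k t) (n l t)); last first.
  by apply/funext => s; rewrite mxE.
apply: is_derive_eq (is_derive_inner (is_mderive_n k t) (is_mderive_n l t)) _.
rewrite innerDl innerDr innerZl innerZr addrACA inner_lie_skew add0r -mulrDr.
congr (_ * _); rewrite mxE [X in _ = _ + X]mxE -(Lam_cst t) -[Lam t in X in _ = _ + X]opprK.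
rewrite -Lam_skew mulmxN !mxE opprK !lie_projm_n inner_suml inner_sumr.
by congr (_ + _); apply: eq_bigr => j _; rewrite ?innerZl ?innerZr !mxE// mulrC.
Qed.

(** By invariance of the inner product, [curvature_killing] reads
    <R(x,v)v, y> = <[x,v], [y,v]> - 3/4 <[x,v]_m, [y,v]_m>. *)
Let RtE t : Rt t = G t + (3 / 4) *: (Lam t *m Lam t).
Proof.
apply/matrixP => k l.
have := jR (t := t) (k := k)
  (killing_vfield (sp2_Ad' (Sc t) (mspace_sp2 (me k t))))
  (killing_vfield (sp2_Ad' (Sc t) (mspace_sp2 (mv t))))
  (killing_at (Sc t) (me k t)) (killing_at (Sc t) (mv t)).
rewrite (curvature_killing LC (Sc t) (me k t) (mv t)) => /(congr1 (fun x => inner x (e l t))).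
have -> : inner (\sum_j (Rt t k j)%:C%C *: e j t) (e l t) = Rt t k l.
  rewrite inner_suml (bigD1 l)//= innerZl orthonormal_e eqxx mulr1.
  rewrite big1 ?addr0 => [//|j /negbTE jl].
  by rewrite innerZl orthonormal_e jl mulr0.
have hX : inner (projm (lie (v t) (n k t))) (e l t) = G t k l.
  apply: etrans (inner_projm _ (me l t)) _.
  by rewrite (lieC (v t)) innerNl inner_lie_skew_opp opprK mxE.
have hY : inner (projm (lie (v t) (projm (n k t)))) (e l t) = - (Lam t *m Lam t) k l.
  apply: etrans (inner_projm _ (me l t)) _.
  rewrite (lieC (v t)) innerNl lie_projm_n inner_suml mxE; congr (- _).
  by apply: eq_bigr => j _; rewrite innerZl [Lam t j l]mxE.
move=> <-; apply: etrans (innerBl _ _ _) _.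
rewrite innerZl hX hY mulrN opprK.
by rewrite [RHS]mxE [X in _ = _ + X]mxE.
Qed.

Let P : 'M[R]_7 := \matrix_(k, j) (p k 0 * p j 0).

Let v_span t : v t = \sum_k (p k 0)%:C%C *: e k t.
Proof.
by rewrite {1}(frame_span t (mv t)); apply: eq_bigr => k _; rewrite -(p_cst k t).
Qed.

(** [projm_lie_sq] for the unit vector [v], in the frame [e]. *)
Let Lam_sq t : Lam t *m Lam t = P - 1%:M.
Proof.
apply/matrixP => k l; rewrite !mxE.
transitivity (inner (lie (projm (n k t)) (v t)) (e l t)).
  by rewrite lie_projm_n inner_suml; apply: eq_bigr => j _; rewrite innerZl !mxE.
rewrite lieC innerNl.
rewrite -(inner_projm (lie (v t) (projm (n k t))) (me l t)).
rewrite /n (lieC (e k t)) projmN lieNr projmN innerNl opprK projm_lie_sq//.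
rewrite innerBl !innerZl unitc mul1r orthonormal_e.
by rewrite -(p_cst k t) -(p_cst l t).
Qed.

Let RtP t : Rt t *m P = 0.
Proof.
have h (A : 'M[R]_7) : (forall k, \sum_j A k j * p j 0 = 0) -> A *m P = 0.
  move=> A0; apply/matrixP => k l; rewrite !mxE.
  under eq_bigr do rewrite mxE mulrA.
  by rewrite -mulr_suml A0 mul0r.
have LP : Lam t *m P = 0.
  apply: h => k; rewrite -[RHS](inner_ev_v (e k t) t) {2}v_span inner_sumr.
  by apply: eq_bigr => j _; rewrite [Lam t k j]mxE innerZr [LHS]mulrC.
have GP : G t *m P = 0.
  apply: h => k; rewrite -[RHS](inner0r (n k t)) -(liexx (v t)) {1}v_span lie_suml inner_sumr.
  by apply: eq_bigr => j _; rewrite [G t k j]mxE lieZl innerZr [LHS]mulrC.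
by rewrite RtE mulmxDl GP -scalemxAl -mulmxA LP mulmx0 scaler0 addr0.
Qed.

Let Rt_sym t : (Rt t)^T = Rt t.
Proof.
rewrite RtE linearD linearZ/= trmx_mul Lam_skew mulmxN mulNmx opprK; congr (_ + _).
by apply/matrixP => k l; rewrite !mxE innerC.
Qed.

Let P_sym : P^T = P.
Proof. by apply/matrixP => k l; rewrite !mxE mulrC. Qed.

Let PRt t : P *m Rt t = 0.
Proof. by rewrite -P_sym -Rt_sym -trmx_mul RtP trmx0. Qed.

(** The Jacobi operator of V_1 in a parallel frame rotates with constant
    angular velocity, and the generator [L] of this rotation squares to minus
    the identity where [Rt] lives. *)
Lemma jacobi_operator_rotation : exists L : 'M[R]_7,
  [/\ forall t k l, is_derive t (1 : R) (fun t => Rt t k l)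
        ((1 / 2) * (L *m Rt t - Rt t *m L) k l),
      forall t, L *m L *m Rt t = - Rt t
    & forall t, Rt t *m (L *m L) = - Rt t].
Proof.
exists (Lam 0); split=> [t k l|t|t].
- have -> : (fun t => Rt t k l) = fun t => G t k l + (3 / 4) * (Lam 0 *m Lam 0) k l.
    by apply/funext => s; rewrite RtE Lam_cst !mxE.
  have := is_deriveD (is_derive_G k l t) (is_derive_cst ((3 / 4) * (Lam 0 *m Lam 0) k l) t 1).
  move=> h; apply: is_derive_eq h _; rewrite addr0; congr (_ * fun_of_matrix _ k l).
  rewrite RtE (Lam_cst t) mulmxDr mulmxDl -scalemxAl -scalemxAr !mulmxA.
  by rewrite opprD addrACA subrr addr0.
- by rewrite Lam_sq mulmxBl PRt mul1mx sub0r.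
- by rewrite Lam_sq mulmxBr RtP mulmx1 sub0r.
Qed.

End Frame.

(** * Linear differential equations and Taylor bounds *)

Section MatrixODE.
Variable R : realType.

Section MxDer.
Variables m n : nat.
Definition is_mxderive (f : R -> 'M[R]_(m, n)) t (d : 'M[R]_(m, n)) :=
  forall i j, is_derive t (1 : R) (fun s => f s i j) (d i j).

Lemma is_mxderive_eq f t d d' : is_mxderive f t d -> d = d' -> is_mxderive f t d'.
Proof. by move=> ? <-. Qed.

Lemma is_mxderive_cst A t : is_mxderive (fun=> A) t 0.
Proof. by move=> i j; rewrite mxE; exact: is_derive_cst. Qed.

Lemma is_mxderiveD f g t d e : is_mxderive f t d -> is_mxderive g t e ->
  is_mxderive (fun s => f s + g s) t (d + e).
Proof.
move=> fd ge i j; rewrite mxE.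
rewrite (_ : (fun s => _) = (fun s => f s i j) + (fun s => g s i j)).
  exact: is_deriveD.
by apply/funext => s; rewrite mxE.
Qed.

Lemma is_mxderiveZ (a : R) f t d : is_mxderive f t d -> is_mxderive (fun s => a *: f s) t (a *: d).
Proof.
move=> fd i j; rewrite mxE.
rewrite (_ : (fun s => _) = a *: (fun s => f s i j)); first exact: is_deriveZ.
by apply/funext => s; rewrite mxE.
Qed.

Lemma is_mxderiveB f g t d e : is_mxderive f t d -> is_mxderive g t e ->
  is_mxderive (fun s => f s - g s) t (d - e).
Proof.
move=> fd ge; rewrite -scaleN1r (_ : (fun s => _) = fun s => f s + -1 *: g s).
  by apply: is_mxderiveD => //; exact: is_mxderiveZ.
by apply/funext => s; rewrite scaleN1r.
Qed.

End MxDer.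

Lemma is_mxderive_derive1 m n (f d : R -> 'M[R]_(m.+1, n.+1)) :
  (forall t, is_mxderive f t (d t)) -> derive1 f = d.
Proof.
move=> fd; apply/funext => t.
have df : derivable f t 1 by apply/derivable_mxP => i j; have [] := fd t i j.
rewrite derive1E derive_mx//; apply/matrixP => i j; rewrite mxE.
by have h := fd t i j; rewrite derive_val.
Qed.

Lemma derivable_is_mxderive m n (f : R -> 'M[R]_(m.+1, n.+1)) t : derivable f t 1 ->
  is_mxderive f t (derive1 f t).
Proof.
move=> df i j; rewrite derive1E derive_mx// mxE -derive1E.
have /derivable_mxP h := df.
by rewrite derive1E; apply: derivableP; exact: h.
Qed.

Lemma is_mxderiveM m n p (f : R -> 'M[R]_(m, n)) (g : R -> 'M[R]_(n, p)) t d e :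
  is_mxderive f t d -> is_mxderive g t e ->
  is_mxderive (fun s => f s *m g s) t (d *m g t + f t *m e).
Proof.
move=> fd ge i j; rewrite !mxE -big_split/=.
have h k : is_derive t (1 : R) (fun s => f s i k * g s k j)
    (d i k * g t k j + f t i k * e k j).
  exact: is_derive_mul.
have := is_derive_sum h; rewrite fct_sumE; congr (is_derive _ _ _ _).
by apply/funext => s; rewrite mxE.
Qed.

Section Scalar.

Lemma is_derive_add (f g : R -> R) t d e :
  is_derive t (1 : R) f d -> is_derive t (1 : R) g e ->
  is_derive t (1 : R) (fun s => f s + g s) (d + e).
Proof. exact: is_deriveD. Qed.

Lemma is_derive_sub (f g : R -> R) t d e :
  is_derive t (1 : R) f d -> is_derive t (1 : R) g e ->
  is_derive t (1 : R) (fun s => f s - g s) (d - e).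
Proof. exact: is_deriveB. Qed.

Lemma is_derive_const (a t : R) : is_derive t (1 : R) (fun _ : R => a) 0.
Proof. exact: is_derive_cst. Qed.

Lemma rotation_ode (g h : R -> R) :
  (forall t, is_derive t (1 : R) g (h t)) ->
  (forall t, is_derive t (1 : R) h (- g t)) ->
  forall t, g t = cos t * g 0 + sin t * h 0.
Proof.
move=> dg dh t.
(* g cos - h sin and g sin + h cos are constant *)
have e1 : g t * cos t - h t * sin t = g 0.
  transitivity (g 0 * cos 0 - h 0 * sin 0); last by rewrite cos0 sin0; ring.
  apply: (@is_derive_0_is_cst _ (fun t => g t * cos t - h t * sin t)) => s.
  apply: is_derive_eq (is_derive_sub (is_derive_mul (dg s) (is_derive_cos s))
     (is_derive_mul (dh s) (is_derive_sin s))) _; ring.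
have e2 : g t * sin t + h t * cos t = h 0.
  transitivity (g 0 * sin 0 + h 0 * cos 0); last by rewrite cos0 sin0; ring.
  apply: (@is_derive_0_is_cst _ (fun t => g t * sin t + h t * cos t)) => s.
  apply: is_derive_eq (is_derive_add (is_derive_mul (dg s) (is_derive_sin s))
     (is_derive_mul (dh s) (is_derive_cos s))) _; ring.
rewrite -e1 -e2 -[LHS]mulr1 -(cos2Dsin2 t); ring.
Qed.

Lemma third_order_ode (f g h : R -> R) :
  (forall t, is_derive t (1 : R) f (g t)) ->
  (forall t, is_derive t (1 : R) g (h t)) ->
  (forall t, is_derive t (1 : R) h (- g t)) ->
  forall t, f t = f 0 + sin t * g 0 + (1 - cos t) * h 0.
Proof.
move=> df dg dh t; have gE := rotation_ode dg dh.
apply/eqP; rewrite -subr_eq0; apply/eqP.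
transitivity (f 0 - (f 0 + sin 0 * g 0 + (1 - cos 0) * h 0)); last first.
  by rewrite cos0 sin0; ring.
apply: (@is_derive_0_is_cst _ (fun t => f t - (f 0 + sin t * g 0 + (1 - cos t) * h 0))) => s.
apply: is_derive_eq (is_derive_sub (df s) (is_derive_add (is_derive_add (is_derive_const (f 0) s)
  (is_derive_mul (is_derive_sin s) (is_derive_const (g 0) s)))
  (is_derive_mul (is_derive_sub (is_derive_const 1 s) (is_derive_cos s))
    (is_derive_const (h 0) s)))) _.
rewrite gE; ring.
Qed.

(** The inductive step of the estimate of Taylor remainders. *)
Lemma is_derive_bound (f df : R -> R) B n T :
  (forall s, is_derive s (1 : R) f (df s)) -> f 0 = 0 ->
  (forall s, 0 <= s <= T -> `|df s| <= B * (s ^+ n / n`!%:R)) ->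
  forall s, 0 <= s <= T -> `|f s| <= B * (s ^+ n.+1 / n.+1`!%:R).
Proof.
move=> fd f0 dB s /andP[s0 sT].
have key (g dg : R -> R) : (forall s, is_derive s (1 : R) g (dg s)) -> g 0 = 0 ->
    (forall s, 0 <= s <= T -> dg s <= B * (s ^+ n / n`!%:R)) ->
    g s <= B * (s ^+ n.+1 / n.+1`!%:R).
  move=> gd g0 dgB.
  pose h s := B * (s ^+ n.+1 / n.+1`!%:R) - g s.
  have hd x : is_derive x (1 : R) h (B * (x ^+ n / n`!%:R) - dg x).
    have dX : is_derive x (1 : R) (fun x : R => x ^+ n.+1) (n.+1%:R * x ^+ n).
      have := is_deriveX n.+1 (is_derive_id x (1 : R)).
      rewrite (_ : (fun x : R => x ^+ n.+1) = id ^+ n.+1).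
        by move=> h1; apply: is_derive_eq h1 _; rewrite /= scaler1 mulr_natl.
      by apply/funext => y; rewrite exprfctE.
    have dc := is_derive_mul (is_derive_const B x)
      (is_derive_mul dX (is_derive_const (n.+1`!%:R^-1) x)).
    apply: is_derive_eq (is_derive_sub dc (gd x)) _.
    rewrite mul0r add0r mulr0 addr0 factS natrM invfM mulrACA divff ?pnatr_eq0//.
    by rewrite mul1r.
  have : h 0 <= h s.
    apply: (@ger0_derive1_le_cc _ h 0 T).
    - by move=> x _; have [] := hd x.
    - move=> x; rewrite in_itv/= => /andP[x0 xT].
      rewrite derive1E; have hx := hd x; rewrite derive_val subr_ge0.
      by apply: dgB; rewrite !ltW.
    - apply: continuous_subspaceT => x; apply: differentiable_continuous.
      by apply/derivable1_diffP; have [] := hd x.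
    - by rewrite in_itv/= lexx (le_trans s0 sT).
    - by rewrite in_itv/= s0 sT.
    - exact: s0.
  by rewrite /h g0 expr0n/= mul0r mulr0 subr0 subr_ge0.
rewrite ler_norml lerNl; apply/andP; split.
  apply: (key (fun s => - f s) (fun s => - df s)).
  - by rewrite f0 oppr0.
  - by move=> x xT; apply: le_trans (dB x xT); rewrite -normrN ler_norm.
by apply: (key f df) => // x xT; apply: le_trans (dB x xT); exact: ler_norm.
Qed.

(** Subtracting a Taylor polynomial of [f 0] and differentiating gives the same
    situation for [f 1] with one term less. *)
Lemma taylor_bound_ge0 (f : nat -> R -> R) (B : nat -> R) T :
  (forall k s, is_derive s (1 : R) (f k) (f k.+1 s)) ->
  (forall k s, 0 <= s <= T -> `|f k s| <= B k) ->
  forall n s, 0 <= s <= T ->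
    `|f 0%N s - \sum_(k < n) (k`!%:R)^-1 * s ^+ k * f k 0| <= B n * (s ^+ n / n`!%:R).
Proof.
move=> fd fB n; elim: n f B fd fB => [|n ih] f B fd fB s sT.
  by rewrite big_ord0 subr0 expr0 divr1 mulr1; exact: fB.
pose g s := f 0%N s - \sum_(k < n.+1) (k`!%:R)^-1 * s ^+ k * f k 0.
pose dg s := f 1%N s - \sum_(k < n) (k`!%:R)^-1 * s ^+ k * f k.+1 0.
have gd x : is_derive x (1 : R) g (dg x).
  pose p : {poly R} := \poly_(k < n.+1) ((k`!%:R)^-1 * f k 0).
  have pE y : \sum_(k < n.+1) (k`!%:R)^-1 * y ^+ k * f k 0 = p.[y].
    by rewrite horner_poly; apply: eq_bigr => k _; rewrite mulrAC.
  have dpE y : \sum_(k < n) (k`!%:R)^-1 * y ^+ k * f k.+1 0 = p^`().[y].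
    have szp : (size p^`() <= n)%N.
      apply: leq_trans (size_poly _ _) _.
      by rewrite -subn1 leq_subLR add1n; exact: size_poly.
    rewrite (horner_coef_wide _ szp); apply: eq_bigr => k _.
    rewrite coef_deriv coef_poly ltnS ltn_ord.
    rewrite -[_ *+ k.+1]mulr_natl factS natrM invfM !mulrA.
    by rewrite divff ?pnatr_eq0// mul1r mulrAC.
  have -> : g = fun y => f 0%N y - p.[y] by apply/funext => y; rewrite /g pE.
  by rewrite /dg dpE; apply: is_derive_sub => //; exact: is_derive_poly.
have g0 : g 0 = 0.
  rewrite /g big_ord_recl/= expr0 fact0 invr1 !mul1r big1 ?addr0 ?subrr// => k _.
  by rewrite exprS mul0r mulr0 mul0r.
apply: (is_derive_bound gd g0) sT => x xT.
exact: (ih (fun k => f k.+1) (fun k => B k.+1) (fun k => fd k.+1) (fun k => fB k.+1) x xT).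
Qed.

Lemma taylor_bound (f : nat -> R -> R) (B : nat -> R) T :
  (forall k s, is_derive s (1 : R) (f k) (f k.+1 s)) ->
  (forall k s, `|s| <= T -> `|f k s| <= B k) ->
  forall n s, `|s| <= T ->
    `|f 0%N s - \sum_(k < n) (k`!%:R)^-1 * s ^+ k * f k 0| <= B n * (`|s| ^+ n / n`!%:R).
Proof.
move=> fd fB n s sT; have [s0|s0] := leP 0 s.
  rewrite (ger0_norm s0); apply: (taylor_bound_ge0 (f := f) (T := T)) => //.
    by move=> k x /andP[x0 xT]; apply: fB; rewrite ger0_norm.
  by rewrite s0 -(ger0_norm s0).
(* a negative argument is reflected *)
pose h k x := (-1) ^+ k * f k (- x).
have hd k x : is_derive x (1 : R) (h k) (h k.+1 x).
  have dN : is_derive x (1 : R) (fun x : R => - x) (-1).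
    by have := is_deriveN (is_derive_id x (1 : R)).
  have d2 : is_derive x (1 : R) (fun x => f k (- x)) (- f k.+1 (- x)).
    have := @is_derive1_comp _ (f k) (fun x => - x) x _ _ (fd k (- x)) dN.
    by move=> h1; apply: is_derive_eq h1 _; rewrite mulrN1.
  have := is_derive_mul (is_derive_const ((-1) ^+ k) x) d2.
  by move=> h1; apply: is_derive_eq h1 _; rewrite mul0r add0r /h exprS mulN1r mulNr mulrN.
have hB k x : 0 <= x <= T -> `|h k x| <= B k.
  by move=> /andP[x0 xT]; rewrite /h normrM normrX normrN1 expr1n mul1r;
    apply: fB; rewrite normrN ger0_norm.
have sN : 0 <= - s <= T by rewrite oppr_ge0 (ltW s0) -(ltr0_norm s0).
have := taylor_bound_ge0 hd hB n sN; rewrite /h expr0 mul1r opprK (ltr0_norm s0).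
congr (`|_ - _| <= _); apply: eq_bigr => k _.
by rewrite oppr0 mulrA -!mulrA; congr (_ * _); rewrite mulrA -exprMn mulNr mulrN1 opprK.
Qed.

End Scalar.
End MatrixODE.

(** * The power series of the Jacobi tensor *)

Section Rotation.
Variable R : realType.
Implicit Types A B X Y : 'M[R]_7.
Variables (Rt : R -> 'M[R]_7) (L : 'M[R]_7).

Definition brk X : 'M[R]_7 := (1 / 2 : R) *: (L *m X - X *m L).

Hypothesis dRt : forall t, is_mxderive Rt t (brk (Rt t)).
Hypothesis LLRt : forall t, L *m L *m Rt t = - Rt t.
Hypothesis RtLL : forall t, Rt t *m (L *m L) = - Rt t.

Lemma brkM X Y : brk (X *m Y) = brk X *m Y + X *m brk Y.
Proof.
rewrite /brk -scalemxAl -scalemxAr -scalerDr mulmxBl mulmxBr !mulmxA; congr (_ *: _).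
by rewrite subrKA.
Qed.

Lemma brkB X Y : brk (X - Y) = brk X - brk Y.
Proof.
by rewrite /brk -scalerBr mulmxBr mulmxBl; congr (_ *: _); rewrite !opprD addrACA.
Qed.

Lemma brkD X Y : brk (X + Y) = brk X + brk Y.
Proof.
by rewrite /brk -scalerDr mulmxDr mulmxDl opprD addrACA.
Qed.

Lemma is_mxderive_brk f t d : is_mxderive f t d -> is_mxderive (fun s => brk (f s)) t (brk d).
Proof.
move=> fd; apply: is_mxderiveZ; apply: is_mxderiveB.
  have h := is_mxderiveM (is_mxderive_cst L t) fd.
  by apply: is_mxderive_eq h _; rewrite mul0mx add0r.
have h := is_mxderiveM fd (is_mxderive_cst L t).
by apply: is_mxderive_eq h _; rewrite mulmx0 addr0.
Qed.

(** As [L] squares to -1 on either side of [Rt], the double commutator of [L]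
    with [Rt] is -2 (Rt + L Rt L), and the triple one is -4 times the simple one. *)
Lemma brk3 t : brk (brk (brk (Rt t))) = - brk (Rt t).
Proof.
have h1 := LLRt t; have h2 := RtLL t; move: (Rt t) h1 h2 => X h1 h2.
have e2 : brk (brk X) = - ((1 / 2 : R) *: (X + L *m X *m L)).
  rewrite /brk -scalemxAr -scalemxAl -scalerBr scalerA mulmxBr mulmxBl !mulmxA h1.
  rewrite -(mulmxA X) h2 -scalerN.
  set Z := L *m X *m L.
  have -> : - X - Z - (Z - - X) = - (2 : R) *: (X + Z).
    by apply/matrixP => i j; rewrite !mxE; ring.
  by rewrite scalerA scalerN -scaleNr; congr (_ *: _); field.
rewrite e2 /brk mulmxN mulNmx -scalemxAr -scalemxAl mulmxDr mulmxDl !mulmxA h1.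
rewrite -[L *m X *m L *m L]mulmxA -[L *m X *m (L *m L)]mulmxA h2 mulNmx mulmxN.
set Z := L *m X; set W := X *m L.
by apply/matrixP => i j; rewrite !mxE; field.
Qed.

Let dRtE : derive1 Rt = fun t => brk (Rt t).
Proof. exact: is_mxderive_derive1. Qed.

Let ddRtE : derive1 (derive1 Rt) = fun t => brk (brk (Rt t)).
Proof. by rewrite dRtE; apply: is_mxderive_derive1 => t; exact: is_mxderive_brk. Qed.

Lemma rotation_formula t :
  Rt t = Rt 0 + sin t *: derive1 Rt 0 + (1 - cos t) *: derive1 (derive1 Rt) 0.
Proof.
apply/matrixP => i j; rewrite !mxE ddRtE dRtE.
apply: (third_order_ode (f := fun t => Rt t i j) (g := fun t => brk (Rt t) i j)
  (h := fun t => brk (brk (Rt t)) i j)) => {}t.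
- exact: dRt.
- exact: (is_mxderive_brk (dRt t)).
- have := is_mxderive_brk (is_mxderive_brk (dRt t)) i j.
  by rewrite brk3 [X in is_derive _ _ _ X]mxE.
Qed.

Let al k := (alpha_beta Rt k).1.
Let be k := (alpha_beta Rt k).2.

Let abS k : (forall t, al k.+2 t = derive1 (al k.+1) t - Rt t *m be k.+1 t) /\
            (forall t, be k.+2 t = al k.+1 t + derive1 (be k.+1) t).
Proof.
rewrite /al /be -[alpha_beta Rt k.+2]/(let: (alpha, beta) := alpha_beta Rt k.+1 in
      (fun t => derive1 alpha t - Rt t *m beta t,
       fun t => alpha t + derive1 beta t)).
by case: (alpha_beta Rt k.+1).
Qed.

Let brk0 : brk 0 = 0.
Proof. by rewrite /brk mulmx0 mul0mx subr0 scaler0. Qed.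

(** All the alpha_k and beta_k are noncommutative polynomials in [L] and [Rt],
    so that they are differentiated by the same bracket as [Rt]. *)
Let ab_der k t : is_mxderive (al k.+1) t (brk (al k.+1 t)) /\ is_mxderive (be k.+1) t (brk (be k.+1 t)).
Proof.
elim: k t => [|k ih] t.
  split; first by rewrite brk0; exact: is_mxderive_cst.
  rewrite /brk mulmx1 mul1mx subrr scaler0; exact: is_mxderive_cst.
have [hal hbe] := abS k.
have dal : derive1 (al k.+1) = fun t => brk (al k.+1 t).
  by apply: is_mxderive_derive1 => s; have [] := ih s.
have dbe : derive1 (be k.+1) = fun t => brk (be k.+1 t).
  by apply: is_mxderive_derive1 => s; have [] := ih s.
have [ia ib] := ih t; split.
  rewrite (funext hal) dal.
  apply: is_mxderive_eq (is_mxderiveB (is_mxderive_brk ia) (is_mxderiveM (dRt t) ib)) _.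
  by rewrite brkB brkM.
rewrite (funext hbe) dbe.
by apply: is_mxderive_eq (is_mxderiveD ia (is_mxderive_brk ib)) _; rewrite brkD.
Qed.

Let alS k t : al k.+2 t = brk (al k.+1 t) - Rt t *m be k.+1 t.
Proof.
have [-> _] := abS k; congr (_ - _).
by rewrite (is_mxderive_derive1 (d := fun t => brk (al k.+1 t)))// => s; have [] := ab_der k s.
Qed.

Let beS k t : be k.+2 t = al k.+1 t + brk (be k.+1 t).
Proof.
have [_ ->] := abS k; congr (_ + _).
by rewrite (is_mxderive_derive1 (d := fun t => brk (be k.+1 t)))// => s; have [] := ab_der k s.
Qed.

Section Norm.

Definition l1norm A : R := \sum_i \sum_j `|A i j|.

Lemma l1norm_ge0 A : 0 <= l1norm A.
Proof. by do 2 (apply: sumr_ge0 => ? _). Qed.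

Lemma le_entry_l1norm A i j : `|A i j| <= l1norm A.
Proof.
rewrite /l1norm (bigD1 i)//= (bigD1 j)//= -addrA lerDl addr_ge0//.
  by apply: sumr_ge0 => ? _.
by do 2 (apply: sumr_ge0 => ? _).
Qed.

Lemma l1normD A B : l1norm (A + B) <= l1norm A + l1norm B.
Proof.
rewrite /l1norm -big_split; apply: ler_sum => i _ /=; rewrite -big_split.
by apply: ler_sum => j _ /=; rewrite mxE ler_normD.
Qed.

Lemma l1normN A : l1norm (- A) = l1norm A.
Proof. by do 2 (apply: eq_bigr => ? _); rewrite mxE normrN. Qed.

Lemma l1normB A B : l1norm (A - B) <= l1norm A + l1norm B.
Proof. by apply: le_trans (l1normD _ _) _; rewrite l1normN. Qed.

Lemma l1normZ (a : R) A : l1norm (a *: A) = `|a| * l1norm A.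
Proof.
rewrite /l1norm mulr_sumr; apply: eq_bigr => i _; rewrite mulr_sumr.
by apply: eq_bigr => j _; rewrite mxE normrM.
Qed.

Lemma l1normM A B : l1norm (A *m B) <= l1norm A * l1norm B.
Proof.
rewrite /l1norm mulr_suml; apply: ler_sum => i _.
apply: le_trans (_ : \sum_j \sum_k `|A i k| * `|B k j| <= _).
  apply: ler_sum => j _; rewrite mxE; apply: le_trans (ler_norm_sum _ _ _) _.
  by apply: ler_sum => k _; rewrite normrM.
rewrite exchange_big/= mulr_suml; apply: ler_sum => k _.
rewrite -mulr_sumr ler_wpM2l// [leRHS](bigD1 k)//= lerDl.
by do 2 (apply: sumr_ge0 => ? _).
Qed.

Lemma l1norm_brk X : l1norm (brk X) <= l1norm L * l1norm X.
Proof.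
rewrite /brk l1normZ ger0_norm ?divr_ge0//.
apply: le_trans (ler_wpM2l _ (l1normB _ _)) _; first by rewrite divr_ge0.
have := l1normM L X; have := l1normM X L; lra.
Qed.

Lemma l1norm_bounded (f : R -> 'M[R]_7) T : (forall t, derivable f t 1) ->
  exists C, forall s, `|s| <= T -> l1norm (f s) <= C.
Proof.
move=> df; have [T0|T0] := leP 0 T; last first.
  by exists 0 => s sT; have := le_lt_trans (le_trans (normr_ge0 s) sT) T0; rewrite ltxx.
have cf : continuous (fun s => l1norm (f s)).
  apply: continuous_big => [|i _]; first exact: add_continuous.
  apply: continuous_big => [|j _ s]; first exact: add_continuous.
  apply: cvg_norm.
  apply: differentiable_continuous; apply/derivable1_diffP.
  by have /derivable_mxP := df s.
have [|c _ hc] := @EVT_max R (fun s => l1norm (f s)) (- T) T _ (continuous_subspaceT cf).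
  by rewrite -subr_ge0 opprK addr_ge0.
by exists (l1norm (f c)) => s sT; apply: hc; rewrite in_itv/= -ler_norml.
Qed.

End Norm.

(** The k-th derivative of A is A alpha_k + A' beta_k, with value beta_k at 0.
    By the recursion with the constant [L], alpha_k and beta_k are bounded on
    [-|t|, |t|] by a multiple of K^k; so Taylor's remainder is at most a multiple
    of (K |t|)^n / n! and tends to 0. *)
Lemma jacobi_series (A : R -> 'M[R]_7) t : jacobi_tensor Rt A ->
  (\sum_(k < n) ((k`!%:R)^-1 * t ^+ k) *: beta Rt k 0) @[n --> \oo] --> A t.
Proof.
move=> [dA ddA A2 A0 dA0].
(* [X k] is the k-th derivative of [A] *)
pose X k s : 'M[R]_7 := if k is k'.+1 then A s *m al k s + derive1 A s *m be k s else A s.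
have X1 s : X 1%N s = derive1 A s by rewrite /X /al /be /= mulmx0 mulmx1 add0r.
have Xd k s : is_mxderive (X k) s (X k.+1 s).
  case: k => [|k]; first by rewrite X1; exact: derivable_is_mxderive.
  have [ia ib] := ab_der k s.
  apply: is_mxderive_eq (is_mxderiveD (is_mxderiveM (derivable_is_mxderive (dA s)) ia)
    (is_mxderiveM (derivable_is_mxderive (ddA s)) ib)) _.
  rewrite A2 /X alS beS mulmxBr mulmxDr mulNmx !mulmxA.
  set a := _ *m al _ _; set b := _ *m brk _; set c := _ *m _ *m _; set d := _ *m brk _.
  by rewrite addrC [a + b]addrC addrACA [- c + b]addrC [d + a]addrC.
have X0 k : X k 0 = beta Rt k 0.
  by case: k => [|k] /=; rewrite A0// dA0 mul0mx mul1mx add0r.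
have dRt' s : derivable Rt s 1 by apply/derivable_mxP => i j; have [] := dRt s i j.
have [CA hA] := l1norm_bounded `|t| dA.
have [CB hB] := l1norm_bounded `|t| ddA.
have [CR hR] := l1norm_bounded `|t| dRt'.
have t0 : `|0 : R| <= `|t| by rewrite normr0.
have CA0 : 0 <= CA := le_trans (l1norm_ge0 _) (hA 0 t0).
have CB0 : 0 <= CB := le_trans (l1norm_ge0 _) (hB 0 t0).
have CR0 : 0 <= CR := le_trans (l1norm_ge0 _) (hR 0 t0).
have L0 := l1norm_ge0 L.
(* K bounds one step of the recursion for the norms of alpha_k and beta_k *)
pose K := 1 + l1norm L + CR; pose c0 := l1norm 0 + l1norm 1%:M.
have K1 : 1 <= K by rewrite /K -addrA lerDl addr_ge0.
have c00 : 0 <= c0 by rewrite addr_ge0 ?l1norm_ge0.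
have hab k s : `|s| <= `|t| -> l1norm (al k.+1 s) + l1norm (be k.+1 s) <= c0 * K ^+ k.
  move=> st; elim: k => [|k ih]; first by rewrite expr0 mulr1.
  rewrite alS beS exprSr mulrA.
  apply: le_trans (_ : (l1norm (al k.+1 s) + l1norm (be k.+1 s)) * K <= _); last first.
    by rewrite ler_wpM2r// (le_trans _ K1).
  apply: le_trans (lerD (l1normB _ _) (l1normD _ _)) _.
  have h1 := l1norm_brk (al k.+1 s); have h2 := l1norm_brk (be k.+1 s).
  have h3 := l1normM (Rt s) (be k.+1 s).
  have h4 : l1norm (Rt s) * l1norm (be k.+1 s) <= CR * l1norm (be k.+1 s).
    by rewrite ler_wpM2r ?l1norm_ge0// hR.
  have h5 : 0 <= CR * l1norm (al k.+1 s) by rewrite mulr_ge0 ?l1norm_ge0.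
  have h6 := l1norm_ge0 (be k.+1 s).
  by rewrite /K; nra.
pose B := (CA + CB) * (1 + c0).
have CAB : 0 <= CA + CB by rewrite addr_ge0.
have Xb i j k s : `|s| <= `|t| -> `|X k s i j| <= B * K ^+ k.
  move=> st; apply: le_trans (le_entry_l1norm _ _ _) _; case: k => [|k] /=.
    rewrite expr0 mulr1; apply: le_trans (hA s st) _.
    by rewrite /B mulrDr mulr1 -addrA lerDl addr_ge0// mulr_ge0.
  apply: le_trans (l1normD _ _) _.
  apply: le_trans (_ : (CA + CB) * (l1norm (al k.+1 s) + l1norm (be k.+1 s)) <= _).
    have h1 := l1normM (A s) (al k.+1 s); have h2 := l1normM (derive1 A s) (be k.+1 s).
    apply: le_trans (lerD h1 h2) _; rewrite mulrDr; apply: lerD.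
      by rewrite ler_wpM2r ?l1norm_ge0//; apply: le_trans (hA s st) _; rewrite lerDl.
    by rewrite ler_wpM2r ?l1norm_ge0//; apply: le_trans (hB s st) _; rewrite lerDr.
  rewrite /B -mulrA ler_wpM2l//; apply: le_trans (hab k s st) _.
  apply: ler_pM => //; first by rewrite exprn_ge0// (le_trans _ K1).
    by rewrite lerDr.
  by rewrite exprS ler_peMl// exprn_ge0// (le_trans _ K1).
apply/cvg_ballP => e e0.
have /cvgrPdist_lt/(_ e e0) : B * exp_coeff (K * `|t|) n @[n --> \oo] --> (B * 0 : R).
  by apply: cvgMr; exact: cvg_exp_coeff.
apply: filterS => n; rewrite mulr0 sub0r normrN => hn; split=> // i j.
rewrite -ball_normE /ball_ /= summxE.
have := taylor_bound (f := fun k s => X k s i j) (fun k s => Xd k s i j) (Xb i j) n (lexx `|t|).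
move=> h; apply: le_lt_trans (le_lt_trans (ler_norm _) hn).
rewrite /exp_coeff /= exprMn; move: h; congr (`|_ - _| <= _).
  by apply: eq_bigr => k _; rewrite mxE -X0.
by rewrite !mulrA.
Qed.

End Rotation.

Theorem proposition4p1 (R : realType)
    (nabla : ('M[R[i]]_4 -> 'M[R[i]]_4) -> ('M[R[i]]_4 -> 'M[R[i]]_4) ->
             'M[R[i]]_4 -> 'M[R[i]]_4)
    (nablaLC : levi_civita nabla) :
  exists F : nat -> 'M[R]_7 -> 'M[R]_7 -> 'M[R]_7 -> 'M[R]_7,
  forall (gamma : R -> set 'M[R[i]]_4) (c : R -> 'M[R[i]]_4)
    (D : (R -> 'M[R[i]]_4) -> R -> 'M[R[i]]_4)
    (e : 'I_7 -> R -> 'M[R[i]]_4) (Rt : R -> 'M[R]_7),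
  smooth_lift gamma c ->
  covariant_derivative nabla c D ->
  geodesic c D ->
  unit_speed c ->
  parallel_frame D e ->
  jacobi_operator nabla c e Rt ->
  (forall A : R -> 'M[R]_7, jacobi_tensor Rt A ->
     forall t : R,
       (\sum_(k < n) ((k`!%:R)^-1 * t ^+ k) *: beta Rt k 0)
         @[n --> \oo] --> A t) /\
  (forall k : nat,
     beta Rt k 0 = F k (Rt 0) (derive1 Rt 0) (derive1 (derive1 Rt) 0)).
Proof.
exists (fun k A B C => beta (fun t => A + sin t *: B + (1 - cos t) *: C) k 0).
move=> gamma c D e Rt [sc Sc _ _] cdD geoD unitc pe jR.
have [L [dRt LLRt RtLL]] := jacobi_operator_rotation nablaLC sc Sc cdD geoD unitc pe jR.
have rot t : is_mxderive Rt t (brk L (Rt t)).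
  by move=> k l; rewrite [brk _ _ _ _]mxE; exact: dRt.
split=> [A jA t|k]; first exact: (jacobi_series rot).
congr (beta _ k 0); apply/funext => t.
exact: (rotation_formula rot LLRt RtLL).
Qed.
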